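(* Let $(M^{3},\varphi,\xi,\eta,g)$ be a $3$-dimensional almost contact metric manifold with $h\neq0$ at every point, and let $\kappa,\mu$ be smooth functions on $M$ such that $d\kappa\wedge\eta=0$. Then $M^{3}$ is an almost Kenmotsu generalized $(\kappa,\mu)$-manifold if and only if for any point $p\in M$ there exists an open neighbourhood $U$ of $p$ with coordinates $x_1,x_2,t$ such that $\kappa=-1-e^{-4t}$ on $U$, $\mu$ only depends on $t$ on $U$, the tensor fields of the structure are expressed on $U$ as $$\varphi=\sum_{i,j=1}^{2}\varphi^{i}_{j}\,dx_{j}\otimes\frac{\partial}{\partial x_{i}}, \quad \xi=\frac{\partial}{\partial t}, \quad \eta=dt, \quad g=dt\otimes dt+\sum_{i,j=1}^{2} g_{ij}\,dx_{i}\otimes dx_{j},$$ where $\varphi^{i}_{j},g_{ij}$ are functions only of $t$; the fundamental $2$-form is $\Phi=e^{2t}\, dx_{1} \wedge dx_{2}$; and the non-zero components $h^{i}_{j}, B^{i}_{j}$ $(i,j\in\{1,2\})$ in $U$ of $h$ and $B:=\varphi h$, respectively, are functions of $t$ satisfying the condition $\sum_{s=1}^2 B^{i}_{s}B^{s}_{j}=e^{-4t}\delta_{j}^{i}$ and the system of differential equations $$\frac{d \varphi^{i}_{j}}{dt}=2h^{i}_{j}, \quad \frac{d h^{i}_{j}}{dt}=2\lambda^2\varphi^{i}_{j}-2h^{i}_{j}-\mu B^{i}_{j}, \quad \frac{d B^{i}_{j}}{dt}=\mu h^{i}_{j}-2B^{i}_{j},$$ where $\lambda=e^{-2t}$.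
   Context: All manifolds are smooth and connected. An almost contact metric manifold $(M^{2n+1},\varphi,\xi,\eta,g)$ is a manifold with a $(1,1)$-tensor field $\varphi$, a vector field $\xi$, a $1$-form $\eta$ and a Riemannian metric $g$ such that $\varphi^2=-I+\eta\otimes\xi$, $\eta(\xi)=1$ and $g(\varphi X,\varphi Y)=g(X,Y)-\eta(X)\eta(Y)$. Its fundamental $2$-form is $\Phi(X,Y)=g(X,\varphi Y)$ (so $\Phi=e^{2t}dx_1\wedge dx_2$ means $\Phi(\partial/\partial x_1,\partial/\partial x_2)=e^{2t}$ and $\Phi(\partial/\partial t,\cdot)=0$). It is almost Kenmotsu if $d\eta=0$ and $d\Phi=2\eta\wedge\Phi$. Put $h:=\frac12\mathcal{L}_{\xi}\varphi$, where $\mathcal L$ is the Lie derivative. Components of a $(1,1)$-tensor field $T$ are given by $T(\partial/\partial x_j)=\sum_i T^i_j\,\partial/\partial x_i$ (all components of $h$ and $B$ involving the $t$-direction vanish). With $R(X,Y)=[\nabla_X,\nabla_Y]-\nabla_{[X,Y]}$ ($\nabla$ the Levi-Civita connection of $g$), an almost Kenmotsu manifold is called a generalized $(\kappa,\mu)$-manifold, for smooth functions $\kappa,\mu$ on $M$, if for all vector fields $X,Y$: $R(X,Y)\xi=\kappa(\eta(Y)X-\eta(X)Y)+\mu(\eta(Y)hX-\eta(X)hY)$. *)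

(* Defs.v *)
From HB Require Import structures.
From mathcomp Require Import all_boot all_order all_algebra.
From mathcomp Require Import all_classical all_reals all_analysis.

Set Implicit Arguments.
Unset Strict Implicit.
Unset Printing Implicit Defensive.

Import Order.TTheory GRing.Theory Num.Theory.
Import numFieldNormedType.Exports.

Local Open Scope classical_set_scope.
Local Open Scope ring_scope.

(* Conventions.  Tensor fields on a manifold are given, in the classical way,
   by their components in every chart of the (maximal) smooth atlas, the
   components in two charts being related by the usual transformation law.
   Components are functions of the coordinates, i.e. on 'rV[R]_n, of which
   only the values on the image of the chart matter:
     vector field X     :  'cV, X = \sum_i X i 0 d/dx_i;
     1-form w           :  'rV, w = \sum_i w 0 i dx_i, so w(X) is w *m X;
     (1,1)-tensor T     :  'M,  T(d/dx_j) = \sum_i T i j d/dx_i, so T(X) is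
                           T *m X and composition is *m;
     (0,2)-tensor b     :  'M,  b(d/dx_i, d/dx_j) = b i j. *)

Definition partial (R : realType) (n : nat) (i : 'I_n) (f : 'rV[R]_n -> R)
  : 'rV[R]_n -> R := fun x => 'D_(delta_mx 0 i) f x.

Fixpoint Ck (R : realType) (n k : nat) (O : set 'rV[R]_n)
    (f : 'rV[R]_n -> R) : Prop :=
  (forall x, O x -> {for x, continuous f}) /\
  if k is k'.+1 then
    forall i : 'I_n, (forall x, O x -> derivable f x (delta_mx 0 i)) /\
                     Ck k' O (partial i f)
  else True.

(* Only meant for open O: the definition looks at f near each point of O. *)
Definition smooth_on (R : realType) (n : nat) (O : set 'rV[R]_n)
    (f : 'rV[R]_n -> R) : Prop := forall k, Ck k O f.

(* A homeomorphism from the open set [dom] of M onto an open set of R^n;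
   [coord] and its inverse [param] are total functions whose values outside
   [dom] and its image are irrelevant. *)
Record chart (R : realType) (n : nat) (M : topologicalType) := Chart {
  dom : set M;
  coord :> M -> 'rV[R]_n;
  param : 'rV[R]_n -> M;
  dom_open : open dom;
  coord_dom_open : open (coord @` dom);
  coordK : forall p, dom p -> param (coord p) = p;
  coord_continuous : {within dom, continuous coord};
  param_continuous : {within coord @` dom, continuous param} }.

Definition img (R : realType) (n : nat) (M : topologicalType)
  (c : chart R n M) : set 'rV[R]_n := c @` dom c.

Definition transition_smooth (R : realType) (n : nat) (M : topologicalType)
    (a b : chart R n M) : Prop :=
  forall i : 'I_n,
    smooth_on (a @` (dom a `&` dom b)) (fun x => b (param a x) 0 i).

Record manifold (R : realType) (n : nat) := Manifold {
  carrier :> topologicalType;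
  manifold_hausdorff : hausdorff_space carrier;
  manifold_second_countable : @second_countable carrier;
  manifold_connected : connected [set: carrier];
  atlas : set (chart R n carrier);
  atlas_cover : forall p : carrier, exists2 c, atlas c & dom c p;
  atlas_compat : forall a b, atlas a -> atlas b -> transition_smooth a b;
  atlas_max : forall c,
    (forall a, atlas a -> transition_smooth a c /\ transition_smooth c a) ->
    atlas c }.

Arguments atlas {R n} m _.

Definition smooth_fun (R : realType) (n : nat) (M : manifold R n)
    (f : M -> R) : Prop :=
  forall c, atlas M c -> smooth_on (img c) (f \o param c).

(* d b_i / d a_j, as a function of the coordinates in a *)
Definition transition_jac (R : realType) (n : nat) (M : topologicalType)
    (a b : chart R n M) (x : 'rV[R]_n) : 'M[R]_n :=
  \matrix_(i, j) partial j (fun y => b (param a y) 0 i) x.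

Definition smooth_components (R : realType) (n : nat) (M : manifold R n)
    (p q : nat) (T : chart R n M -> 'rV[R]_n -> 'M[R]_(p, q)) : Prop :=
  forall c, atlas M c -> forall i j, smooth_on (img c) (fun x => T c x i j).

Definition transformation_law (R : realType) (n : nat) (M : manifold R n)
    (p q : nat) (T : chart R n M -> 'rV[R]_n -> 'M[R]_(p, q))
    (law : 'M[R]_n -> 'M[R]_(p, q) -> 'M[R]_(p, q) -> Prop) : Prop :=
  forall a b, atlas M a -> atlas M b -> forall x : M, dom a x -> dom b x ->
    law (transition_jac a b (a x)) (T a (a x)) (T b (b x)).

Record vector_field (R : realType) (n : nat) (M : manifold R n) :=
  VectorField {
    vf_comp :> chart R n M -> 'rV[R]_n -> 'cV[R]_n;
    vf_smooth : smooth_components vf_comp;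
    vf_law : transformation_law vf_comp (fun J Xa Xb => Xb = J *m Xa) }.

Record one_form (R : realType) (n : nat) (M : manifold R n) :=
  OneForm {
    of_comp :> chart R n M -> 'rV[R]_n -> 'rV[R]_n;
    of_smooth : smooth_components of_comp;
    of_law : transformation_law of_comp (fun J wa wb => wb *m J = wa) }.

Record tensor11 (R : realType) (n : nat) (M : manifold R n) :=
  Tensor11 {
    t11_comp :> chart R n M -> 'rV[R]_n -> 'M[R]_n;
    t11_smooth : smooth_components t11_comp;
    t11_law : transformation_law t11_comp (fun J Ta Tb => Tb *m J = J *m Ta) }.

Record riemannian_metric (R : realType) (n : nat) (M : manifold R n) :=
  RiemannianMetric {
    rm_comp :> chart R n M -> 'rV[R]_n -> 'M[R]_n;
    rm_smooth : smooth_components rm_comp;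
    rm_law : transformation_law rm_comp (fun J ga gb => J^T *m gb *m J = ga);
    rm_sym : forall c, atlas M c -> forall x, img c x ->
      (rm_comp c x)^T = rm_comp c x;
    rm_pos : forall c, atlas M c -> forall x, img c x ->
      forall v : 'cV[R]_n, v != 0 -> 0 < (v^T *m rm_comp c x *m v) 0 0 }.

Definition lie_bracket (R : realType) (n : nat) (X Y : 'rV[R]_n -> 'cV[R]_n)
    (x : 'rV[R]_n) : 'cV[R]_n :=
  \col_k \sum_i (X x i 0 * partial i (fun y => Y y k 0) x
               - Y x i 0 * partial i (fun y => X y k 0) x).

(* (L_X T)(Y) = [X, T Y] - T [X, Y] for Y = d/dx_j *)
Definition lie_deriv11 (R : realType) (n : nat) (X : 'rV[R]_n -> 'cV[R]_n)
    (T : 'rV[R]_n -> 'M[R]_n) (x : 'rV[R]_n) : 'M[R]_n :=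
  \matrix_(i, j) \sum_k (X x k 0 * partial k (fun y => T y i j) x
                       - T x k j * partial k (fun y => X y i 0) x
                       + T x i k * partial j (fun y => X y k 0) x).

Definition christoffel (R : realType) (n : nat) (g : 'rV[R]_n -> 'M[R]_n)
    (k i j : 'I_n) (x : 'rV[R]_n) : R :=
  2^-1 * \sum_l invmx (g x) k l *
    (partial i (fun y => g y j l) x + partial j (fun y => g y i l) x
     - partial l (fun y => g y i j) x).

(* nabla_X Y for the Levi-Civita connection of g *)
Definition levi_civita (R : realType) (n : nat) (g : 'rV[R]_n -> 'M[R]_n)
    (X Y : 'rV[R]_n -> 'cV[R]_n) (x : 'rV[R]_n) : 'cV[R]_n :=
  \col_k (\sum_i X x i 0 * partial i (fun y => Y y k 0) x
          + \sum_i \sum_j christoffel g k i j x * X x i 0 * Y x j 0).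

Definition curvature (R : realType) (n : nat) (g : 'rV[R]_n -> 'M[R]_n)
    (X Y Z : 'rV[R]_n -> 'cV[R]_n) (x : 'rV[R]_n) : 'cV[R]_n :=
  levi_civita g X (levi_civita g Y Z) x - levi_civita g Y (levi_civita g X Z) x
  - levi_civita g (lie_bracket X Y) Z x.

(* (w1 /\ w2)(X, Y) = w1(X) w2(Y) - w1(Y) w2(X) *)
Definition wedge11 (R : realType) (n : nat) (w1 w2 : 'rV[R]_n) : 'M[R]_n :=
  \matrix_(i, j) (w1 0 i * w2 0 j - w1 0 j * w2 0 i).

Definition wedge12 (R : realType) (n : nat) (w : 'rV[R]_n) (b : 'M[R]_n)
    (i j k : 'I_n) : R :=
  w 0 i * b j k + w 0 j * b k i + w 0 k * b i j.

Definition d0 (R : realType) (n : nat) (f : 'rV[R]_n -> R) (x : 'rV[R]_n)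
  : 'rV[R]_n := \row_i partial i f x.

Definition d1 (R : realType) (n : nat) (w : 'rV[R]_n -> 'rV[R]_n)
    (x : 'rV[R]_n) : 'M[R]_n :=
  \matrix_(i, j) (partial i (fun y => w y 0 j) x
                - partial j (fun y => w y 0 i) x).

Definition d2 (R : realType) (n : nat) (b : 'rV[R]_n -> 'M[R]_n)
    (x : 'rV[R]_n) (i j k : 'I_n) : R :=
  partial i (fun y => b y j k) x + partial j (fun y => b y k i) x
  + partial k (fun y => b y i j) x.

(* The axioms force n to be odd. *)
Record almost_contact_metric (R : realType) (n : nat) (M : manifold R n) :=
  AlmostContactMetric {
    acm_phi : tensor11 M;
    acm_xi : vector_field M;
    acm_eta : one_form M;
    acm_g : riemannian_metric M;
    acm_phi2 : forall c, atlas M c -> forall x, img c x ->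
      acm_phi c x *m acm_phi c x = - 1%:M + acm_xi c x *m acm_eta c x;
    acm_eta_xi : forall c, atlas M c -> forall x, img c x ->
      acm_eta c x *m acm_xi c x = 1%:M;
    (* g(phi X, phi Y) = g(X, Y) - eta(X) eta(Y) *)
    acm_compat : forall c, atlas M c -> forall x, img c x ->
      (acm_phi c x)^T *m acm_g c x *m acm_phi c x =
      acm_g c x - (acm_eta c x)^T *m acm_eta c x }.

(* Phi(X, Y) = g(X, phi Y) *)
Definition acm_Phi (R : realType) (n : nat) (M : manifold R n)
    (S : almost_contact_metric M) : chart R n M -> 'rV[R]_n -> 'M[R]_n :=
  fun c x => acm_g S c x *m acm_phi S c x.

Definition acm_h (R : realType) (n : nat) (M : manifold R n)
    (S : almost_contact_metric M) : chart R n M -> 'rV[R]_n -> 'M[R]_n :=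
  fun c x => 2^-1 *: lie_deriv11 (acm_xi S c) (acm_phi S c) x.

Definition acm_B (R : realType) (n : nat) (M : manifold R n)
    (S : almost_contact_metric M) : chart R n M -> 'rV[R]_n -> 'M[R]_n :=
  fun c x => acm_phi S c x *m acm_h S c x.

Definition almost_kenmotsu (R : realType) (n : nat) (M : manifold R n)
    (S : almost_contact_metric M) : Prop :=
  forall c, atlas M c -> forall x, img c x ->
    d1 (acm_eta S c) x = 0 /\
    forall i j k, d2 (acm_Phi S c) x i j k =
                  2 * wedge12 (acm_eta S c x) (acm_Phi S c x) i j k.

Definition kappa_mu_condition (R : realType) (n : nat) (M : manifold R n)
    (S : almost_contact_metric M) (kappa mu : M -> R) : Prop :=
  forall X Y : vector_field M,
  forall c, atlas M c -> forall x, img c x ->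
    let eta (Z : vector_field M) := (acm_eta S c x *m Z c x) 0 0 in
    let h := acm_h S c x in
    curvature (acm_g S c) (X c) (Y c) (acm_xi S c) x =
      kappa (param c x) *: (eta Y *: X c x - eta X *: Y c x) +
      mu (param c x) *: (eta Y *: (h *m X c x) - eta X *: (h *m Y c x)).

Definition generalized_kappa_mu (R : realType) (n : nat) (M : manifold R n)
    (S : almost_contact_metric M) (kappa mu : M -> R) : Prop :=
  [/\ almost_kenmotsu S, smooth_fun kappa, smooth_fun mu &
      kappa_mu_condition S kappa mu].

(* The indices of x_1, x_2 and t are 0, 1 and 2, i.e. 'I_3 is read as
   'I_(2 + 1).  [bdiag A a] has the entries of A in the directions x_1, x_2,
   the entry a in the direction (t, t), and vanishing mixed entries. *)
Definition ix1 : 'I_3 := @Ordinal 3 0 isT.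
Definition ix2 : 'I_3 := @Ordinal 3 1 isT.
Definition it : 'I_3 := @Ordinal 3 2 isT.

Definition bdiag (R : realType) (A : 'M[R]_2) (a : R) : 'M[R]_3 :=
  @block_mx R 2 1 2 1 A 0 0 a%:M.

Definition dx (R : realType) (i : 'I_3) : 'rV[R]_3 := delta_mx 0 i.

Definition ddx (R : realType) (i : 'I_3) : 'cV[R]_3 := delta_mx i 0.

(* Main.v *)
Require Import Defs.
From HB Require Import structures.
From mathcomp Require Import all_boot all_order all_algebra.
From mathcomp Require Import perm.
From mathcomp Require Import all_classical all_reals all_analysis.
From mathcomp Require Import ring lra.
Import Order.TTheory GRing.Theory Num.Theory.
Import numFieldNormedType.Exports.
Set Implicit Arguments.
Unset Strict Implicit.
Unset Printing Implicit Defensive.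
Local Open Scope classical_set_scope.
Local Open Scope ring_scope.

(** Why the theorem holds.

    Write [B = phi h] and [A = nabla xi].  On an almost Kenmotsu manifold
    [A = - phi^2 - B] ([nabla_xi]): [d eta = 0] makes [A] self-adjoint, so that it
    is half of [L_xi g], and [L_xi g] is read off from [L_xi Phi = 2 Phi].  Hence
    [R(X, xi)xi = - (L_xi A + A^2) X], and the curvature condition in the
    direction of [xi] says that
      [h^2 = (kappa + 1) phi^2],   [L_xi B = mu h - 2 B],
    from which the formula for [L_xi h] and [xi(kappa) = - 4 (kappa + 1)] follow
    ([h2], [lie_B], [lie_h], [dkappa_xi]).  The formulas for [L_xi phi], [L_xi h]
    and [L_xi B] are the differential equations of the statement, once [xi] is
    [d/dt] and all components depend on [t] only.

    From the structure to the coordinates.  As [h] does not vanish,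
    [kappa < - 1]; so [t = - ln (- 1 - kappa) / 4] is a smooth function, and
    [dt = eta] because [d kappa] is a multiple of [eta].  The field [B] has the
    eigenvalues [lam], [- lam] and [0], with [lam = expR (- 2 t)]; let [u] be a
    unit eigenvector field for [lam] and [v = phi u].  The condition on
    [R(xi, u)xi] gives [[xi, u]] and [[xi, v]] as combinations of [u] and [v] with
    coefficients in [lam] and [mu]; the condition [R(u, v)xi = 0] gives
    [[u, v] = 0]; and then the Jacobi identity shows that [mu] is constant along
    [u] and [v], that is, a function of [t].  A 1-form with values [p(t)], [q(t)],
    [0] on [u], [v], [xi] is closed if and only if [(p, q)] solves a linear
    differential equation ([coframe_closed]).  Two independent solutions give, by
    the Poincare lemma, the coordinates [x1] and [x2]; in the coordinates
    [x1, x2, t] the fields [u], [v], [xi] have components [P(t)], and so [phi] and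
    [g] are functions of [t].  The equation for [P] has trace [- 2], so that the
    initial condition can be chosen with [\det P = - expR (- 2 t)], which makes
    [Phi = expR (2 t) dx1 /\ dx2] ([adapted_chart], [adapted_equations]).

    From the coordinates to the structure.  In an adapted chart [d eta] and
    [d Phi] are computed at once, and the equation for [B] gives back
    [R(X, xi)xi].  On the leaves [t = const] neither [g] nor [A] varies, and
    [R(X, Y)xi = 0] for [X] and [Y] tangent to them ([curv_leaf]).  It remains to
    transport these identities to the other charts of the atlas, for which the
    exterior derivative, the Lie derivative and the Levi-Civita connection are
    shown to be compatible with changes of coordinates ([related_lie],
    [related_levi_civita]).

    The condition on the curvature is tested on vector fields of the whole
    manifold; bump functions show that these take all values at each point
    ([global_field]).  The inverse function theorem provides the new charts
    ([new_chart]).  Throughout, tensors are matrices of components: [dird v T] is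
    the derivative of the components of [T] in the direction [v], [dv X] the
    matrix of the differential of the components of [X], and
    [L_X T = dird X T - dv X T + T dv X]. *)


(** * Functions of several real variables *)

Lemma common_radius {R : realType} (I : finType) (P : I -> R -> Prop) (r0 : R) :
  0 < r0 -> (forall i, exists2 r, 0 < r & P i r) ->
  (forall i r s, s <= r -> P i r -> P i s) ->
  exists r, [/\ 0 < r, r <= r0 & forall i, P i r].
Proof.
move=> r00 exP monoP.
have /choice[s sP] : forall i, exists r, 0 < r /\ P i r.
  by move=> i; have [r ? ?] := exP i; exists r.
exists (\big[Num.min/r0]_i s i); split.
- by apply: lt_bigmin => // i _; have [] := sP i.
- exact: bigmin_le_id.
- move=> i; apply: (monoP i (s i)); last by have [] := sP i.
  exact: bigmin_le_cond.
Qed.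

Section Boxes.
Context {R : realType} {n : nat}.
Implicit Types (x y : 'rV[R]_n) (r : R) (f : 'rV[R]_n -> R).

(** Cubes rather than balls, because the estimates go coordinate by coordinate
    and a box is a product of intervals. *)
Definition box x r : set 'rV[R]_n := [set y | forall i, `|y 0 i - x 0 i| < r].

Lemma box_center x r : 0 < r -> box x r x.
Proof. by move=> r0 i; rewrite subrr normr0. Qed.

Lemma nbhs_box x (A : set 'rV[R]_n) :
  nbhs x A <-> exists2 r, 0 < r & box x r `<=` A.
Proof.
split.
  move=> /nbhs_ballP [r /= r0 rA]; exists r => // y xy; apply: rA.
  by split => // i j; rewrite ord1 /ball /= distrC.
move=> [r r0 rA]; apply/nbhs_ballP; exists r => //= y [_ xy]; apply: rA => i.
by have := xy 0 i; rewrite /ball /= distrC.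
Qed.

Lemma box_open x r : open (box x r).
Proof.
rewrite openE => y yr; apply/nbhs_box.
pose s := \big[Num.min/1]_(i < n) (r - `|y 0 i - x 0 i|).
exists s.
  by apply: lt_bigmin => // i _; rewrite subr_gt0.
move=> z zs i; rewrite -[z 0 i](subrK (y 0 i)) -addrA.
apply: (le_lt_trans (ler_normD _ _)); rewrite -ltrBrDr.
by apply: lt_le_trans (zs i) _; apply: bigmin_le_cond.
Qed.

Lemma box_sub x r s : r <= s -> box x r `<=` box x s.
Proof. by move=> rs y yr i; apply: lt_le_trans (yr i) rs. Qed.

Lemma open_box (O : set 'rV[R]_n) x :
  open O -> O x -> exists2 r, 0 < r & box x r `<=` O.
Proof. by move=> oO Ox; apply/nbhs_box; apply: open_nbhs_nbhs. Qed.

Lemma continuous_box f x : {for x, continuous f} <->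
  forall e, 0 < e -> exists2 r, 0 < r & forall y, box x r y -> `|f y - f x| < e.
Proof.
split.
  move=> fx0; have fx : f y @[y --> x] --> f x := fx0.
  move/cvgrPdist_lt : fx => fx e e0; have /nbhs_box[r r0 rA] := fx e e0.
  by exists r => // y /rA /=; rewrite distrC.
move=> H; suff : f y @[y --> x] --> f x by [].
apply/(@cvgrPdist_lt _ _ _ _ (nbhs_filter x)) => e e0; have [r r0 rA] := H e e0.
by apply/nbhs_box; exists r => // y /rA /=; rewrite distrC.
Qed.

Lemma norm_box x y r : 0 < r -> `|y - x| < r <-> box x r y.
Proof.
move=> r0; have := @mx_norm_ball R 1 n; rewrite predeq3E => /(_ x r y).
rewrite /ball_ /= [ `|x - y|]distrC => <-; split.
  by case=> _ xy i; have := xy 0 i; rewrite /ball /= distrC.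
by move=> xy; split => // i j; rewrite ord1 /ball /= distrC.
Qed.

Lemma norm_coord_le x i : `|x 0 i| <= `|x|.
Proof.
rewrite [leRHS]/Num.Def.normr/= mx_normrE.
exact: (@le_bigmax _ _ _ _ (fun ij : 'I_1 * 'I_n => `|x ij.1 ij.2|) (0, i)).
Qed.

End Boxes.

Section OneVariable.
Context {R : realType}.
Implicit Types (g : R -> R) (a b c e s : R).

Lemma is_derive_continuous g s d : is_derive s 1 g d -> {for s, continuous g}.
Proof.
by case=> dg _; apply: differentiable_continuous; apply/derivable1_diffP.
Qed.

(** The mean value inequality applied to [g - c id], the form in which it
    bounds the remainder of a first-order expansion. *)
Lemma mvt_le g (g' : R -> R) a b c e :
  (forall s, Num.min a b <= s <= Num.max a b ->
     is_derive s 1 g (g' s) /\ `|g' s - c| <= e) ->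
  `|g b - g a - c * (b - a)| <= e * `|b - a|.
Proof.
wlog ab : a b / a <= b.
  move=> W H; have [/W|/ltW ba] := leP a b; first exact.
  have := W b a ba; rewrite minC maxC => /(_ H).
  rewrite [ `|a - b|]distrC; congr (_ <= _); rewrite -normrN; congr (`|_|); ring.
rewrite (min_idPl ab) (max_idPr ab) => H.
have dg s : s \in `]a, b[ -> is_derive s 1 g (g' s).
  by rewrite in_itv => /= /andP[/ltW sa /ltW sb]; have [] := H s _; rewrite ?sa.
have cg : {within `[a, b], continuous g}.
  apply: derivable_within_continuous => s; rewrite in_itv => /= sab.
  by have [[]] := H s sab.
have [s sab ->] := MVT_segment ab dg cg.
rewrite -mulrBl normrM ler_wpM2r //.
by move: sab; rewrite in_itv => /= /H[].
Qed.

Lemma derive_zero_const g a b :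
  (forall s, Num.min a b <= s <= Num.max a b -> is_derive s 1 g 0) -> g b = g a.
Proof.
move=> H; apply/eqP; rewrite -subr_eq0 -normr_le0.
have K := @mvt_le g (fun=> 0) a b 0 0.
rewrite !mul0r (subr0 (g b - g a)) in K; apply: K => s /H ?.
by split => //; rewrite /= ?subrr ?normr0.
Qed.

End OneVariable.

Section Lines.
Context {R : realType} {V W : normedModType R}.

Lemma shift_line_derive (f : V -> W) x v s l :
  is_derive (x + s *: v) v f l <-> is_derive s 1 (fun t : R => f (x + t *: v)) l.
Proof.
set g := fun t : R => f (x + t *: v).
have E : (fun h : R => h^-1 *: ((f \o shift (x + s *: v)) (h *: v)
            - f (x + s *: v))) =
  (fun h : R => h^-1 *: ((g \o shift s) (h *: (1 : R)) - g s)).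
  apply/funext => h; rewrite /g /=; congr (_ *: (f _ - _)).
  by rewrite [h%:A]mulr1 scalerDl addrCA.
have E1 : derivable f (x + s *: v) v = derivable g s 1.
  by rewrite /derivable E.
have E2 : 'D_v f (x + s *: v) = 'D_1 g s by rewrite /derive E.
by split=> -[H1 H2]; apply: DeriveDef; first [by rewrite E1|by rewrite -E1|
  by rewrite E2|by rewrite -E2].
Qed.

Lemma line_derive0 (f : V -> W) x v l :
  is_derive x v f l <-> is_derive (0 : R) 1 (fun t : R => f (x + t *: v)) l.
Proof.
by have := shift_line_derive f x v 0 l; rewrite {1}scale0r addr0.
Qed.

End Lines.

Section SeveralVariables.
Context {R : realType} {n : nat}.
Implicit Types (x y : 'rV[R]_n) (r : R) (f : 'rV[R]_n -> R) (O : set 'rV[R]_n).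

Local Notation e_ i := (delta_mx 0 i : 'rV[R]_n).

(** Going from one point to the other along one coordinate at a time stays in
    the box and involves the partial derivatives only. *)
Lemma box_mvt f x0 r e (a : 'I_n -> R) :
  (forall y, box x0 r y -> forall i,
     derivable f y (e_ i) /\ `|partial i f y - a i| <= e) ->
  forall x x', box x0 r x -> box x0 r x' ->
  `|f x' - f x - \sum_i a i * (x' 0 i - x 0 i)| <=
  \sum_i e * `|x' 0 i - x 0 i|.
Proof.
move=> H x x' xr x'r.
pose z k : 'rV[R]_n := \row_i (if (i < k)%N then x' 0 i else x 0 i).
have -> : f x' - f x = \sum_(i < n) (f (z i.+1) - f (z i)).
  rewrite -(big_mkord xpredT (fun i => f (z i.+1) - f (z i))) telescope_sumr //.
  congr (f _ - f _); apply/rowP => i; rewrite mxE ?ltn_ord //.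
rewrite -sumrB; apply: (le_trans (ler_norm_sum _ _ _)); apply: ler_sum => i _.
set d := x' 0 i - x 0 i.
have zE : z i.+1 = z i + d *: e_ i.
  apply/rowP => j; rewrite !mxE eqxx /= ltnS leq_eqVlt.
  have [->|ij] := eqVneq j i; first by rewrite eqxx ltnn mulr1 addrC subrK.
  by rewrite (negPf (ij : val j != val i)) mulr0 addr0.
have := @mvt_le _ (fun s : R => f (z i + s *: e_ i))
  (fun s => partial i f (z i + s *: e_ i)) 0 d (a i) e.
rewrite scale0r addr0 -zE !subr0; apply=> s sd.
have zr : box x0 r (z i + s *: e_ i).
  move=> j; rewrite !mxE eqxx /=.
  have [->|ij] := eqVneq j i; last by rewrite mulr0 addr0; case: ifP.
  rewrite ltnn mulr1.
  move: sd (xr i) (x'r i); rewrite /d !ltr_norml.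
  have [d0|d0] := leP 0 (x' 0 i - x 0 i) => /andP[s1 s2] /andP[? ?] /andP[? ?];
    apply/andP; split; lra.
have [dz az] := H _ zr i.
exact: (conj ((shift_line_derive f _ _ _ _).1 (DeriveDef dz erefl)) az).
Qed.

Lemma near_open O x (P : 'rV[R]_n -> Prop) :
  open O -> O x -> (forall y, O y -> P y) -> \forall y \near x, P y.
Proof. by move=> oO Ox H; apply: filterS H _; apply: open_nbhs_nbhs. Qed.

Lemma partial_ext O f g i x : open O -> O x -> (forall y, O y -> f y = g y) ->
  partial i f x = partial i g x.
Proof. by move=> oO Ox fg; apply: near_eq_derive; apply: near_open fg. Qed.

Lemma derivable_ext O f g x v : open O -> O x -> (forall y, O y -> f y = g y) ->
  derivable f x v -> derivable g x v.
Proof. by move=> oO Ox fg; apply: near_eq_derivable; apply: near_open fg. Qed.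

Lemma continuous_ext O f g x : open O -> O x -> (forall y, O y -> f y = g y) ->
  {for x, continuous f} -> {for x, continuous g}.
Proof.
move=> oO Ox fg /continuous_box fx; apply/continuous_box => e e0.
have [r r0 fr] := fx e e0; have [s s0 sO] := open_box oO Ox.
exists (Num.min r s) => [|y ym]; first by rewrite lt_min r0.
rewrite -!fg //; first by apply: fr; apply: box_sub ym; rewrite ge_min lexx.
by apply: sO; apply: box_sub ym; rewrite ge_min lexx orbT.
Qed.

Lemma Ck_continuous k O f x : Ck k O f -> O x -> {for x, continuous f}.
Proof. by case: k => [|k] [cf _]; apply: cf. Qed.

Lemma Ck_derivable k O f x i : Ck k.+1 O f -> O x -> derivable f x (e_ i).
Proof. by case=> _ /(_ i)[H _]; apply: H. Qed.

Lemma Ck_partial k O f i : Ck k.+1 O f -> Ck k O (partial i f).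
Proof. by case=> _ /(_ i)[]. Qed.

Lemma Ck_sub k O O' f : O' `<=` O -> Ck k O f -> Ck k O' f.
Proof.
move=> OO'; elim: k f => [|k IH] f [cf df]; first by split => // x /OO'; apply: cf.
split=> [x /OO'|i]; first exact: cf.
by have [H1 H2] := df i; split; [move=> x /OO'; apply: H1|apply: IH].
Qed.

Lemma Ck_ext k O f g : open O -> (forall y, O y -> f y = g y) ->
  Ck k O f -> Ck k O g.
Proof.
move=> oO; elim: k f g => [|k IH] f g fg [cf df].
  by split => // x Ox; apply: continuous_ext fg (cf x Ox).
split=> [x Ox|i]; first exact: continuous_ext fg (cf x Ox).
have [H1 H2] := df i; split=> [x Ox|].
  by apply: derivable_ext fg _ => //; apply: H1.
by apply: IH H2 => x Ox; apply: partial_ext fg.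
Qed.

Lemma CkW k O f : Ck k.+1 O f -> Ck k O f.
Proof.
elim: k f => [|k IH] f [cf df]; first by split.
by split => // i; have [H1 H2] := df i; split => //; apply: IH.
Qed.

Lemma Ck_le k l O f : (k <= l)%N -> Ck l O f -> Ck k O f.
Proof.
move=> kl; rewrite -(subnK kl); elim: (l - k)%N => // m IH /CkW; exact: IH.
Qed.

(** The form in which the closure properties are proved: the partial
    derivatives only have to be known up to equality on the open set. *)
Lemma Ck_step k O f (F : 'I_n -> 'rV[R]_n -> R) : open O ->
  (forall x, O x -> {for x, continuous f}) ->
  (forall i x, O x -> is_derive x (e_ i) f (F i x)) ->
  (forall i, Ck k O (F i)) -> Ck k.+1 O f.
Proof.
move=> oO cf df kF; split => // i; split=> [x Ox|]; first by case: (df i x Ox).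
by apply: Ck_ext (kF i) => // x Ox; case: (df i x Ox).
Qed.

Lemma Ck_is_derive k O f x i : Ck k.+1 O f -> O x ->
  is_derive x (e_ i) f (partial i f x).
Proof. by move=> kf Ox; apply: DeriveDef => //; apply: Ck_derivable kf Ox. Qed.

Lemma Ck_cst k O (a : R) : Ck k O (fun=> a).
Proof.
elim: k a => [|k IH] a; first by split => // x _; apply: cst_continuous.
split=> [x _|i]; first exact: cst_continuous.
split=> [x _|]; first exact: derivable_cst.
suff -> : partial i (fun=> a) = (fun=> 0) by apply: IH.
by apply/funext => x; apply: derive_cst.
Qed.

Lemma is_derive_coord x (v : 'rV[R]_n) i :
  is_derive x v (fun y : 'rV[R]_n => y 0 i) (v 0 i).
Proof.
have df : derivable (id : 'rV[R]_n -> 'rV[R]_n) x v by exact: derivable_id.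
apply: DeriveDef; first by move/derivable_mxP : df; apply.
by have := derive_mx df; rewrite derive_id => /matrixP/(_ 0 i); rewrite mxE.
Qed.

Lemma coord_cont x i : {for x, continuous (fun y : 'rV[R]_n => y 0 i)}.
Proof. by apply: coord_continuous. Qed.

Lemma partial_coord i j x :
  partial i (fun y : 'rV[R]_n => y 0 j) x = (j == i)%:R.
Proof. by rewrite /partial; have [_ ->] := is_derive_coord x (e_ i) j; rewrite mxE. Qed.

Lemma Ck_coord k O i : open O -> Ck k O (fun y : 'rV[R]_n => y 0 i).
Proof.
move=> oO; case: k => [|k]; first by split => // x _; apply: coord_cont.
apply: (@Ck_step _ _ _ (fun j _ => (e_ j) 0 i)) => //.
- by move=> x _; apply: coord_cont.
- by move=> j x _; apply: is_derive_coord.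
- by move=> j; apply: Ck_cst.
Qed.

Lemma CkD k O f g : Ck k O f -> Ck k O g -> open O ->
  Ck k O (fun x => f x + g x).
Proof.
move=> + + oO; elim: k f g => [|k IH] f g kf kg.
  by split => // x Ox; apply: continuousD; [apply: Ck_continuous kf _|
    apply: Ck_continuous kg _].
apply: (@Ck_step _ _ _ (fun i x => partial i f x + partial i g x)) => //.
- by move=> x Ox; apply: continuousD; [apply: Ck_continuous kf _|
    apply: Ck_continuous kg _].
- by move=> i x Ox; apply: is_deriveD; [apply: Ck_is_derive kf _|
    apply: Ck_is_derive kg _].
- by move=> i; apply: IH; apply: Ck_partial.
Qed.

Lemma CkM k O f g : Ck k O f -> Ck k O g -> open O ->
  Ck k O (fun x => f x * g x).
Proof.
move=> + + oO; elim: k f g => [|k IH] f g kf kg.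
  by split => // x Ox; apply: continuousM; [apply: Ck_continuous kf _|
    apply: Ck_continuous kg _].
apply: (@Ck_step _ _ _
  (fun i x => f x * partial i g x + g x * partial i f x)) => //.
- by move=> x Ox; apply: continuousM; [apply: Ck_continuous kf _|
    apply: Ck_continuous kg _].
- by move=> i x Ox; apply: is_deriveM; [apply: Ck_is_derive kf _|
    apply: Ck_is_derive kg _].
- by move=> i; apply: CkD => //; apply: IH; do ?[exact: CkW];
    apply: Ck_partial.
Qed.

Lemma CkN k O f : Ck k O f -> open O -> Ck k O (fun x => - f x).
Proof.
move=> kf oO; have := CkM (Ck_cst k O (-1)) kf oO.
by apply: Ck_ext => // y _; rewrite mulN1r.
Qed.

Lemma CkB k O f g : Ck k O f -> Ck k O g -> open O ->
  Ck k O (fun x => f x - g x).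
Proof. by move=> kf kg oO; apply: CkD => //; apply: CkN. Qed.

Lemma Ck_sum (I : Type) (s : seq I) (P : pred I) k O
    (F : I -> 'rV[R]_n -> R) :
  open O -> (forall i, P i -> Ck k O (F i)) ->
  Ck k O (fun x => \sum_(i <- s | P i) F i x).
Proof.
move=> oO kF; elim: s => [|i s IH].
  by apply: Ck_ext (Ck_cst k O 0) => // y _; rewrite big_nil.
case Pi : (P i); last by apply: Ck_ext IH => // y _; rewrite big_cons Pi.
by apply: Ck_ext (CkD (kF i Pi) IH oO) => // y _; rewrite big_cons Pi.
Qed.

Lemma Ck_prod (I : Type) (s : seq I) (P : pred I) k O
    (F : I -> 'rV[R]_n -> R) :
  open O -> (forall i, P i -> Ck k O (F i)) ->
  Ck k O (fun x => \prod_(i <- s | P i) F i x).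
Proof.
move=> oO kF; elim: s => [|i s IH].
  by apply: Ck_ext (Ck_cst k O 1) => // y _; rewrite big_nil.
case Pi : (P i); last by apply: Ck_ext IH => // y _; rewrite big_cons Pi.
by apply: Ck_ext (CkM (kF i Pi) IH oO) => // y _; rewrite big_cons Pi.
Qed.

End SeveralVariables.

Section Estimates.
Context {R : realType}.
Implicit Types (g : R -> R) (s d e r t : R).

Lemma is_deriveP g s d : is_derive s 1 g d <->
  forall e, 0 < e -> exists2 r, 0 < r &
    forall t, `|t| < r -> `|g (s + t) - g s - d * t| <= e * `|t|.
Proof.
have key t e : t != 0 -> (`|d - t^-1 *: (g (t%:A + s) - g s)| <= e) =
    (`|g (s + t) - g s - d * t| <= e * `|t|).
  move=> t0; rewrite -ler_pdivrMr ?normr_gt0 // -normf_div distrC.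
  congr (`|_| <= _).
  rewrite [t%:A]mulr1 [t + s]addrC mulrBl mulfK // [_ *: _]mulrC //.
split=> [[dg dE] e e0|H].
  have /cvgrPdist_le/(_ e e0) : h^-1 *: (g (h *: (1:R) + s) - g s) @[h --> 0^'] --> d.
    by rewrite -dE; apply: dg.
  rewrite near_withinE => /nbhs_ballP[r /= r0 rH]; exists r => // t tr.
  have [->|t0] := eqVneq t 0; first by rewrite addr0 subrr mulr0 subr0 normr0 mulr0.
  by rewrite -key //; apply: rH => //; rewrite /ball /= sub0r normrN.
have cd : h^-1 *: (g (h *: (1:R) + s) - g s) @[h --> 0^'] --> d.
  apply/cvgrPdist_le => e e0; have [r r0 rH] := H e e0.
  rewrite near_withinE; apply/nbhs_ballP; exists r => //= t.
  rewrite /ball /= sub0r normrN => tr t0; rewrite key //; exact: rH.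
apply: DeriveDef; first by apply/cvg_ex; exists d.
exact: cvg_lim.
Qed.

Lemma is_derive_lipschitz g s d : is_derive s 1 g d ->
  exists2 r, 0 < r &
    forall t, `|t| < r -> `|g (s + t) - g s| <= (`|d| + 1) * `|t|.
Proof.
move=> /is_deriveP/(_ 1 ltr01)[r r0 H]; exists r => // t /H Ht.
rewrite -[g _ - _](subrK (d * t)) mulrDl -normrM addrC.
by apply: (le_trans (ler_normD _ _)); rewrite lerD2l.
Qed.

Lemma is_derive_comp1 (V : normedModType R) (phi : R -> R) (f : V -> R)
    (x v : V) l d :
  is_derive x v f l -> is_derive (f x) 1 phi d ->
  is_derive x v (fun y => phi (f y)) (d * l).
Proof.
move=> /(line_derive0 f) df dphi; apply/(line_derive0 (fun y => phi (f y))).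
have E : f x = f (x + (0 : R) *: v) by rewrite scale0r addr0.
rewrite E in dphi.
exact: (@is_derive1_comp _ phi (fun t : R => f (x + t *: v)) 0 d l dphi df).
Qed.

End Estimates.

Section Chain.
Context {R : realType} {n : nat}.
Implicit Types (x y : 'rV[R]_n) (f : 'rV[R]_n -> R) (O : set 'rV[R]_n).

Local Notation e_ i := (delta_mx 0 i : 'rV[R]_n).

(** Strict differentiability of C1 functions, from the continuity of the
    partial derivatives. *)
Lemma C1_box_estimate O f x : open O -> Ck 1 O f -> O x ->
  forall e, 0 < e -> exists2 r, 0 < r & box x r `<=` O /\
    forall y z, box x r y -> box x r z ->
    `|f z - f y - \sum_i partial i f x * (z 0 i - y 0 i)| <=
    \sum_i e * `|z 0 i - y 0 i|.
Proof.
move=> oO kf Ox e e0; have [r0 r00 r0O] := open_box oO Ox.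
have cf i : exists2 r, 0 < r &
    forall y, box x r y -> `|partial i f y - partial i f x| < e.
  apply: (continuous_box _ _).1 e0.
  by apply: Ck_continuous (Ck_partial _ kf) Ox.
have [i r s rs H y ys|r [r_gt0 rr0 H]] := common_radius r00 cf.
  by apply: H; apply: box_sub ys.
have rO : box x r `<=` O by apply: subset_trans r0O; apply: box_sub.
exists r => //; split=> // y z; apply: box_mvt => w wr i; split.
  by apply: Ck_derivable kf _; apply: rO.
by apply/ltW/H.
Qed.

(** Chain rule along a curve; the chain rule for maps follows by restriction
    to coordinate lines. *)
Lemma chain_line O f (G : R -> 'rV[R]_n) (dG : 'I_n -> R) s :
  open O -> Ck 1 O f -> O (G s) ->
  (forall i, is_derive s 1 (fun t => G t 0 i) (dG i)) ->
  is_derive s 1 (fun t => f (G t)) (\sum_i partial i f (G s) * dG i).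
Proof.
move=> oO kf Os dGi.
pose a i := partial i f (G s).
pose lin t := \sum_i a i * G t 0 i.
pose rho t := f (G t) - lin t.
have dlin : is_derive s 1 lin (\sum_i a i * dG i).
  have -> : lin = \sum_(i < n) (fun t => a i * G t 0 i).
    by apply/funext => t; rewrite fct_sumE.
  by apply: is_derive_sum => k; have := is_deriveZ (a k) (dGi k).
have drho : is_derive s 1 rho 0.
  apply/is_deriveP => e e0.
  pose C := 1 + \sum_i (`|dG i| + 1).
  have C0 : 0 < C.
    by rewrite ltr_wpDr // sumr_ge0 // => i _; rewrite addr_ge0.
  have [r r0 [rO rH]] := C1_box_estimate oO kf Os (divr_gt0 e0 C0).
  have lip i : exists2 r1, 0 < r1 & forall t, `|t| < r1 ->
     `|G (s + t) 0 i - G s 0 i| <= (`|dG i| + 1) * `|t| /\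
     `|G (s + t) 0 i - G s 0 i| < r.
    have [r1 r10 H1] := is_derive_lipschitz (dGi i).
    have d1 : 0 < `|dG i| + 1 by rewrite ltr_wpDl.
    exists (Num.min r1 (r / (`|dG i| + 1))).
      by rewrite lt_min r10 divr_gt0.
    move=> t; rewrite lt_min => /andP[/H1 H2 tr]; split=> //.
    by apply: (le_lt_trans H2); move: tr; rewrite ltr_pdivlMr // mulrC.
  have [i r1 r2 r12 H t tr|r1 [r10 _ H]] := common_radius ltr01 lip.
    by apply: H; apply: lt_le_trans r12.
  exists r1 => // t tr1; have lipt i := H i t tr1.
  have := rH (G s) (G (s + t)) (box_center _ r0) (fun i => (lipt i).2).
  rewrite mul0r subr0 /rho.
  have -> : f (G (s + t)) - lin (s + t) - (f (G s) - lin s) =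
    f (G (s + t)) - f (G s) - \sum_i a i * (G (s + t) 0 i - G s 0 i).
    rewrite (eq_bigr (fun i => a i * G (s + t) 0 i - a i * G s 0 i)); last first.
      by move=> i _; rewrite mulrBr.
    by rewrite sumrB /lin; ring.
  move=> /le_trans; apply; rewrite -mulr_sumr mulrAC ler_pdivrMr //.
  rewrite -mulrA ler_wpM2l ?(ltW e0) //.
  apply: (@le_trans _ _ (\sum_i (`|dG i| + 1) * `|t|)).
    by apply: ler_sum => i _; have [] := lipt i.
  by rewrite -mulr_suml mulrC ler_wpM2l // /C lerDr.
have -> : (fun t => f (G t)) = rho + lin.
  by apply/funext => t; rewrite /rho fctE subrK.
by rewrite -[X in is_derive _ _ _ X]add0r; apply: is_deriveD.
Qed.

Lemma is_derive_line O f x v s : open O -> Ck 1 O f -> O (x + s *: v) ->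
  is_derive s 1 (fun t => f (x + t *: v))
    (\sum_i partial i f (x + s *: v) * v 0 i).
Proof.
move=> oO kf Ox.
apply: (chain_line (G := fun t => x + t *: v) (dG := fun i => v 0 i) oO kf Ox).
move=> i; have := is_derive_coord (x + s *: v) v i.
exact: (shift_line_derive (fun y : 'rV[R]_n => y 0 i) x v s _).1.
Qed.

End Chain.

Section Composition.
Context {R : realType} {n m : nat}.
Implicit Types (x y : 'rV[R]_n) (O : set 'rV[R]_n) (Q : set 'rV[R]_m).
Implicit Types (f : 'rV[R]_m -> R) (F : 'rV[R]_n -> 'rV[R]_m).

Lemma is_derive_comp Q f F x v (l : 'I_m -> R) : open Q -> Ck 1 Q f ->
  Q (F x) -> (forall j, is_derive x v (fun y => F y 0 j) (l j)) ->
  is_derive x v (fun y => f (F y)) (\sum_j partial j f (F x) * l j).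
Proof.
move=> oO kf OF dF.
have E : x + (0 : R) *: v = x by rewrite scale0r addr0.
apply/(line_derive0 (fun y => f (F y))).
have := @chain_line _ _ Q f (fun t => F (x + t *: v)) l 0 oO kf.
rewrite E; apply => // j.
exact: ((line_derive0 (fun y => F y 0 j) _ _ _).1 (dF j)).
Qed.

Lemma continuous_comp_box f F x : {for F x, continuous f} ->
  (forall j, {for x, continuous (fun y => F y 0 j)}) ->
  {for x, continuous (fun y => f (F y))}.
Proof.
move=> /continuous_box cf cF; apply/continuous_box => e e0.
have [r r0 rH] := cf e e0.
have cFr j : exists2 s, 0 < s &
    forall y, box x s y -> `|F y 0 j - F x 0 j| < r.
  exact: (continuous_box _ _).1 r0.
have [j r1 s rs H y ys|s [s0 _ H]] := common_radius ltr01 cFr.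
  by apply: H; apply: box_sub ys.
by exists s => // y ys; apply: rH => j; apply: H.
Qed.

Lemma Ck_comp k O Q f F : open O -> open Q -> Ck k Q f ->
  (forall j, Ck k O (fun y => F y 0 j)) -> (forall x, O x -> Q (F x)) ->
  Ck k O (fun y => f (F y)).
Proof.
move=> oO oQ + + OQ; elim: k f => [|k IH] f kf kF.
  split=> // x Ox; apply: continuous_comp_box.
    by apply: Ck_continuous kf _; apply: OQ.
  by move=> j; apply: Ck_continuous (kF j) Ox.
apply: (@Ck_step _ _ _ _ _ (fun i x => \sum_j partial j f (F x) *
    partial i (fun y => F y 0 j) x)) => //.
- move=> x Ox; apply: continuous_comp_box.
    by apply: Ck_continuous kf _; apply: OQ.
  by move=> j; apply: Ck_continuous (kF j) Ox.
- move=> i x Ox; apply: (is_derive_comp oQ); last 1 first.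
  + by move=> j; apply: Ck_is_derive (kF j) Ox.
  + exact: Ck_le kf.
  + exact: OQ.
- move=> i; apply: Ck_sum => // j _; apply: CkM => //.
    by apply: IH; [exact: Ck_partial|move=> l; apply: CkW].
  by apply: (Ck_partial (f := fun y => F y 0 j)).
Qed.

Lemma partial_comp O Q f F i x : open O -> open Q -> Ck 1 Q f ->
  (forall j, Ck 1 O (fun y => F y 0 j)) -> O x -> Q (F x) ->
  partial i (fun y => f (F y)) x =
  \sum_j partial j f (F x) * partial i (fun y => F y 0 j) x.
Proof.
move=> oO oQ kf kF Ox OF.
have [_ <- //] : is_derive x (delta_mx 0 i) (fun y => f (F y))
  (\sum_j partial j f (F x) * partial i (fun y => F y 0 j) x).
apply: (is_derive_comp oQ) => // j; exact: Ck_is_derive (kF j) Ox.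
Qed.

End Composition.

Section Elementary.
Context {R : realType} {n : nat}.
Implicit Types (f : 'rV[R]_n -> R) (O : set 'rV[R]_n).

Lemma Ck_comp1 k O (D : set R) (phi phi' : R -> R) f : open O ->
  (forall s, D s -> is_derive s 1 phi (phi' s)) ->
  (forall x, O x -> D (f x)) -> Ck k.+1 O f ->
  Ck k O (fun x => phi' (f x)) -> Ck k.+1 O (fun x => phi (f x)).
Proof.
move=> oO dphi OD kf kphi.
apply: (@Ck_step _ _ _ _ _ (fun i x => phi' (f x) * partial i f x)) => //.
- move=> x Ox; apply: (@continuous_comp _ _ _ f phi).
    exact: Ck_continuous kf Ox.
  by apply: is_derive_continuous (dphi _ (OD x Ox)).
- move=> i x Ox; apply: is_derive_comp1; first exact: Ck_is_derive kf Ox.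
  by apply: dphi; apply: OD.
- by move=> i; apply: CkM => //; apply: Ck_partial.
Qed.

Lemma CkV k O f : open O -> (forall x, O x -> f x != 0) -> Ck k O f ->
  Ck k O (fun x => (f x)^-1).
Proof.
move=> oO f0; elim: k => [|k IH] kf.
  by split=> // x Ox; apply: continuousV; [apply: f0|apply: Ck_continuous kf Ox].
apply: (Ck_comp1 (D := [set s | s != 0]) (phi := fun s => s^-1)
  (phi' := fun s => - s ^- 2 * 1)) => //.
  by move=> s s0; apply: is_deriveV.
have kV := IH (CkW kf).
have := CkN (CkM kV kV oO) oO; apply: Ck_ext => // y _.
by rewrite mulr1 expr2 invfM.
Qed.

Lemma Ck_expR k O f : open O -> Ck k O f -> Ck k O (fun x => expR (f x)).
Proof.
move=> oO; elim: k => [|k IH] kf.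
  split=> // x Ox; apply: (@continuous_comp _ _ _ f (@expR R)).
    exact: Ck_continuous kf Ox.
  exact: continuous_expR.
exact: (Ck_comp1 (D := setT) oO (fun s _ => is_derive_expR s)
  (fun _ _ => I) kf (IH (CkW kf))).
Qed.

Lemma Ck_ln k O f : open O -> (forall x, O x -> 0 < f x) -> Ck k O f ->
  Ck k O (fun x => ln (f x)).
Proof.
move=> oO f0; case: k => [|k] kf.
  split=> // x Ox; apply: (@continuous_comp _ _ _ f (@ln R)).
    exact: Ck_continuous kf Ox.
  by apply: continuous_ln; apply: f0.
have f1 x : O x -> f x != 0 by move=> /f0 /lt0r_neq0.
exact: (Ck_comp1 (D := [set s | 0 < s]) oO (fun s s0 => is_derive1_ln s0)
  f0 kf (CkV oO f1 (CkW kf))).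
Qed.

End Elementary.

(** * Symmetry of second derivatives, fields of matrices *)

Section Schwarz.
Context {R : realType} {n : nat}.
Implicit Types (x y : 'rV[R]_n) (f : 'rV[R]_n -> R) (O : set 'rV[R]_n).

Local Notation e_ i := (delta_mx 0 i : 'rV[R]_n).

(** The second difference is a first difference of [f (. + k e_j) - f], to
    which the mean value inequality applies; its limit is a mixed partial
    derivative. *)
Lemma second_difference O f x i j : open O -> Ck 2 O f -> O x ->
  forall e, 0 < e -> exists2 r, 0 < r & forall h k, `|h| < r -> `|k| < r ->
    `|f (x + h *: e_ i + k *: e_ j) - f (x + h *: e_ i)
      - (f (x + k *: e_ j) - f x) - partial j (partial i f) x * k * h|
    <= e * `|k| * `|h|.
Proof.
move=> oO kf Ox e e0.
have [r r0 [rO rH]] := C1_box_estimate oO (Ck_partial i kf) Ox e0.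
exists (r / 2) => [|h k hr kr]; first by rewrite divr_gt0.
pose g s := f (x + k *: e_ j + s *: e_ i) - f (x + s *: e_ i).
have box1 s : `|s| <= `|h| -> box x r (x + s *: e_ i).
  move=> sh l; rewrite !mxE eqxx addrAC subrr add0r normrM.
  by case: eqP => _; rewrite ?normr1 ?normr0 ?mulr0 // ?mulr1; move: (hr); lra.
have box2 s : `|s| <= `|h| -> box x r (x + k *: e_ j + s *: e_ i).
  move=> sh l; rewrite !mxE eqxx -addrA addrAC subrr add0r.
  apply: (le_lt_trans (ler_normD _ _)); rewrite !normrM.
  have := normr_ge0 k; have := normr_ge0 s; move: hr kr sh.
  by case: eqP => _; case: eqP => _; rewrite ?normr1 ?normr0 ?mulr0 ?mulr1; lra.
have := @mvt_le _ g (fun s => partial i f (x + k *: e_ j + s *: e_ i) -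
  partial i f (x + s *: e_ i)) 0 h (partial j (partial i f) x * k) (e * `|k|).
rewrite !subr0 /g !scale0r !addr0 [x + k *: _ + _]addrAC; apply => s sh.
have {}sh : `|s| <= `|h|.
  rewrite ler_norml; move: sh; case: (leP 0 h) => h0 /andP[s1 s2].
    by rewrite (ger0_norm h0); lra.
  by rewrite (ltr0_norm h0); lra.
split.
  apply: is_deriveB.
  - apply/(shift_line_derive f); apply: Ck_is_derive kf _; exact/rO/box2.
  - apply/(shift_line_derive f); apply: Ck_is_derive kf _; exact/rO/box1.
have := rH _ _ (box1 s sh) (box2 s sh).
have E l : (x + k *: e_ j + s *: e_ i) 0 l - (x + s *: e_ i) 0 l
    = k * (l == j)%:R by rewrite !mxE eqxx /=; ring.
rewrite (bigD1 j) //= big1 ?addr0; last first.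
  by move=> l /negPf lj; rewrite E lj mulr0 mulr0.
rewrite E eqxx mulr1 => /le_trans; apply.
rewrite (bigD1 j) //= big1 ?addr0; last first.
  by move=> l /negPf lj; rewrite E lj mulr0 normr0 mulr0.
by rewrite E eqxx mulr1.
Qed.

(** The second difference is symmetric in the two directions. *)
Lemma partialC O f x i j : open O -> Ck 2 O f -> O x ->
  partial i (partial j f) x = partial j (partial i f) x.
Proof.
move=> oO kf Ox; apply/eqP; rewrite -subr_eq0 -normr_le0.
apply/ler_addgt0Pl => e e0; rewrite addr0.
have e20 : 0 < e / 2 by rewrite divr_gt0.
have [r r0 rH] := second_difference i j oO kf Ox e20.
have [s s0 sH] := second_difference j i oO kf Ox e20.
pose h := Num.min r s / 2.
have h0 : 0 < h by rewrite divr_gt0 // lt_min r0.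
have hm : h < Num.min r s by rewrite /h ltr_pdivrMr // ltr_pMr ?lt_min ?r0 //; lra.
have hr : `|h| < r by rewrite gtr0_norm //; apply: lt_le_trans hm _; rewrite ge_min lexx.
have hs : `|h| < s.
  by rewrite gtr0_norm //; apply: lt_le_trans hm _; rewrite ge_min lexx orbT.
have := rH h h hr hr; have := sH h h hs hs.
rewrite [x + h *: e_ j + _]addrAC.
set D := f (x + h *: e_ i + _); set a := f (x + h *: e_ i).
set b := f (x + h *: e_ j); set p := partial i _ x; set q := partial j _ x.
rewrite (gtr0_norm h0) => H1 H2.
have : `|p - q| * (h * h) <= e * (h * h).
  have hh : 0 < h * h by rewrite mulr_gt0.
  rewrite -{1}(gtr0_norm hh) -normrM.
  have -> : (p - q) * (h * h) = (D - a - (b - f x) - q * h * h)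
      - (D - b - (a - f x) - p * h * h) by ring.
  apply: (le_trans (ler_normB _ _)); apply: (le_trans (lerD H2 H1)).
  by rewrite le_eqVlt; apply/orP; left; apply/eqP; field.
by rewrite ler_pM2r // mulr_gt0.
Qed.

End Schwarz.

(** The jacobian matrix is indexed as in [transition_jac]. *)
Definition jac {R : realType} {n m : nat} (F : 'rV[R]_n -> 'rV[R]_m)
    (x : 'rV[R]_n) : 'M[R]_(m, n) :=
  \matrix_(i, j) partial j (fun y => F y 0 i) x.

Definition Ckm {R : realType} {n p q : nat} k (O : set 'rV[R]_n)
    (A : 'rV[R]_n -> 'M[R]_(p, q)) : Prop :=
  forall i j, Ck k O (fun x => A x i j).

Section CkMatrices.
Context {R : realType} {n : nat}.
Implicit Types (O : set 'rV[R]_n).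

Lemma Ckm_ext k p q O (A B : 'rV[R]_n -> 'M[R]_(p, q)) : open O ->
  (forall y, O y -> A y = B y) -> Ckm k O A -> Ckm k O B.
Proof.
by move=> oO AB kA i j; apply: Ck_ext (kA i j) => // y Oy; rewrite AB.
Qed.

Lemma Ckm_sub k p q O O' (A : 'rV[R]_n -> 'M[R]_(p, q)) : O' `<=` O ->
  Ckm k O A -> Ckm k O' A.
Proof. by move=> OO kA i j; apply: Ck_sub OO (kA i j). Qed.

Lemma Ckm_cst k p q O (A : 'M[R]_(p, q)) : Ckm k O (fun=> A).
Proof. by move=> i j; apply: Ck_cst. Qed.

Lemma CkmD k p q O (A B : 'rV[R]_n -> 'M[R]_(p, q)) : open O ->
  Ckm k O A -> Ckm k O B -> Ckm k O (fun x => A x + B x).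
Proof.
move=> oO kA kB i j; apply: Ck_ext (CkD (kA i j) (kB i j) oO) => // y _.
by rewrite mxE.
Qed.

Lemma CkmN k p q O (A : 'rV[R]_n -> 'M[R]_(p, q)) : open O ->
  Ckm k O A -> Ckm k O (fun x => - A x).
Proof.
by move=> oO kA i j; apply: Ck_ext (CkN (kA i j) oO) => // y _; rewrite mxE.
Qed.

Lemma CkmB k p q O (A B : 'rV[R]_n -> 'M[R]_(p, q)) : open O ->
  Ckm k O A -> Ckm k O B -> Ckm k O (fun x => A x - B x).
Proof. by move=> oO kA kB; apply: CkmD => //; apply: CkmN. Qed.

Lemma CkmZ k p q O f (A : 'rV[R]_n -> 'M[R]_(p, q)) : open O ->
  Ck k O f -> Ckm k O A -> Ckm k O (fun x => f x *: A x).
Proof.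
move=> oO kf kA i j; apply: Ck_ext (CkM kf (kA i j) oO) => // y _.
by rewrite mxE.
Qed.

Lemma CkmM k p q r O (A : 'rV[R]_n -> 'M[R]_(p, q))
    (B : 'rV[R]_n -> 'M[R]_(q, r)) : open O ->
  Ckm k O A -> Ckm k O B -> Ckm k O (fun x => A x *m B x).
Proof.
move=> oO kA kB i j.
have := Ck_sum (index_enum 'I_q) oO (fun l (_ : xpredT l) =>
  CkM (kA i l) (kB l j) oO).
by apply: Ck_ext => // y _; rewrite mxE.
Qed.

Lemma Ckm_tr k p q O (A : 'rV[R]_n -> 'M[R]_(p, q)) : open O ->
  Ckm k O A -> Ckm k O (fun x => (A x)^T).
Proof. by move=> oO kA i j; apply: Ck_ext (kA j i) => // y _; rewrite mxE. Qed.

Lemma Ck_det k p O (A : 'rV[R]_n -> 'M[R]_p) : open O ->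
  Ckm k O A -> Ck k O (fun x => \det (A x)).
Proof.
move=> oO kA; apply: Ck_sum => // s _; apply: CkM => //; first exact: Ck_cst.
by apply: Ck_prod => // i _; apply: kA.
Qed.

Lemma Ckm_adj k p O (A : 'rV[R]_n -> 'M[R]_p) : open O ->
  Ckm k O A -> Ckm k O (fun x => \adj (A x)).
Proof.
move=> oO kA i j.
apply: (@Ck_ext _ _ _ _ (fun x => cofactor (A x) j i)) => //.
  by move=> y _; rewrite mxE.
apply: CkM => //; first exact: Ck_cst.
apply: Ck_det => // a b.
apply: (@Ck_ext _ _ _ _ (fun x => A x (lift j a) (lift i b))) => //.
by move=> y _; rewrite !mxE.
Qed.

Lemma Ckm_inv k p O (A : 'rV[R]_n -> 'M[R]_p) : open O ->
  (forall x, O x -> A x \in unitmx) ->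
  Ckm k O A -> Ckm k O (fun x => invmx (A x)).
Proof.
move=> oO Au kA.
apply: (@Ckm_ext _ _ _ _ (fun x => (\det (A x))^-1 *: \adj (A x))) => //.
  by move=> y Oy; rewrite /invmx Au.
apply: CkmZ => //; last exact: Ckm_adj.
apply: CkV => // [x Ox|]; last exact: Ck_det.
by have := Au x Ox; rewrite unitmxE unitfE.
Qed.

Lemma Ckm_comp k m p q O (Q : set 'rV[R]_m) (A : 'rV[R]_m -> 'M[R]_(p, q))
    (F : 'rV[R]_n -> 'rV[R]_m) : open O -> open Q ->
  Ckm k Q A -> Ckm k O F -> (forall x, O x -> Q (F x)) ->
  Ckm k O (fun x => A (F x)).
Proof.
move=> oO oQ kA kF OQ i j.
by apply: (Ck_comp (Q := Q) (f := fun y => A y i j)) => // l; apply: kF.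
Qed.

Lemma Ckm_jac k m O (F : 'rV[R]_n -> 'rV[R]_m) : open O ->
  Ckm k.+1 O F -> Ckm k O (jac F).
Proof.
move=> oO kF i j.
apply: Ck_ext (Ck_partial j (kF 0 i)) => // y _; by rewrite mxE.
Qed.

Lemma open_nonzero k O f : open O -> Ck k O f ->
  open [set x | O x /\ f x != 0].
Proof.
move=> oO kf; rewrite openE => x /= [Ox fx0].
have /continuous_box/(_ `|f x|) := Ck_continuous kf Ox.
rewrite normr_gt0 => /(_ fx0)[r r0 rH]; have [s s0 sO] := open_box oO Ox.
apply/nbhs_box; exists (Num.min r s); first by rewrite lt_min r0.
move=> y ym; split.
  by apply: sO; apply: box_sub ym; rewrite ge_min lexx orbT.
have : box x r y by apply: box_sub ym; rewrite ge_min lexx.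
by move=> /rH; apply: contraTneq => ->; rewrite sub0r normrN ltxx.
Qed.

End CkMatrices.

(** * The inverse function theorem *)

HB.instance Definition _ (R : realType) (n : nat) := Complete.on 'rV[R]_n.

(** Banach's theorem on a closed ball, with ratio [1/2]. *)
Lemma contraction_fixed_point {R : realType} {n : nat} (x0 : 'rV[R]_n) (r : R)
    (T : 'rV[R]_n -> 'rV[R]_n) : 0 < r ->
  (forall x, `|x - x0| <= r -> `|T x - x0| <= r) ->
  (forall x y, `|x - x0| <= r -> `|y - x0| <= r ->
     `|T x - T y| <= 2^-1 * `|x - y|) ->
  exists2 x, `|x - x0| <= r & T x = x.
Proof.
move=> r0 TT lipT.
pose U : set 'rV[R]_n := [set x | `|x - x0| <= r].
have cU : closed U.
  rewrite (_ : U = closed_ball x0 r); first exact: closed_ball_closed.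
  by rewrite closed_ballE //; apply/seteqP; split=> x; rewrite /U /closed_ball_ /= distrC.
have fT : set_fun U U T by move=> x /TT.
pose T' : {fun U >-> U} := HB.pack T (isFun.Build _ _ U U T fT).
have cT : is_contraction T'.
  exists 2^-1%:nng; split; first by rewrite /= invf_lt1 // ltr1n.
  by move=> [x y] [/= Ux Uy]; apply: lipT.
have [] := banach_fixed_point cT cU; first by exists x0; rewrite /U /= subrr normr0 ltW.
by move=> x Ux xT; exists x.
Qed.

Lemma norm_le_coord {R : realType} {n : nat} (x : 'rV[R]_n) r : 0 <= r ->
  (forall i, `|x 0 i| <= r) -> `|x| <= r.
Proof.
move=> r0 H; rewrite [leLHS]/Num.Def.normr/= mx_normrE.
by apply: bigmax_le => // -[i j] _; rewrite ord1.
Qed.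

Lemma mulmx_bounded {R : realType} {n m : nat} (A : 'M[R]_(n, m)) :
  exists2 C, 0 < C & forall x : 'rV[R]_n, `|x *m A| <= C * `|x|.
Proof.
pose C := 1 + \sum_j \sum_i `|A i j|.
have C0 : 0 < C by rewrite ltr_wpDr // !sumr_ge0 // => *; rewrite sumr_ge0.
exists C => // x; apply: norm_le_coord => [|j].
  by rewrite mulr_ge0 // ltW.
rewrite mxE; apply: (le_trans (ler_norm_sum _ _ _)).
apply: (@le_trans _ _ ((\sum_i `|A i j|) * `|x|)).
  rewrite mulr_suml; apply: ler_sum => i _.
  by rewrite normrM mulrC ler_wpM2l // norm_coord_le.
apply: ler_wpM2r => //; rewrite /C (bigD1 j) //= addrCA lerDl.
by rewrite addr_ge0 // sumr_ge0 // => *; rewrite sumr_ge0.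
Qed.

Section InverseFunction.
Context {R : realType} {n : nat}.
Variables (O : set 'rV[R]_n) (F : 'rV[R]_n -> 'rV[R]_n) (x0 : 'rV[R]_n).
Hypothesis oO : open O.
Hypothesis Ox0 : O x0.
Hypothesis kF : forall k, Ckm k O F.
Hypothesis uF : jac F x0 \in unitmx.

Let K := (invmx (jac F x0))^T.
Let T x := x - F x *m K.

(** The differential of [T] at [x0] vanishes, so [T] is a contraction near
    [x0]. *)
Lemma inverse_iteration_contracts : exists r, [/\ 0 < r, box x0 r `<=` O,
  (forall x, box x0 r x -> jac F x \in unitmx) &
  forall x y, box x0 r x -> box x0 r y -> `|T x - T y| <= 2^-1 * `|x - y|].
Proof.
pose O1 := [set x | O x /\ \det (jac F x) != 0].
have kdet : Ck 0 O (fun x => \det (jac F x)).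
  by apply: Ck_det => //; apply: Ckm_jac.
have oO1 : open O1 by apply: open_nonzero kdet.
have O1x0 : O1 x0 by split => //; move: uF; rewrite unitmxE unitfE.
have [r0 r00 r0O] := open_box oO1 O1x0.
have kT : Ckm 1 O T.
  apply: CkmB => //; first by move=> i j; rewrite ord1; apply: Ck_coord.
  by apply: CkmM => //; apply: Ckm_cst.
have dT i l : partial l (fun y => T y 0 i) x0 = 0.
  have -> : (fun y => T y 0 i) = (fun y : 'rV[R]_n => y 0 i) -
      \sum_j (fun y => K j i * F y 0 j).
    apply/funext => y; rewrite /T 3!mxE; congr (_ - _).
    by rewrite fct_sumE; apply: eq_bigr => j _; rewrite mulrC.
  have dF j : is_derive x0 (delta_mx 0 l) (fun y => K j i * F y 0 j)
      (K j i * partial l (fun y => F y 0 j) x0).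
    by have := is_deriveZ (K j i) (Ck_is_derive l (@kF 1 0 j) Ox0).
  have H := is_deriveB (is_derive_coord x0 (delta_mx 0 l) i)
    (is_derive_sum dF).
  rewrite /partial; have [_ ->] := H.
  have := mulVmx uF => /matrixP/(_ i l); rewrite !mxE eqxx /= => <-.
  apply/eqP; rewrite subr_eq0; apply/eqP/eq_bigr => j _.
  by rewrite /K !mxE.
pose e : R := 2^-1 / n.+1%:R.
have e0 : 0 < e by rewrite divr_gt0.
have est i : exists2 r, 0 < r & forall y z, box x0 r y -> box x0 r z ->
    `|T z 0 i - T y 0 i| <= 2^-1 * `|z - y|.
  have [r r0' [rO H]] := C1_box_estimate oO (kT 0 i) Ox0 e0.
  exists r => // y z yr zr; have := H y z yr zr.
  rewrite big1 ?subr0; last by move=> l _; rewrite dT mul0r.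
  move=> /le_trans; apply.
  apply: (@le_trans _ _ (\sum_(l < n) e * `|z - y|)).
    apply: ler_sum => l _; rewrite ler_wpM2l ?(ltW e0) //.
    by have := norm_coord_le (z - y) l; rewrite !mxE.
  rewrite sumr_const card_ord -[_ *+ n]mulr_natr [e * _]mulrC -mulrA [leRHS]mulrC.
  rewrite ler_wpM2l // /e -mulrA ler_piMr ?invr_ge0 // mulrC.
  by rewrite ler_pdivrMr // mul1r ler_nat.
have [i r s rs H y z ys zs|r [rpos rr0 H]] := common_radius r00 est.
  by apply: H; apply: box_sub rs _ _.
have rO1 : box x0 r `<=` O1 by apply: subset_trans r0O; apply: box_sub.
exists r; split => //.
- by move=> x /rO1[].
- by move=> x /rO1[_]; rewrite unitmxE unitfE.
- move=> x y xr yr; apply: norm_le_coord => [|i].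
    by rewrite mulr_ge0 // invr_ge0.
  by rewrite [X in `|X|]mxE [X in _ + X]mxE; apply: H.
Qed.

(** Local inverse of a smooth map with invertible differential: [x] is
    recovered from [y = F x] as the fixed point of [x - (F x - y) K], a
    contraction when [K] is the inverse of the differential at [x0]. *)
Lemma inverse_function : exists (U : set 'rV[R]_n) (G : 'rV[R]_n -> 'rV[R]_n)
    (rho : R),
  [/\ [/\ 0 < rho, open U, U x0 & U `<=` O],
      (forall x, U x -> [/\ box (F x0) rho (F x), G (F x) = x &
                          jac F x \in unitmx]),
      (forall y, box (F x0) rho y -> U (G y) /\ F (G y) = y) &
      forall k, Ckm k (box (F x0) rho) G].
Proof.
have [r [r0 rO rU rT]] := inverse_iteration_contracts.
have [C C0 CK] := mulmx_bounded K.
have uK : K \in unitmx by rewrite unitmx_tr unitmx_inv.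
pose rho := r / 4 / C.
have rho0 : 0 < rho by rewrite !divr_gt0.
have normbox x : `|x - x0| <= r / 2 -> box x0 r x.
  move=> xr; apply/norm_box => //; apply: le_lt_trans xr _; lra.
have exG y : exists x, box (F x0) rho y -> `|x - x0| <= r / 2 /\ F x = y.
  have [yr|] := pselect (box (F x0) rho y); last by exists 0.
  have yK : `|(y - F x0) *m K| <= r / 4.
    apply: (le_trans (CK _)); rewrite mulrC -ler_pdivlMr //; apply/ltW.
    by apply/norm_box.
  have r20 : 0 < r / 2 by rewrite divr_gt0.
  pose S x := T x + y *m K.
  have [||x xr xS] := @contraction_fixed_point R n x0 (r / 2) S r20.
  - move=> x xr.
    have -> : S x - x0 = (T x - T x0) + (y - F x0) *m K.
      by rewrite /S /T mulmxBl; apply/rowP => i; rewrite !mxE; ring.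
    apply: (le_trans (ler_normD _ _)).
    have := rT _ _ (normbox _ xr) (box_center _ r0); move: xr yK.
    set a := `|_ - _|; set b := `|_ *m _|; set c := `|_ - _|; lra.
  - move=> x z xr zr; rewrite /S opprD addrACA subrr addr0.
    by apply: rT; apply: normbox.
  exists x => _; split=> //; apply/eqP; rewrite -subr_eq0; apply/eqP.
  have : (F x - y) *m K = 0.
    have : x - S x = 0 by rewrite xS subrr.
    move <-; rewrite /S /T mulmxBl; apply/rowP => i; rewrite !mxE; ring.
  by move/(congr1 (mulmx^~ (invmx K))); rewrite mulmxK // mul0mx.
have /choice[G HG] := exG.
have est x z : box x0 r x -> box x0 r z -> `|x - z| <= 2 * (C * `|F x - F z|).
  move=> xr zr; have := rT _ _ xr zr.
  have -> : T x - T z = (x - z) - (F x - F z) *m K.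
    by rewrite /T mulmxBl; apply/rowP => i; rewrite !mxE; ring.
  have := CK (F x - F z); have := ler_normD (x - z - (F x - F z) *m K)
    ((F x - F z) *m K); rewrite subrK.
  set a := `|x - z - _|; set b := `|x - z|; set c := `|_ *m _|; lra.
have GF x : box x0 r x -> box (F x0) rho (F x) -> G (F x) = x.
  move=> xr Fr; have [Gr FG] := HG _ Fr.
  have := est _ _ (normbox _ Gr) xr.
  by rewrite FG subrr normr0 mulr0 mulr0 normr_le0 subr_eq0 => /eqP.
have lipG y z : box (F x0) rho y -> box (F x0) rho z ->
    `|G z - G y| <= 2 * C * `|z - y|.
  move=> yr zr; have [Gy Fy] := HG _ yr; have [Gz Fz] := HG _ zr.
  by have := est _ _ (normbox _ Gz) (normbox _ Gy); rewrite Fy Fz mulrA.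
have oV := @box_open R n (F x0) rho.
have C20 : 0 < 2 * C by rewrite mulr_gt0.
have contG : forall i y, box (F x0) rho y ->
    {for y, continuous (fun y => G y 0 i)}.
  move=> i y yr; apply/continuous_box => e e0.
  have [s s0 sV] := open_box oV yr.
  exists (Num.min s (e / (2 * C))) => [|z zm].
    by rewrite lt_min s0 divr_gt0.
  have zs : box y s z by apply: box_sub zm; rewrite ge_min lexx.
  have ze : box y (e / (2 * C)) z.
    by apply: box_sub zm; rewrite ge_min lexx orbT.
  have := norm_coord_le (G z - G y) i; rewrite 2!mxE => /le_lt_trans; apply.
  apply: (le_lt_trans (lipG _ _ yr (sV _ zs))).
  rewrite mulrC -ltr_pdivlMr //; apply/norm_box => //; exact: divr_gt0.
have dG i j y : box (F x0) rho y -> is_derive y (delta_mx 0 j)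
    (fun y => G y 0 i) (invmx (jac F (G y)) i j).
  move=> yr; have [Gy Fy] := HG _ yr; set x := G y; set J := jac F x.
  have Ox : O x by apply: rO; apply: normbox.
  have uJ : J \in unitmx by apply: rU; apply: normbox.
  apply/(line_derive0 (fun y => G y 0 i)); apply/is_deriveP => e e0.
  pose D := 1 + \sum_k `|invmx J i k| * (n%:R * (2 * C)).
  have D0 : 0 < D.
    rewrite ltr_wpDr // sumr_ge0 // => k _; rewrite !mulr_ge0 //.
    by apply: ltW.
  have eD0 : 0 < e / D by rewrite divr_gt0.
  have estk k : exists2 s, 0 < s & forall z, box x s z ->
      `|F z 0 k - F x 0 k - \sum_l J k l * (z 0 l - x 0 l)|
         <= \sum_(l < n) (e / D) * `|z 0 l - x 0 l|.
    have [s s0 [_ H]] := C1_box_estimate oO (kF 1 0 k) Ox eD0.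
    exists s => // z zs; have := H x z (box_center _ s0) zs.
    have -> // : \sum_l partial l (fun y => F y 0 k) x * (z 0 l - x 0 l) =
      \sum_l J k l * (z 0 l - x 0 l).
    by apply: eq_bigr => l _; rewrite /J /jac mxE.
  have [k a b ab H z zb|s [s0 _ sH]] := common_radius ltr01 estk.
    by apply: H; apply: box_sub ab _ _.
  have [s1 s10 s1V] := open_box oV yr.
  exists (Num.min s1 (s / (2 * C))) => [|t].
    by rewrite lt_min s10 divr_gt0.
  rewrite lt_min add0r scale0r addr0 => /andP[ts1 ts].
  set yt := y + t *: delta_mx 0 j; set xt := G yt.
  have ytr : box (F x0) rho yt.
    apply: s1V => l; rewrite !mxE eqxx addrAC subrr add0r normrM.
    by case: eqP => _; rewrite ?normr1 ?normr0 ?mulr0 ?mulr1.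
  have [Gyt Fyt] := HG _ ytr.
  have nyt : `|yt - y| <= `|t|.
    rewrite /yt addrAC subrr add0r; apply: norm_le_coord => // l.
    rewrite !mxE eqxx normrM.
    by case: eqP => _; rewrite ?normr1 ?normr0 ?mulr0 ?mulr1.
  have nxt : `|xt - x| <= 2 * C * `|t|.
    by apply: (le_trans (lipG _ _ yr ytr)); rewrite ler_wpM2l // ltW.
  have xts : box x s xt.
    apply/norm_box => //; apply: (le_lt_trans nxt).
    by rewrite mulrC -ltr_pdivlMr.
  pose w := \col_k (F xt 0 k - F x 0 k) - J *m (xt - x)^T.
  have wE : invmx J *m w = t *: col j (invmx J) - (xt - x)^T.
    rewrite /w mulmxBr mulKmx //; congr (_ - _).
    rewrite /xt /x Fyt Fy.
    have -> : \col_k (yt 0 k - y 0 k) = t *: (delta_mx j 0 : 'cV[R]_n).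
      by apply/colP => k; rewrite !mxE eqxx /= addrAC subrr add0r andbT.
    by rewrite -scalemxAr colE.
  have wle k : `|w k 0| <= e / D * (n%:R * (2 * C) * `|t|).
    have := sH k _ xts; rewrite /w 4!mxE.
    have -> : \sum_l J k l * (xt - x)^T l 0 = \sum_l J k l * (xt 0 l - x 0 l).
      by apply: eq_bigr => l _; rewrite !mxE.
    move=> /le_trans; apply; rewrite -mulr_sumr ler_wpM2l ?(ltW eD0) //.
    apply: (@le_trans _ _ (\sum_(l < n) 2 * C * `|t|)).
      apply: ler_sum => l _; apply: le_trans nxt.
      by have := norm_coord_le (xt - x) l; rewrite 2!mxE.
    by rewrite sumr_const card_ord -[_ *+ n]mulr_natl mulrA.
  have -> : xt 0 i - x 0 i - invmx J i j * t = - (invmx J *m w) i 0.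
    rewrite wE !mxE; ring.
  rewrite normrN mxE; apply: (le_trans (ler_norm_sum _ _ _)).
  apply: (@le_trans _ _ (\sum_k `|invmx J i k| * (e / D * (n%:R * (2 * C) * `|t|)))).
    by apply: ler_sum => k _; rewrite normrM ler_wpM2l.
  have -> : \sum_k `|invmx J i k| * (e / D * (n%:R * (2 * C) * `|t|)) =
     (\sum_k `|invmx J i k| * (n%:R * (2 * C))) * (e / D * `|t|).
    by rewrite mulr_suml; apply: eq_bigr => k _; ring.
  rewrite [leLHS]mulrA ler_wpM2r // [leLHS]mulrA ler_pdivrMr // [leLHS]mulrC ler_wpM2l ?(ltW e0) //.
  by rewrite /D lerDr.
pose U := [set x | box x0 r x /\ box (F x0) rho (F x)].
have Ur x : U x -> box x0 r x by case.
have GU y : box (F x0) rho y -> U (G y).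
  by move=> yr; have [Gy Fy] := HG _ yr; split; [apply: normbox|rewrite Fy].
exists U, G, rho; split; first split => //.
- rewrite openE => x [xr Fxr].
  have [s s0 sV] := open_box oV Fxr; have [a a0 aV] := open_box (box_open (x:=x0) (r:=r)) xr.
  have cF k : exists2 b, 0 < b & forall z, box x b z -> `|F z 0 k - F x 0 k| < s.
    apply: (continuous_box _ _).1 s0; apply: Ck_continuous (kF 0 0 k) _.
    exact: rO.
  have [k b c bc H z zb|b [b0 ba bH]] := common_radius a0 cF.
    by apply: H; apply: box_sub bc _ _.
  apply/nbhs_box; exists b => // z zb; split; first exact/aV/(box_sub ba).
  by apply: sV => k; apply: bH.
- by split; apply: box_center.
- by move=> x /Ur/rO.
- by move=> x [xr Fxr]; split => //; [apply: GF|apply: rU].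
- by move=> y yr; split; [apply: GU|have [] := HG _ yr].
- elim=> [|k IH] i j; first by rewrite ord1; split => // y; apply: contG.
  rewrite ord1; apply: (Ck_step oV (contG j) (fun l y yr => dG j l y yr)) => l.
  apply: (@Ckm_inv R n k n _ (fun y => jac F (G y)) oV) => [y yr|].
    by apply: rU; case: (GU _ yr).
  apply: (Ckm_comp oV oO _ IH) => [|y yr]; first exact: Ckm_jac.
  by apply: rO; case: (GU _ yr).
Qed.

End InverseFunction.

(** * Primitives and linear differential equations *)

Section Primitives.
Context {R : realType}.
Implicit Types (f : R -> R) (a b : R).

Lemma local_primitive f a b :
  (forall x, a <= x <= b -> {for x, continuous f}) ->
  exists F : R -> R, forall x : R, a < x < b -> is_derive x 1 F (f x).
Proof.
move=> cf; pose mu := @lebesgue_measure R.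
exists (fun x => (\int[mu]_(t in [set` `[a, x]]) (f t))%R) => x /andP[ax xb].
have intf : mu.-integrable `[a, b] (EFin \o f).
  apply: continuous_compact_integrable; first exact: segment_compact.
  apply: continuous_in_subspaceT => y; rewrite inE /= in_itv /= => aby.
  exact: cf.
have [|H1 H2] := continuous_FTC1_closed xb intf ax.
  by apply: cf; rewrite (ltW ax) (ltW xb).
by rewrite -H2 derive1E; exact: (DeriveDef H1 erefl).
Qed.

Lemma primitive_unique (F G f : R -> R) (c x : R) :
  (forall s, Num.min c x <= s <= Num.max c x ->
     is_derive s 1 F (f s) /\ is_derive s 1 G (f s)) ->
  F c = G c -> F x = G x.
Proof.
move=> H E; apply/eqP; rewrite -subr_eq0; apply/eqP.
have := @derive_zero_const _ (F - G) c x; rewrite !fctE E subrr; apply=> s sc.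
by have [? ?] := H s sc; rewrite -[0](subrr (f s)); apply: is_deriveB.
Qed.

(** Primitives on longer and longer intervals, normalized to vanish at [c],
    agree where both are defined. *)
Lemma primitive f (c : R) : (forall x, {for x, continuous f}) ->
  exists F : R -> R, F c = 0 /\ forall x : R, is_derive x 1 F (f x).
Proof.
move=> cf.
have /choice[P HP] : forall N : R, exists F : R -> R, F c = 0 /\
    forall x : R, c - N < x < c + N -> is_derive x 1 F (f x).
  move=> N; have [F HF] := @local_primitive f (c - N) (c + N) (fun x _ => cf x).
  exists (fun x => F x - F c); split; first by rewrite subrr.
  move=> x /HF dF.
  have -> : (fun x => F x - F c) = F - cst (F c) by apply/funext.
  by rewrite -[f x]subr0; apply: is_deriveB.
pose F x := P (`|x - c| + 1) x.
have FE N x : `|x - c| + 1 <= N -> F x = P N x.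
  move=> xN; apply: (@primitive_unique (P (`|x - c| + 1)) (P N) f c) => [s sx|]; last first.
    exact: etrans (HP _).1 (esym (HP _).1).
  have sc : `|s - c| <= `|x - c|.
    rewrite ler_norml; move: sx; case: (leP c x) => cx /andP[s1 s2].
      by rewrite ger0_norm ?subr_ge0 //; lra.
    by rewrite ltr0_norm ?subr_lt0 //; lra.
  have : `|s - c| < N by lra.
  rewrite ltr_norml => /andP[? ?].
  have : `|s - c| < `|x - c| + 1 by lra.
  rewrite ltr_norml => /andP[? ?].
  by split; [apply: (HP _).2|apply: (HP _).2]; lra.
exists F; split=> [|x]; first by rewrite /F (HP _).1.
pose N := `|x - c| + 2.
apply: (@near_eq_is_derive _ _ _ (P N)).
  apply/nbhs_ballP; exists 1 => //= y; rewrite /ball /= => xy.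
  apply/esym; apply: FE; rewrite /N.
  have := ler_distD x y c; rewrite [ `|y - x|]distrC; move: xy.
  by set a := `|_|; set b := `|_|; set d := `|_|; lra.
apply: (HP _).2; have : `|x - c| < N by rewrite /N; lra.
by rewrite ltr_norml => /andP[]; lra.
Qed.

Lemma geometric_limit (u : nat -> R) (M : R) :
  (forall k, `|u k.+1 - u k| <= M * 2^-1 ^+ k) ->
  exists l, forall k, `|l - u k| <= 2 * M * 2^-1 ^+ k.
Proof.
move=> H; pose a k := u k - 2 * M * 2^-1 ^+ k.
pose b k := u k + 2 * M * 2^-1 ^+ k.
have M0 : 0 <= M by have := H 0; rewrite expr0 mulr1; apply: le_trans.
have step k : a k <= a k.+1 /\ b k.+1 <= b k.
  have := H k; rewrite ler_norml /a /b exprSr => /andP[].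
  by set p := 2^-1 ^+ k; split; lra.
have mono j k : (j <= k)%N -> a j <= a k /\ b k <= b j.
  move=> jk; rewrite -(subnK jk); elim: (k - j)%N => // m [IH1 IH2].
  have [s1 s2] := step (m + j)%N; rewrite addSn.
  by split; [apply: le_trans s1|apply: le_trans IH2].
have ab k : a k <= b k.
  have : 0 <= M * 2^-1 ^+ k by rewrite mulr_ge0 // exprn_ge0.
  by rewrite /a /b; lra.
have abjk j k : a j <= b k.
  have [jk|/ltnW kj] := leqP j k; first exact: le_trans (mono _ _ jk).1 (ab k).
  exact: le_trans (ab j) (mono _ _ kj).2.
pose A := [set a k | k in setT].
have hA : has_sup A.
  by split; [exists (a 0), 0%N|exists (b 0) => _ [k _ <-]].
exists (sup A) => k.
have ak : a k <= sup A by apply: ub_le_sup; [case: hA|exists k].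
have bk : sup A <= b k by apply: ge_sup; [case: hA|move=> _ [j _ <-]].
by move: ak bk; rewrite /a /b ler_norml; set p := _ ^+ k; lra.
Qed.

Lemma le_geometric (a b C : R) : (forall k, a <= b + C * 2^-1 ^+ k) -> a <= b.
Proof.
move=> H; apply/ler_addgt0Pr => e e0.
have [C0|C0] := leP C 0.
  apply: (le_trans (H 0)); rewrite expr0 mulr1; lra.
have [k kC] : exists k, C * 2^-1 ^+ k < e.
  have : geometric C 2^-1 @ \oo --> (0 : R).
    by apply: cvg_geometric; rewrite gtr0_norm // invf_lt1 // ltr1n.
  move/cvgrPdist_lt => /(_ e e0)[k _ /(_ k (leqnn k))] /=.
  rewrite sub0r normrN gtr0_norm ?mulr_gt0 ?exprn_gt0 ?invr_gt0 //.
  by exists k.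
by apply: (le_trans (H k)); rewrite lerD2l ltW.
Qed.

End Primitives.

Lemma continuous_sum_at {R : realType} (T : topologicalType) (I : finType)
    (f : I -> T -> R) t : (forall i, {for t, continuous (f i)}) ->
  {for t, continuous (fun s => \sum_i f i s)}.
Proof.
move=> cf; have -> : (fun s => \sum_i f i s) = \sum_i f i.
  by apply/funext => s; rewrite fct_sumE.
elim/big_ind: _ => [|g h cg ch|i _]; last exact: cf.
  exact: cst_continuous.
exact: (continuousD cg ch).
Qed.

Section LinearODE.
Context {R : realType} {n : nat}.
Variables (A : 'I_n -> 'I_n -> R -> R) (N : R) (t0 : R) (c : 'I_n -> R).
Hypothesis cA : forall i j t, {for t, continuous (A i j)}.
Hypothesis bA : forall i j t, `|A i j t| <= N.

(** Picard iteration: the differences of successive iterates decrease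
    geometrically on a short interval, so the iterates converge uniformly and
    the mean value theorem lets the derivative pass to the limit. *)
Lemma linear_ode : exists r (y : 'I_n -> R -> R), [/\ 0 < r,
  forall i, y i t0 = c i &
  forall i (s : R), `|s - t0| < r -> is_derive s 1 (y i) (\sum_j A i j s * y j s)].
Proof.
have cprod i j (g : R -> R) t : {for t, continuous g} ->
    {for t, continuous (fun s => A i j s * g s)}.
  by move=> cg; apply: continuousM => //; apply: cA.
have csum (Y : 'I_n -> R -> R) i t : (forall j t, {for t, continuous (Y j)}) ->
    {for t, continuous (fun s => \sum_j A i j s * Y j s)}.
  move=> cY; apply: continuous_sum_at => j; apply: cprod; exact: cY.
have /choice[prim Hprim] : forall f : R -> R, exists F : R -> R,
    (forall x, {for x, continuous f}) ->
    F t0 = 0 /\ forall x : R, is_derive x 1 F (f x).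
  move=> f; have [cf|ncf] := pselect (forall x, {for x, continuous f}).
    by have [F HF] := primitive t0 cf; exists F.
  by exists f.
pose Y := fix Y k i t : R := if k is k'.+1
  then c i + prim (fun s => \sum_j A i j s * Y k' j s) t else c i.
have YS k i : (forall j t, {for t, continuous (Y k j)}) ->
    Y k.+1 i t0 = c i /\
    forall t : R, is_derive t 1 (Y k.+1 i) (\sum_j A i j t * Y k j t).
  move=> cY; have [H1 H2] := Hprim _ (fun x => csum (Y k) i x cY).
  split=> [|t]; first by rewrite /= H1 addr0.
  have -> : Y k.+1 i = cst (c i) + prim (fun s => \sum_j A i j s * Y k j s).
    by apply/funext.
  by rewrite -[\sum_j _]add0r; apply: is_deriveD.
have cY k : forall j t, {for t, continuous (Y k j)}.
  elim: k => [|k IH] j t; first exact: cst_continuous.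
  by apply: is_derive_continuous ((YS k j IH).2 t).
have YE k i : Y k i t0 = c i by case: k => [//|k]; exact: (YS k i (cY k)).1.
have dY k i t := (YS k i (cY k)).2 t.
have N0 : 0 <= N \/ n = 0%N.
  case: (posnP n) => [|n0]; [by right|left].
  by apply: le_trans (bA (Ordinal n0) (Ordinal n0) t0).
pose K := n%:R * N.
have K0 : 0 <= K.
  by rewrite /K; case: N0 => [?|->]; [rewrite mulr_ge0|rewrite mul0r].
pose M := \sum_i `|c i|.
have M0 : 0 <= M by rewrite sumr_ge0.
have sumbound (Z : 'I_n -> R -> R) i t (C : R) : (forall j, `|Z j t| <= C) ->
    `|\sum_j A i j t * Z j t| <= K * C.
  move=> ZC; apply: (le_trans (ler_norm_sum _ _ _)).
  apply: (@le_trans _ _ (\sum_(j < n) N * C)).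
    by apply: ler_sum => j _; rewrite normrM ler_pM.
  by rewrite sumr_const card_ord -[_ *+ n]mulr_natl mulrA.
pose r := (2 * (K + 1))^-1.
have r0 : 0 < r by rewrite invr_gt0 mulr_gt0 // ltr_wpDl.
have Kr : K * r <= 2^-1.
  rewrite /r invfM mulrCA -[leRHS]mulr1 ler_wpM2l ?invr_ge0 //.
  by rewrite ler_pdivrMr ?ltr_wpDl // mul1r lerDl.
pose I s := `|s - t0| < r.
have between s t : I t -> Num.min t0 t <= s <= Num.max t0 t -> I s.
  rewrite /I !ltr_norml => /andP[? ?].
  by case: (leP t0 t) => ? /andP[? ?]; apply/andP; split; lra.
have diffY k : forall i t, I t -> `|Y k.+1 i t - Y k i t| <= M * 2^-1 ^+ k.
  elim: k => [|k IH] i t It.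
    have := @mvt_le _ (Y 1%N i) (fun s => \sum_j A i j s * Y 0%N j s) t0 t 0 (K * M).
    rewrite mul0r subr0 YE expr0 mulr1 => H.
    apply: (le_trans (H _)) => [s _|].
      split; first exact: dY.
      rewrite subr0; apply: sumbound => j /=.
      by rewrite /M (bigD1 j) //= lerDl sumr_ge0.
    rewrite mulrAC; apply: ler_piMl => //.
    apply: (@le_trans _ _ (K * r)); first by rewrite ler_wpM2l // ltW.
    by apply: (le_trans Kr); rewrite invf_le1 // ler1n.
  have := @mvt_le _ (Y k.+2 i - Y k.+1 i)
    (fun s => \sum_j A i j s * (Y k.+1 j s - Y k j s)) t0 t 0
    (K * (M * 2^-1 ^+ k)).
  rewrite mul0r subr0 !fctE !YE subrr subr0 => H.
  apply: (le_trans (H _)) => [s st|].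
    split; last by rewrite subr0; apply: (sumbound (fun j s => Y k.+1 j s - Y k j s)) => j; apply: IH;
      apply: between st.
    have -> : \sum_j A i j s * (Y k.+1 j s - Y k j s) =
      \sum_j A i j s * Y k.+1 j s - \sum_j A i j s * Y k j s.
      by rewrite -sumrB; apply: eq_bigr => j _; rewrite mulrBr.
    by apply: is_deriveB; apply: dY.
  rewrite mulrAC exprSr [leRHS](_ : _ = 2^-1 * (M * 2^-1 ^+ k)); last by ring.
  apply: ler_wpM2r.
    by rewrite mulr_ge0 // exprn_ge0 // invr_ge0.
  by apply: le_trans Kr; rewrite ler_wpM2l // ltW.
have /choice[z Hz] : forall it : 'I_n * R, exists l, I it.2 -> forall k,
    `|l - Y k it.1 it.2| <= 2 * M * 2^-1 ^+ k.
  move=> [i t]; have [It|nIt] := pselect (I t); last by exists 0.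
  have [l Hl] := @geometric_limit _ (fun k => Y k i t) M (fun k => diffY k i t It).
  by exists l.
pose y i t := z (i, t).
have yY i t k : I t -> `|y i t - Y k i t| <= 2 * M * 2^-1 ^+ k.
  by move=> It; apply: (Hz (i, t)).
have It0 : I t0 by rewrite /I subrr normr0.
(* uniform bound and Lipschitz constant for the iterates *)
have bY k i t : I t -> `|Y k i t| <= 5 * M.
  move=> It; have := yY i t k It; have := yY i t 0%N It.
  have ci : `|c i| <= M by rewrite /M (bigD1 i) //= lerDl sumr_ge0.
  have p1 : 2^-1 ^+ k <= 1 :> R by rewrite exprn_ile1 // invf_le1 // ler1n.
  have {p1} := ler_wpM2l (mulr_ge0 (ler0n R 2) M0) p1.
  rewrite expr0 !mulr1 /=.
  set p := 2 * M * _; move: ci; rewrite !ler_norml.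
  move=> /andP[? ?] ? /andP[? ?] /andP[? ?]; apply/andP; split; lra.
have lipY k i s t : I s -> I t -> `|Y k.+1 i t - Y k.+1 i s| <=
    K * (5 * M) * `|t - s|.
  move=> Is It.
  have := @mvt_le _ (Y k.+1 i) (fun s => \sum_j A i j s * Y k j s) s t 0 (K * (5 * M)).
  rewrite mul0r subr0; apply=> u u1; split; first exact: dY.
  rewrite subr0; apply: sumbound => j; apply: bY.
  move: Is It u1; rewrite /I !ltr_norml => /andP[? ?] /andP[? ?].
  by case: (leP s t) => ? /andP[? ?]; apply/andP; split; lra.
have lipy i s t : I s -> I t -> `|y i t - y i s| <= K * (5 * M) * `|t - s|.
  move=> Is It; apply: (@le_geometric _ _ _ (2 * M)) => k.
  have := lipY k i s t Is It; have := yY i s k.+1 Is; have := yY i t k.+1 It.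
  rewrite exprSr !ler_norml; set p := 2^-1 ^+ k; set q := K * _ * _.
  by move=> /andP[? ?] /andP[? ?] /andP[? ?]; apply/andP; split; lra.
exists r, y; split => //.
  move=> i; apply/eqP; rewrite -subr_eq0 -normr_le0.
  apply: (@le_geometric _ _ _ (2 * M)) => k.
  by rewrite add0r -[c i](YE k); apply: yY.
move=> i s Is; set f := \sum_j A i j s * y j s.
have cf : {for s, continuous (fun t => \sum_j A i j t * y j t)}.
  apply: continuous_sum_at => j; apply: continuousM; first exact: cA.
  apply/(@cvgrPdist_lt _ _ _ _ (nbhs_filter s)) => e e0.
  apply/nbhs_ballP; pose C := K * (5 * M) + 1.
  have C0 : 0 < C by rewrite /C ltr_wpDl // mulr_ge0 // mulr_ge0.
  exists (Num.min (r - `|s - t0|) (e / C)) => [|t] /=.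
    by rewrite lt_min subr_gt0 Is divr_gt0.
  rewrite /ball /= lt_min => /andP[st1 st2].
  have It : I t.
    rewrite /I; apply: le_lt_trans (ler_distD s t t0) _.
    by rewrite [ `|t - s|]distrC -ltrBrDr.
  rewrite distrC; apply: (le_lt_trans (lipy j s t Is It)).
  rewrite distrC; apply: (@le_lt_trans _ _ (C * `|s - t|)).
    by rewrite ler_wpM2r // /C lerDl.
  by rewrite mulrC -ltr_pdivlMr.
apply/is_deriveP => e e0.
have : \forall t \near s, `|\sum_j A i j t * y j t - f| < e.
  have cf' : (\sum_j A i j t * y j t) @[t --> s] --> f by exact: cf.
  by move/cvgrPdist_lt : cf' => /(_ e e0); apply: filterS => t; rewrite distrC.
move=> /nbhs_ballP[d /= d0 dH].
exists (Num.min d (r - `|s - t0|)); first by rewrite lt_min d0 subr_gt0.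
move=> t; rewrite lt_min => /andP[td tr].
have Iu u : `|u - s| <= `|t| -> I u.
  move=> ut; rewrite /I; apply: le_lt_trans (ler_distD s u t0) _.
  by rewrite -ltrBrDr; apply: le_lt_trans tr.
have Ist : I (s + t) by apply: Iu; rewrite addrAC subrr add0r.
apply: (@le_geometric _ _ _ (4 * M + K * (2 * M) * `|t|)) => k.
have := @mvt_le _ (Y k.+1 i) (fun s => \sum_j A i j s * Y k j s) s (s + t) f
  (e + K * (2 * M * 2^-1 ^+ k)).
have -> : s + t - s = t by rewrite addrAC subrr add0r.
move=> H.
have {}H : `|Y k.+1 i (s + t) - Y k.+1 i s - f * t| <=
    (e + K * (2 * M * 2^-1 ^+ k)) * `|t|.
  apply: H => u su.
  have us : `|u - s| <= `|t|.
    move: su; rewrite ler_norml; case: (leP s (s + t)) => st /andP[s1 s2].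
      by rewrite ger0_norm; lra.
    by rewrite ltr0_norm; lra.
  split; first exact: dY.
  have -> : \sum_j A i j u * Y k j u - f =
      (\sum_j A i j u * y j u - f) - \sum_j A i j u * (y j u - Y k j u).
    rewrite addrAC; congr (_ - f); rewrite -sumrB.
    by apply: eq_bigr => j _; ring.
  apply: (le_trans (ler_normB _ _)); apply: lerD.
    apply/ltW/dH; rewrite /ball /= distrC; exact: le_lt_trans td.
  apply: (sumbound (fun j u => y j u - Y k j u)) => j.
  by apply: yY; apply: Iu.
have := yY i s k.+1 Is; have := yY i (s + t) k.+1 Ist; move: H.
have p0 : 0 <= 2^-1 ^+ k :> R by rewrite exprn_ge0 // invr_ge0.
rewrite exprSr; set p := 2^-1 ^+ k.
have -> : (e + K * (2 * M * p)) * `|t| = e * `|t| + K * (2 * M) * `|t| * p by ring.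
rewrite [(4 * M + _) * _]mulrDl.
set q := K * _ * _ * _; set q' := e * `|t|.
have Mp : 0 <= M * p by rewrite mulr_ge0.
rewrite !ler_norml => /andP[? ?] /andP[? ?] /andP[? ?].
by apply/andP; split; lra.
Qed.

End LinearODE.

(** * Closed 1-forms are locally exact *)

Lemma ler_term_sum {R : realType} (I : finType) (F : I -> R) i :
  (forall j, 0 <= F j) -> F i <= \sum_j F j.
Proof. by move=> F0; rewrite (bigD1 i) //= lerDl sumr_ge0. Qed.

Section Poincare.
Context {R : realType} {n : nat}.
Implicit Types (O : set 'rV[R]_n) (f : 'rV[R]_n -> R).

Lemma locally_bounded O f p : open O -> Ck 0 O f -> O p ->
  exists2 r, 0 < r & forall x, box p r x -> `|f x| <= `|f p| + 1.
Proof.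
move=> oO kf Op.
have /continuous_box/(_ 1 ltr01)[r r0 rH] := Ck_continuous kf Op.
exists r => // x /rH H; rewrite -[f x](subrK (f p)) addrC.
by apply: (le_trans (ler_normD _ _)); rewrite lerD2l ltW.
Qed.

Lemma box_segment p r x y (s : R) : box p r x -> box p r y -> 0 <= s <= 1 ->
  box p r (x + s *: (y - x) : 'rV[R]_n).
Proof.
move=> xr yr /andP[s0 s1] i; have := xr i; have := yr i.
rewrite !mxE !ltr_norml => /andP[y1 y2] /andP[x1 x2].
have -> : x 0 i + s * (y 0 i - x 0 i) - p 0 i =
  s * (y 0 i - p 0 i) + (1 - s) * (x 0 i - p 0 i) by ring.
have [->|sn0] := eqVneq s 0; first by rewrite mul0r subr0 mul1r add0r x1 x2.
have {sn0}s0 : 0 < s by rewrite lt0r sn0.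
apply/andP; split; nra.
Qed.

Lemma taylor1 O f p r C : open O -> Ck 2 O f -> box p r `<=` O -> 0 <= C ->
  (forall i j x, box p r x -> `|partial j (partial i f) x| <= C) ->
  forall x y, box p r x -> box p r y ->
  `|f y - f x - \sum_i partial i f x * (y 0 i - x 0 i)| <=
  n%:R * (n%:R * C * `|y - x|) * `|y - x|.
Proof.
move=> oO kf rO C0 bf x y xr yr.
set d := `|y - x|.
have := @mvt_le _ (fun s => f (x + s *: (y - x)))
  (fun s => \sum_i partial i f (x + s *: (y - x)) * (y - x) 0 i) 0 1
  (\sum_i partial i f x * (y 0 i - x 0 i)) (n%:R * (n%:R * C * d) * d).
rewrite subr0 normr1 !mulr1 scale0r scale1r addr0 subrKC; apply=> s s01.
have {}s01 : 0 <= s <= 1.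
  by move: s01; rewrite (min_idPl ler01) (max_idPr ler01).
have zr := box_segment xr yr s01.
split; first by apply: (is_derive_line oO (Ck_le _ kf)) => //; apply: rO.
rewrite -sumrB; apply: (le_trans (ler_norm_sum _ _ _)).
apply: (@le_trans _ _ (\sum_(i < n) (n%:R * C * d) * d)); last first.
  by rewrite sumr_const card_ord -[_ *+ n]mulr_natl !mulrA.
apply: ler_sum => i _; rewrite [(y - x) 0 i]mxE [(- x) 0 i]mxE -mulrBl normrM.
have cd j : `|y 0 j - x 0 j| <= d.
  by have := norm_coord_le (y - x) j; rewrite 2!mxE.
apply: ler_pM => //.
have := @box_mvt _ _ (partial i f) p r C (fun=> 0) _ x _ xr zr.
rewrite big1 ?subr0; last by move=> j _; rewrite mul0r.
move=> H; apply: (le_trans (H _)) => [z zpr j|].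
  split; last by rewrite subr0; apply: bf.
  by apply: Ck_derivable (Ck_partial i kf) _; apply: rO.
apply: (@le_trans _ _ (\sum_(j < n) C * d)); last first.
  by rewrite sumr_const card_ord -[_ *+ n]mulr_natl mulrA.
apply: ler_sum => j _; apply: ler_wpM2l => //.
rewrite !mxE addrAC subrr add0r normrM; apply: le_trans (cd j).
apply: ler_piMl => //; case/andP: s01 => s0 s1.
by rewrite ger0_norm.
Qed.

(** Poincare lemma.  The primitive is the integral of the form along the
    segments issued from [p]; subtracting the linear term, closedness turns the
    derivative along the segments into second-order terms, so that the primitive
    is differentiable with the required partial derivatives. *)
Lemma poincare O (theta : 'I_n -> 'rV[R]_n -> R) p : open O -> O p ->
  (forall k i, Ck k O (theta i)) ->
  (forall i j x, O x -> partial i (theta j) x = partial j (theta i) x) ->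
  exists f r, [/\ 0 < r, box p r `<=` O,
    forall i x, box p r x -> is_derive x (delta_mx 0 i) f (theta i x) &
    forall k, Ck k (box p r) f].
Proof.
move=> oO Op kth clo.
have [r0 r00 r0O] := open_box oO Op.
have b1 (ij : 'I_n * 'I_n) : exists2 r, 0 < r & forall x, box p r x ->
    `|partial ij.2 (theta ij.1) x| <= `|partial ij.2 (theta ij.1) p| + 1.
  by apply: locally_bounded oO _ Op; apply: Ck_partial (kth 1%N _).
have b2 (ijk : 'I_n * 'I_n * 'I_n) : exists2 r, 0 < r & forall x, box p r x ->
    `|partial ijk.2 (partial ijk.1.2 (theta ijk.1.1)) x| <=
    `|partial ijk.2 (partial ijk.1.2 (theta ijk.1.1)) p| + 1.
  by apply: locally_bounded oO _ Op; do 2!apply: Ck_partial; apply: (kth 2%N).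
have r1_0 : 0 < Num.min (r0 / 2) 1 by rewrite lt_min divr_gt0 // ltr01.
have [ij r s rs H x xs|r1 [r10 r1r0 H1]] := common_radius r1_0 b1.
  by apply: H; apply: box_sub rs _ _.
have [ij r2 s rs H x xs|r [rpos rr1 H2]] := common_radius r10 b2.
  by apply: H; apply: box_sub rs _ _.
pose B1 (ij : 'I_n * 'I_n) := `|partial ij.2 (theta ij.1) p| + 1.
pose B2 (ijk : 'I_n * 'I_n * 'I_n) :=
  `|partial ijk.2 (partial ijk.1.2 (theta ijk.1.1)) p| + 1.
have B1_0 ij : 0 <= B1 ij by rewrite addr_ge0.
have B2_0 ijk : 0 <= B2 ijk by rewrite addr_ge0.
pose C := \sum_ij B1 ij + \sum_ijk B2 ijk.
have C0 : 0 <= C by rewrite addr_ge0 // sumr_ge0.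
have {}H1 i j x : box p r x -> `|partial j (theta i) x| <= C.
  move=> xr; apply: (le_trans (H1 (i, j) x (box_sub rr1 xr))).
  apply: (le_trans (ler_term_sum (i, j) B1_0)).
  by rewrite lerDl sumr_ge0.
have {}H2 i j k x : box p r x -> `|partial k (partial j (theta i)) x| <= C.
  move=> xr; apply: (le_trans (H2 (i, j, k) x xr)).
  apply: (le_trans (ler_term_sum (i, j, k) B2_0)).
  by rewrite lerDr sumr_ge0.
have rr0 : r <= r0 / 2 /\ r <= 1.
  by move: r1r0; rewrite le_min => /andP[? ?]; split; apply: le_trans rr1 _.
have rO : box p r `<=` O.
  by apply: subset_trans r0O; apply: box_sub; case: rr0; lra.
have line_box x s : box p r x -> `|s| <= 2 -> O (p + s *: (x - p)).
  move=> xr s2; apply: r0O => i; have := xr i; rewrite !mxE addrAC subrr add0r.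
  rewrite normrM; set a := `|x 0 i - p 0 i| => ar.
  have a0 : 0 <= a by apply: normr_ge0.
  by case: rr0 => [rr0 _]; have := normr_ge0 s; nra.
have /choice[Phi HPhi] : forall x, exists F : R -> R, F 0 = 0 /\
    (box p r x -> forall s : R, -1 < s < 2 -> is_derive s 1 F
      (\sum_i theta i (p + s *: (x - p)) * (x - p) 0 i)).
  move=> x; have [xr|nxr] := pselect (box p r x); last first.
    by exists (fun=> 0); split.
  have [|F HF] := @local_primitive R (fun s =>
      \sum_i theta i (p + s *: (x - p)) * (x - p) 0 i) (-1) 2.
    move=> s /andP[s1 s2]; apply: continuous_sum_at => i.
    apply: continuousM; last exact: cst_continuous.
    apply: is_derive_continuous (is_derive_line oO (kth 1%N i) _).
    by apply: line_box => //; rewrite ler_norml; lra.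
  exists (fun s => F s - F 0); split; first by rewrite subrr.
  move=> _ s /HF dF.
  have -> : (fun s => F s - F 0) = F - cst (F 0) by apply/funext.
  by rewrite -[\sum_i _]subr0; apply: is_deriveB.
pose f x := Phi x 1.
pose M := n%:R * (n%:R * (n%:R * C)) + n%:R * (n%:R * C).
have M0 : 0 <= M by rewrite addr_ge0 // !mulr_ge0.
have est x y : box p r x -> box p r y ->
    `|f y - f x - \sum_i theta i x * (y 0 i - x 0 i)| <= M * `|y - x| * `|y - x|.
  move=> xr yr; set d := `|y - x|; have d0 : 0 <= d by apply: normr_ge0.
  have cd j : `|(y - x) 0 j| <= d by apply: norm_coord_le.
  have pr := box_center p rpos.
  pose xs s : 'rV[R]_n := p + s *: (x - p); pose ys s : 'rV[R]_n := p + s *: (y - p).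
  pose D (s : R) := Phi y s - Phi x s - s * \sum_i theta i (xs s) * (y - x) 0 i.
  pose D' (s : R) := \sum_i theta i (ys s) * (y - p) 0 i -
    \sum_i theta i (xs s) * (x - p) 0 i -
    (s * (\sum_i (y - x) 0 i * \sum_k partial k (theta i) (xs s) * (x - p) 0 k) +
     \sum_i theta i (xs s) * (y - x) 0 i).
  have := @mvt_le _ D D' 0 1 0 (M * d * d).
  have D0 : D 0 = 0.
    by rewrite /D (HPhi x).1 (HPhi y).1 mul0r !subr0.
  have D1 : D 1 = f y - f x - \sum_i theta i x * (y 0 i - x 0 i).
    rewrite /D /f mul1r /xs scale1r subrKC; congr (_ - _).
    by apply: eq_bigr => i _; rewrite !mxE.
  rewrite D0 -D1 mul0r !subr0 normr1 mulr1; apply=> s.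
  rewrite (min_idPl ler01) (max_idPr ler01) => s01.
  have s12 : -1 < s < 2 by case/andP: s01 => *; lra.
  have xsr : box p r (xs s) := box_segment pr xr s01.
  have ysr : box p r (ys s) := box_segment pr yr s01.
  split.
    have dsum : is_derive s 1 (fun s => \sum_i theta i (xs s) * (y - x) 0 i)
        (\sum_i (y - x) 0 i * \sum_k partial k (theta i) (xs s) * (x - p) 0 k).
      have -> : (fun s => \sum_i theta i (xs s) * (y - x) 0 i) =
          \sum_(i < n) (fun s => (y - x) 0 i * theta i (xs s)).
        by apply/funext => t; rewrite fct_sumE; apply: eq_bigr => i _; rewrite mulrC.
      apply: is_derive_sum => i.
      have := is_derive_line oO (kth 1%N i) (rO _ xsr).
      by move=> dl; have := is_deriveZ ((y - x) 0 i) dl.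
    have did := is_derive_id s (1 : R).
    have := is_deriveB (is_deriveB ((HPhi y).2 yr s s12) ((HPhi x).2 xr s s12))
      (is_deriveM did dsum).
    rewrite /D' [_ *: (1 : R)]mulr1 => dD.
    exact: dD.
  rewrite subr0.
  pose q k := theta k (ys s) - theta k (xs s) -
    \sum_i partial i (theta k) (xs s) * (ys s 0 i - xs s 0 i).
  have ysxs : ys s - xs s = s *: (y - x).
    by rewrite /ys /xs; apply/rowP => j; rewrite !mxE; ring.
  have DE : D' s = \sum_k q k * (y - p) 0 k +
      s * \sum_k \sum_i partial i (theta k) (xs s) * (y - x) 0 i * (y - x) 0 k.
    have E1 : \sum_i (y - x) 0 i * (\sum_k partial k (theta i) (xs s) * (x - p) 0 k)
       = \sum_k \sum_i partial i (theta k) (xs s) * (y - x) 0 i * (x - p) 0 k.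
      rewrite [RHS]exchange_big /=; apply: eq_bigr => i _; rewrite mulr_sumr.
      apply: eq_bigr => k _; rewrite (clo k i _ (rO _ xsr)); ring.
    have E2 : s * (\sum_k \sum_i partial i (theta k) (xs s) * (y - x) 0 i * (y - x) 0 k)
      = \sum_k (\sum_i partial i (theta k) (xs s) * (ys s 0 i - xs s 0 i)) * (y - x) 0 k.
      rewrite mulr_sumr; apply: eq_bigr => k _; rewrite mulr_sumr mulr_suml.
      apply: eq_bigr => i _.
      have -> : ys s 0 i - xs s 0 i = s * (y - x) 0 i.
        by have /rowP/(_ i) := ysxs; rewrite !mxE.
      by ring.
    have E3 : s * (\sum_k \sum_i partial i (theta k) (xs s) * (y - x) 0 i * (x - p) 0 k)
      = \sum_k (\sum_i partial i (theta k) (xs s) * (ys s 0 i - xs s 0 i)) * (x - p) 0 k.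
      rewrite mulr_sumr; apply: eq_bigr => k _; rewrite mulr_sumr mulr_suml.
      apply: eq_bigr => i _.
      have -> : ys s 0 i - xs s 0 i = s * (y - x) 0 i.
        by have /rowP/(_ i) := ysxs; rewrite !mxE.
      by ring.
    rewrite /D' E1 E2 E3 -!sumrB -!big_split -sumrB /=; apply: eq_bigr => k _.
    rewrite /q; set S := \sum_i _.
    have -> : (y - p) 0 k = (y - x) 0 k + (x - p) 0 k by rewrite !mxE; ring.
    ring.
  rewrite DE; apply: (le_trans (ler_normD _ _)).
  rewrite /M 2!mulrDl; apply: lerD.
    apply: (le_trans (ler_norm_sum _ _ _)).
    apply: (@le_trans _ _ (\sum_(k < n) n%:R * (n%:R * C) * d * d)); last first.
      by rewrite sumr_const card_ord -[_ *+ n]mulr_natl !mulrA.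
    apply: ler_sum => k _; rewrite normrM -[leRHS]mulr1; apply: ler_pM => //.
      have := taylor1 oO (kth 2%N k) rO C0 (fun i j x => H2 k i j x) xsr ysr.
      rewrite ysxs normrZ => /le_trans; apply.
      have sd : `|s| * `|y - x| <= d.
        by apply: ler_piMl => //; case/andP: s01 => *; rewrite ger0_norm.
      move: sd; set w := `|s| * `|y - x| => wd.
      have w0 : 0 <= w by rewrite /w mulr_ge0.
      have -> : n%:R * (n%:R * C) * d * d = n%:R * (n%:R * C * d) * d by ring.
      by apply: ler_pM; rewrite ?mulr_ge0 // ler_wpM2l // ler_wpM2l // mulr_ge0.
    rewrite mxE [(- p) 0 k]mxE; case: rr0 => _ r1'.
    by apply: le_trans r1'; apply: ltW; apply: yr.
  rewrite normrM -[leRHS]mul1r; apply: ler_pM => //.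
    by case/andP: s01 => *; rewrite ger0_norm.
  apply: (le_trans (ler_norm_sum _ _ _)).
  apply: (@le_trans _ _ (\sum_(k < n) n%:R * C * d * d)); last first.
    by rewrite sumr_const card_ord -[_ *+ n]mulr_natl !mulrA.
  apply: ler_sum => k _; apply: (le_trans (ler_norm_sum _ _ _)).
  apply: (@le_trans _ _ (\sum_(i < n) C * d * d)); last first.
    by rewrite sumr_const card_ord -[_ *+ n]mulr_natl !mulrA.
  apply: ler_sum => i _; rewrite !normrM.
  by apply: ler_pM; rewrite ?mulr_ge0 //; apply: ler_pM => //; apply: H1.
have oB := @box_open R n p r.
have df i x : box p r x -> is_derive x (delta_mx 0 i) f (theta i x).
  move=> xr; apply/(line_derive0 f); apply/is_deriveP => e e0.
  have [s s0 sB] := open_box oB xr.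
  have M1 : 0 < M + 1 by rewrite ltr_wpDl.
  exists (Num.min s (e / (M + 1))) => [|t].
    by rewrite lt_min s0 divr_gt0.
  rewrite lt_min => /andP[ts te].
  rewrite add0r scale0r addr0; set y := x + t *: _.
  have yi j : y 0 j - x 0 j = t * (j == i)%:R.
    by rewrite !mxE eqxx addrAC subrr add0r.
  have yr : box p r y.
    apply: sB => j; rewrite yi normrM.
    by case: eqP => _; rewrite ?normr1 ?normr0 ?mulr0 ?mulr1.
  have nyx : `|y - x| <= `|t|.
    apply: norm_le_coord => // j.
    rewrite [(y - x) 0 j]mxE [(- x) 0 j]mxE yi normrM.
    by case: eqP => _; rewrite ?normr1 ?normr0 ?mulr0 ?mulr1.
  have := est x y xr yr; rewrite (bigD1 i) //= big1 ?addr0; last first.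
    by move=> j /negPf ji; rewrite yi ji !mulr0.
  rewrite yi eqxx mulr1 => /le_trans; apply.
  apply: (@le_trans _ _ (M * `|t| * `|t|)).
    by apply: ler_pM; rewrite ?mulr_ge0 //; apply: ler_wpM2l.
  apply: ler_wpM2r => //; apply: (@le_trans _ _ ((M + 1) * `|t|)).
    by apply: ler_wpM2r => //; rewrite lerDl.
  by rewrite mulrC -ler_pdivlMr // ltW.
have cf x : box p r x -> {for x, continuous f}.
  move=> xr; apply/continuous_box => e e0.
  have [s s0 sB] := open_box oB xr.
  pose L := \sum_i `|theta i x| + M + 1.
  have S0 : 0 <= \sum_i `|theta i x| by rewrite sumr_ge0.
  have L0 : 0 < L by rewrite ltr_wpDl // addr_ge0.
  pose s' := Num.min 1 (Num.min s (e / L)).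
  have s'0 : 0 < s' by rewrite !lt_min s0 divr_gt0 // ltr01.
  exists s' => // y ys'.
  have yr : box p r y.
    by apply: sB; apply: box_sub ys'; rewrite /s' !ge_min lexx orbT.
  have nd : `|y - x| < s' by apply/norm_box.
  move: (nd); rewrite !lt_min => /and3P[d1 _ dL].
  have := est x y xr yr; set S := \sum_i _; set d := `|y - x| in d1 dL nd *.
  have dge0 : 0 <= d by apply: normr_ge0.
  move=> H; rewrite -[f y - f x](subrK S).
  apply: (le_lt_trans (ler_normD _ _)).
  have HS : `|S| <= (\sum_i `|theta i x|) * d.
    apply: (le_trans (ler_norm_sum _ _ _)); rewrite mulr_suml.
    apply: ler_sum => i _; rewrite normrM; apply: ler_wpM2l => //.
    by have := norm_coord_le (y - x) i; rewrite 2!mxE.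
  have Md : M * d * d <= M * d by apply: ler_piMr; [rewrite mulr_ge0|apply: ltW].
  have : L * d < e by rewrite mulrC -ltr_pdivlMr.
  apply: le_lt_trans; apply: (le_trans (lerD H HS)).
  have -> : L * d = (\sum_i `|theta i x|) * d + M * d + d by rewrite /L; ring.
  lra.
exists f, r; split => //; elim=> [|k IH]; first by split => // x; apply: cf.
by apply: (Ck_step oB cf df) => i; apply: Ck_sub rO (kth k i).
Qed.

End Poincare.

(** * Bump functions *)

Section Bump.
Context {R : realType}.

(** The classical flat functions; the exponent is there because the family is
    closed under derivation. *)
Definition flat (m : nat) (s : R) : R :=
  if 0 < s then s ^- m * expR (- s^-1) else 0.

Lemma flat_small m (t : R) : 
  `|flat m t| <= (m.+2%:R) ^+ m.+2 * (t * t).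
Proof.
rewrite /flat; case: ifPn => t0; last first.
  by rewrite normr0 mulr_ge0 ?exprn_ge0 // -expr2 sqr_ge0.
set N : R := m.+2%:R; have N0 : 0 < N by rewrite ltr0n.
have E : expR (t^-1) = expR ((N * t)^-1) ^+ m.+2.
  by rewrite -expRM_natl invfM mulrA divff ?mul1r // gt_eqF.
have f0 : 0 <= t ^- m * expR (- t^-1).
  by rewrite mulr_ge0 ?expR_ge0 // invr_ge0 exprn_ge0 // ltW.
rewrite (ger0_norm f0) expRN E -[X in _ * X]exprVn.
have H : (expR (N * t)^-1)^-1 <= N * t.
  rewrite -[leRHS]invrK lef_pV2 ?posrE ?expR_gt0 ?invr_gt0 ?mulr_gt0 //.
  by apply: le_trans (expR_ge1Dx _); rewrite lerDr.
have H2 : (expR (N * t)^-1)^-1 ^+ m.+2 <= (N * t) ^+ m.+2.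
  by apply: lerXn2r => //; rewrite nnegrE ?invr_ge0 ?expR_ge0 // mulr_ge0 // ltW.
apply: (@le_trans _ _ (t ^- m * (N * t) ^+ m.+2)).
  by apply: ler_wpM2l => //; rewrite invr_ge0 exprn_ge0 // ltW.
rewrite exprMn mulrCA ler_wpM2l ?exprn_ge0 // ?(ltW N0) //.
by rewrite !exprSr !mulrA mulVf ?mul1r // expf_neq0 // gt_eqF.
Qed.

Lemma flat_derive m (s : R) :
  is_derive s 1 (flat m) (flat m.+2 s - m%:R * flat m.+1 s).
Proof.
have [s0|s0|s0] := ltgtP s 0.
- have -> : flat m.+2 s - m%:R * flat m.+1 s = 0.
    by rewrite /flat ltNge (ltW s0) /= mulr0 subr0.
  have near0 : \forall y \near s, (cst 0 : R -> R) y = flat m y.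
    apply/nbhs_ballP; exists (- s); first by rewrite /= oppr_gt0.
    move=> y; rewrite /ball /= /flat ltr_norml => /andP[? ?].
    by rewrite ltNge (_ : y <= 0) //; lra.
  exact: (near_eq_is_derive near0 (is_derive_cst (0 : R) s (1 : R))).
- have sn0 : s != 0 by rewrite gt_eqF.
  have nears : \forall y \near s, (y^-1) ^+ m * expR (- y^-1) = flat m y.
    apply/nbhs_ballP; exists s => // y; rewrite /ball /= /flat ltr_norml.
    by move=> /andP[? ?]; rewrite (_ : 0 < y) ?exprVn //; lra.
  have dV : is_derive s 1 (fun y : R => y^-1) (- s ^- 2 *: (1 : R)).
    exact: is_deriveV.
  have dN : is_derive s 1 (fun y : R => - y^-1) (- (- s ^- 2 *: (1 : R))).
    exact: is_deriveN.
  have dE := is_derive_comp1 dN (is_derive_expR (- s^-1)).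
  have dX : is_derive s 1 (fun y : R => (y^-1) ^+ m)
      (m%:R * s^-1 ^+ m.-1 *: (- s ^- 2 *: (1 : R))).
    have -> : (fun y : R => (y^-1) ^+ m) = (fun y : R => y^-1) ^+ m.
      by apply/funext => y; rewrite exprfctE.
    exact: is_deriveX.
  apply: (near_eq_is_derive nears).
  have := is_deriveM dX dE; rewrite /flat s0.
  have -> // : s^-1 ^+ m *: (expR (- s^-1) * - (- s ^- 2)%:A) +
     expR (- s^-1) *: ((m%:R * s^-1 ^+ m.-1) *: (- s ^- 2)%:A) =
    s ^- m.+2 * expR (- s^-1) - m%:R * (s ^- m.+1 * expR (- s^-1)).
  rewrite ![_%:A]mulr1 ![_ *: _]mulrC -!exprVn; set x := s^-1; set E := expR _.
  case: m {dX nears} => [|m] /=; first by rewrite mul0r expr0 !mul0r mulr0; ring.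
  by rewrite !exprS; ring.
- have f0 k : flat k 0 = 0 by rewrite /flat ltxx.
  rewrite s0 !f0 mulr0 subr0.
  apply/is_deriveP => e e0; set N : R := (m.+2%:R) ^+ m.+2.
  have N0 : 0 < N by rewrite exprn_gt0 // ltr0n.
  exists (e / N) => [|t tr]; first by rewrite divr_gt0.
  rewrite add0r mul0r subr0 f0 subr0.
  apply: (le_trans (flat_small _ _)); rewrite -/N.
  have -> : t * t = `|t| * `|t| by rewrite -normrM ger0_norm // -expr2 sqr_ge0.
  rewrite mulrA ler_wpM2r // mulrC -ler_pdivlMr //; exact: ltW.
Qed.

Lemma Ck_flat n k (O : set 'rV[R]_n) m f : open O -> Ck k O f ->
  Ck k O (fun x => flat m (f x)).
Proof.
move=> oO; elim: k m => [|k IH] m kf.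
  split=> // x Ox; apply: (@continuous_comp _ _ _ f (flat m)).
    exact: Ck_continuous kf Ox.
  by apply: is_derive_continuous (flat_derive m (f x)).
apply: (Ck_comp1 (D := setT) oO (fun s _ => flat_derive m s)
  (fun _ _ => I) kf).
apply: CkB => //; first exact/IH/CkW.
by apply: CkM => //; [apply: Ck_cst|apply/IH/CkW].
Qed.

Lemma bump_function n (p : 'rV[R]_n) r : 0 < r ->
  exists rho : 'rV[R]_n -> R, [/\ forall k, Ck k setT rho, rho p != 0 &
    forall x, rho x != 0 -> box p r x].
Proof.
move=> r0.
exists (fun x => \prod_i flat 0 (r ^+ 2 - (x 0 i - p 0 i) ^+ 2)); split.
- move=> k; apply: Ck_prod => [|i _]; first exact: openT.
  apply: Ck_flat; first exact: openT.
  have cx : Ck k setT (fun x : 'rV[R]_n => x 0 i - p 0 i).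
    by apply: CkB; [apply: Ck_coord|apply: Ck_cst|]; apply: openT.
  by apply: CkB; [apply: Ck_cst|apply: CkM => //|]; apply: openT.
- apply/prodf_neq0 => i _; rewrite subrr expr0n subr0 /flat exprn_gt0 //.
  by rewrite expr0 invr1 mul1r gt_eqF // expR_gt0.
- move=> x; apply: contraNP => /existsNP[i /negP]; rewrite -leNgt => ri.
  apply/prodf_eq0; exists i => //; rewrite /flat ifN // -leNgt subr_le0.
  by rewrite -[leRHS]real_normK ?num_real // lerXn2r // nnegrE ltW.
Qed.

End Bump.

(** * Directional derivatives, brackets and Lie derivatives *)

Definition pd {R : realType} {n p q : nat} (i : 'I_n)
    (A : 'rV[R]_n -> 'M[R]_(p, q)) (x : 'rV[R]_n) : 'M[R]_(p, q) :=
  \matrix_(a, b) partial i (fun y => A y a b) x.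

(** Directional derivative of a field of matrices, and matrix of the differential
    of a vector field.  They are locked so that unification never unfolds the
    limits of which derivatives are made. *)
HB.lock Definition dird {R : realType} {n p q : nat} (v : 'cV[R]_n)
    (A : 'rV[R]_n -> 'M[R]_(p, q)) (x : 'rV[R]_n) : 'M[R]_(p, q) :=
  \sum_i v i 0 *: pd i A x.

HB.lock Definition dv {R : realType} {n p : nat}
    (X : 'rV[R]_n -> 'cV[R]_p) (x : 'rV[R]_n) : 'M[R]_(p, n) :=
  \matrix_(k, i) partial i (fun y => X y k 0) x.

Section Directional.
Context {R : realType} {n : nat}.
Implicit Types (O : set 'rV[R]_n) (x : 'rV[R]_n) (v w : 'cV[R]_n).

Definition smoothm p q O (A : 'rV[R]_n -> 'M[R]_(p, q)) : Prop :=
  forall k, Ckm k O A.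

Lemma dird_sum p q v (A : 'rV[R]_n -> 'M[R]_(p, q)) x :
  dird v A x = \sum_i v i 0 *: pd i A x.
Proof. by rewrite dird.unlock; apply: eq_bigr. Qed.

Lemma dvE p (X : 'rV[R]_n -> 'cV[R]_p) x k i :
  dv X x k i = partial i (fun y => X y k 0) x.
Proof. by rewrite dv.unlock mxE. Qed.

Lemma dird_dv p v (X : 'rV[R]_n -> 'cV[R]_p) x : dird v X x = dv X x *m v.
Proof.
apply/colP => k; rewrite dird_sum summxE mxE; apply: eq_bigr => i _.
by rewrite !mxE dvE mulrC.
Qed.

Lemma dirdE p q v (A : 'rV[R]_n -> 'M[R]_(p, q)) x a b :
  dird v A x a b = \sum_i v i 0 * partial i (fun y => A y a b) x.
Proof. by rewrite dird_sum summxE; apply: eq_bigr => i _; rewrite !mxE. Qed.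

Lemma dird_delta p q i (A : 'rV[R]_n -> 'M[R]_(p, q)) x :
  dird (delta_mx i 0) A x = pd i A x.
Proof.
rewrite dird_sum (bigD1 i) //= mxE !eqxx scale1r big1 ?addr0 // => j /negPf ji.
by rewrite mxE ji scale0r.
Qed.

Lemma dird_ext p q v O (A B : 'rV[R]_n -> 'M[R]_(p, q)) x : open O -> O x ->
  (forall y, O y -> A y = B y) -> dird v A x = dird v B x.
Proof.
move=> oO Ox AB; rewrite !dird_sum; apply: eq_bigr => i _.
congr (_ *: _); apply/matrixP => a b.
by rewrite !mxE; apply: (partial_ext _ oO Ox) => y Oy; rewrite AB.
Qed.

Lemma dv_ext p O (A B : 'rV[R]_n -> 'cV[R]_p) x : open O -> O x ->
  (forall y, O y -> A y = B y) -> dv A x = dv B x.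
Proof.
move=> oO Ox AB; apply/matrixP => a b.
by rewrite !dvE; apply: (partial_ext _ oO Ox) => y Oy; rewrite AB.
Qed.

Lemma pd_cst p q i (A : 'M[R]_(p, q)) x : pd i (fun=> A) x = 0.
Proof. by apply/matrixP => a b; rewrite !mxE; apply: derive_cst. Qed.

Lemma dird_cst p q v (A : 'M[R]_(p, q)) x : dird v (fun=> A) x = 0.
Proof. by rewrite dird_sum big1 // => i _; rewrite pd_cst scaler0. Qed.

Lemma dird_lin p q (a : R) v w (A : 'rV[R]_n -> 'M[R]_(p, q)) x :
  dird (a *: v + w) A x = a *: dird v A x + dird w A x.
Proof.
rewrite !dird_sum scaler_sumr -big_split; apply: eq_bigr => i _ /=.
by rewrite !mxE scalerDl scalerA.
Qed.

Lemma dird_tr p q v (A : 'rV[R]_n -> 'M[R]_(p, q)) x :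
  dird v (fun y => (A y)^T) x = (dird v A x)^T.
Proof.
apply/matrixP => a b; rewrite mxE !dirdE; apply: eq_bigr => i _.
congr (_ * partial i _ x); apply/funext => y; by rewrite mxE.
Qed.

Lemma partialD i O f g x : Ck 1 O f -> Ck 1 O g -> O x ->
  partial i (fun y => f y + g y) x = partial i f x + partial i g x.
Proof.
move=> kf kg Ox; rewrite /partial.
by have [_ ->] := is_deriveD (Ck_is_derive i kf Ox) (Ck_is_derive i kg Ox).
Qed.

Lemma partialM i O f g x : Ck 1 O f -> Ck 1 O g -> O x ->
  partial i (fun y => f y * g y) x = partial i f x * g x + f x * partial i g x.
Proof.
move=> kf kg Ox; rewrite /partial.
have [_ ->] := is_deriveM (Ck_is_derive i kf Ox) (Ck_is_derive i kg Ox).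
by rewrite addrC [_ *: _]mulrC.
Qed.

Lemma partial_sum i (I : finType) O (F : I -> 'rV[R]_n -> R) x : open O ->
  (forall j, Ck 1 O (F j)) -> O x ->
  partial i (fun y => \sum_j F j y) x = \sum_j partial i (F j) x.
Proof.
move=> oO kF Ox.
have : forall s : seq I, partial i (fun y => \sum_(j <- s) F j y) x =
    \sum_(j <- s) partial i (F j) x.
  elim=> [|j s IH].
    rewrite big_nil (_ : (fun y => _) = cst 0); first exact: derive_cst.
    by apply/funext => y; rewrite big_nil.
  have -> : (fun y => \sum_(k <- j :: s) F k y) =
      (fun y => F j y + \sum_(k <- s) F k y).
    by apply/funext => y; rewrite big_cons.
  rewrite big_cons -IH.
  by apply: (partialD _ (kF j) (g := fun y => \sum_(k <- s) F k y)) => //;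
    apply: Ck_sum.
exact.
Qed.

Lemma pdM i p q r O (A : 'rV[R]_n -> 'M[R]_(p, q)) (B : 'rV[R]_n -> 'M[R]_(q, r))
    x : open O -> Ckm 1 O A -> Ckm 1 O B -> O x ->
  pd i (fun y => A y *m B y) x = pd i A x *m B x + A x *m pd i B x.
Proof.
move=> oO kA kB Ox; apply/matrixP => a b; rewrite !mxE.
transitivity (partial i (fun y => \sum_j A y a j * B y j b) x).
  by congr (partial i _ x); apply/funext => y; rewrite mxE.
rewrite (partial_sum _ oO) //; last by move=> j; apply: CkM.
rewrite -big_split; apply: eq_bigr => j _ /=; rewrite !mxE.
exact: (partialM _ (kA a j) (kB j b) Ox).
Qed.

Lemma dirdM v p q r O (A : 'rV[R]_n -> 'M[R]_(p, q))
    (B : 'rV[R]_n -> 'M[R]_(q, r)) x :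
  open O -> Ckm 1 O A -> Ckm 1 O B -> O x ->
  dird v (fun y => A y *m B y) x = dird v A x *m B x + A x *m dird v B x.
Proof.
move=> oO kA kB Ox; rewrite !dird_sum mulmx_suml mulmx_sumr -big_split.
apply: eq_bigr => i _ /=.
by rewrite (pdM i oO kA kB Ox) scalerDr -scalemxAl -scalemxAr.
Qed.

Lemma dirdD v p q O (A B : 'rV[R]_n -> 'M[R]_(p, q)) x :
  open O -> Ckm 1 O A -> Ckm 1 O B -> O x ->
  dird v (fun y => A y + B y) x = dird v A x + dird v B x.
Proof.
move=> oO kA kB Ox; apply/matrixP => a b; rewrite mxE !dirdE -big_split.
apply: eq_bigr => i _ /=; rewrite -mulrDr; congr (_ * _).
rewrite -(partialD _ (kA a b) (kB a b) Ox); congr (partial i _ x).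
by apply/funext => y; rewrite mxE.
Qed.

Lemma dirdZ v p q O (f : 'rV[R]_n -> R) (A : 'rV[R]_n -> 'M[R]_(p, q)) x :
  open O -> Ck 1 O f -> Ckm 1 O A -> O x ->
  dird v (fun y => f y *: A y) x = (d0 f x *m v) 0 0 *: A x + f x *: dird v A x.
Proof.
move=> oO kf kA Ox; apply/matrixP => a b; rewrite !mxE !dirdE mulr_suml mulr_sumr.
rewrite -big_split; apply: eq_bigr => i _ /=; rewrite !mxE.
transitivity (v i 0 * partial i (fun y => f y * A y a b) x).
  by congr (_ * partial i _ x); apply/funext => y; rewrite mxE.
rewrite (partialM _ kf (kA a b) Ox); ring.
Qed.

Lemma dirdN v p q O (A : 'rV[R]_n -> 'M[R]_(p, q)) x :
  open O -> Ckm 1 O A -> O x ->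
  dird v (fun y => - A y) x = - dird v A x.
Proof.
move=> oO kA Ox.
have := dirdD v oO kA (CkmN oO kA) Ox.
have -> : dird v (fun y => A y - A y) x = 0.
  by rewrite (_ : (fun y => _) = fun=> 0) ?dird_cst //; apply/funext => y; rewrite subrr.
by move/esym/eqP; rewrite addrC addr_eq0 => /eqP.
Qed.

Lemma dirdB v p q O (A B : 'rV[R]_n -> 'M[R]_(p, q)) x :
  open O -> Ckm 1 O A -> Ckm 1 O B -> O x ->
  dird v (fun y => A y - B y) x = dird v A x - dird v B x.
Proof.
by move=> oO kA kB Ox; rewrite (dirdD v oO kA (CkmN oO kB) Ox) (dirdN v oO kB Ox).
Qed.

Lemma lie_bracketE X Y x :
  lie_bracket X Y x = dv Y x *m X x - dv X x *m Y x :> 'cV[R]_n.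
Proof.
apply/colP => k; rewrite !mxE -sumrB; apply: eq_bigr => i _; rewrite !dvE; ring.
Qed.

Lemma lie_deriv11E X T x :
  lie_deriv11 X T x = dird (X x) T x - dv X x *m T x + T x *m dv X x :> 'M[R]_n.
Proof.
apply/matrixP => i j; rewrite !mxE dirdE -sumrB -big_split.
by apply: eq_bigr => k _; rewrite !dvE /=; ring.
Qed.

Lemma smoothm_ext p q O (A B : 'rV[R]_n -> 'M[R]_(p, q)) : open O ->
  (forall y, O y -> A y = B y) -> smoothm O A -> smoothm O B.
Proof. by move=> oO AB sA k; apply: Ckm_ext (sA k). Qed.

Lemma smoothmM p q r O (A : 'rV[R]_n -> 'M[R]_(p, q))
    (B : 'rV[R]_n -> 'M[R]_(q, r)) : open O ->
  smoothm O A -> smoothm O B -> smoothm O (fun x => A x *m B x).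
Proof. by move=> oO sA sB k; apply: CkmM. Qed.

Lemma smoothmD p q O (A B : 'rV[R]_n -> 'M[R]_(p, q)) : open O ->
  smoothm O A -> smoothm O B -> smoothm O (fun x => A x + B x).
Proof. by move=> oO sA sB k; apply: CkmD. Qed.

Lemma smoothmN p q O (A : 'rV[R]_n -> 'M[R]_(p, q)) : open O ->
  smoothm O A -> smoothm O (fun x => - A x).
Proof. by move=> oO sA k; apply: CkmN. Qed.

Lemma smoothmB p q O (A B : 'rV[R]_n -> 'M[R]_(p, q)) : open O ->
  smoothm O A -> smoothm O B -> smoothm O (fun x => A x - B x).
Proof. by move=> oO sA sB k; apply: CkmB. Qed.

Lemma smoothm_cst p q O (A : 'M[R]_(p, q)) : smoothm O (fun=> A).
Proof. by move=> k; apply: Ckm_cst. Qed.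

Lemma smoothmZ p q O f (A : 'rV[R]_n -> 'M[R]_(p, q)) : open O ->
  smooth_on O f -> smoothm O A -> smoothm O (fun x => f x *: A x).
Proof. by move=> oO sf sA k; apply: CkmZ. Qed.

Lemma smoothm_tr p q O (A : 'rV[R]_n -> 'M[R]_(p, q)) : open O ->
  smoothm O A -> smoothm O (fun x => (A x)^T).
Proof. by move=> oO sA k; apply: Ckm_tr. Qed.

Lemma smoothm_dv p O (X : 'rV[R]_n -> 'cV[R]_p) : open O ->
  smoothm O X -> smoothm O (dv X).
Proof.
move=> oO sX k i j.
by apply: Ck_ext (Ck_partial j (sX k.+1 i 0)) => // y _; rewrite dvE.
Qed.

Lemma smoothm_dird p q O X (A : 'rV[R]_n -> 'M[R]_(p, q)) : open O ->
  smoothm O X -> smoothm O A -> smoothm O (fun x => dird (X x) A x).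
Proof.
move=> oO sX sA k a b.
apply: (@Ck_ext _ _ _ _ (fun x => \sum_i X x i 0 * partial i (fun y => A y a b) x)).
- by [].
- by move=> y _; rewrite dirdE.
- by apply: Ck_sum => // i _; apply: CkM => //; [apply: sX|apply: Ck_partial; apply: sA].
Qed.

Lemma smoothm_lie O X T : open O -> smoothm O X -> smoothm O T ->
  smoothm O (lie_deriv11 X T).
Proof.
move=> oO sX sT; apply: (smoothm_ext oO (fun y _ => esym (lie_deriv11E X T y))).
apply: smoothmD => //; last by apply: smoothmM => //; apply: smoothm_dv.
apply: smoothmB => //; first exact: smoothm_dird.
by apply: smoothmM => //; apply: smoothm_dv.
Qed.

Lemma lieM O X S T x : open O -> smoothm O S -> smoothm O T -> O x ->
  lie_deriv11 X (fun y => S y *m T y) x =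
  lie_deriv11 X S x *m T x + S x *m lie_deriv11 X T x.
Proof.
move=> oO sS sT Ox; rewrite !lie_deriv11E (dirdM _ oO (sS 1%N) (sT 1%N) Ox).
rewrite !(mulmxDr, mulmxDl, mulmxN, mulNmx) !mulmxA.
set a := dird _ S x *m _; set b := S x *m dird _ _ _.
set c := dv X x *m S x *m T x; set d := S x *m T x *m dv X x.
set e := S x *m dv X x *m T x.
move: a b c d e => a b c d e.
by apply/matrixP => i j; rewrite !mxE; ring.
Qed.

Lemma lieD O X S T x : open O -> smoothm O S -> smoothm O T -> O x ->
  lie_deriv11 X (fun y => S y + T y) x = lie_deriv11 X S x + lie_deriv11 X T x.
Proof.
move=> oO sS sT Ox; rewrite !lie_deriv11E (dirdD _ oO (sS 1%N) (sT 1%N) Ox).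
rewrite !mulmxDr !mulmxDl opprD.
by apply/matrixP => a b; rewrite !mxE; ring.
Qed.

Lemma lieN O X S x : open O -> smoothm O S -> O x ->
  lie_deriv11 X (fun y => - S y) x = - lie_deriv11 X S x.
Proof.
move=> oO sS Ox; rewrite !lie_deriv11E (dirdN _ oO (sS 1%N) Ox).
by rewrite mulmxN mulNmx !opprD.
Qed.

Lemma lieZ O X f S x : open O -> smooth_on O f -> smoothm O S -> O x ->
  lie_deriv11 X (fun y => f y *: S y) x =
  (d0 f x *m X x) 0 0 *: S x + f x *: lie_deriv11 X S x.
Proof.
move=> oO sf sS Ox; rewrite !lie_deriv11E (dirdZ _ oO (sf 1%N) (sS 1%N) Ox).
rewrite -scalemxAr -scalemxAl !scalerDr scalerN.
by apply/matrixP => a b; rewrite !mxE; ring.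
Qed.

Lemma lie_ext O X S T x : open O -> O x -> (forall y, O y -> S y = T y) ->
  lie_deriv11 X S x = lie_deriv11 X T x.
Proof.
by move=> oO Ox ST; rewrite !lie_deriv11E (dird_ext _ oO Ox ST) ST.
Qed.

End Directional.

(** * The Levi-Civita connection and its curvature *)

(** The matrix of [w |-> Gamma(v, w)], [Gamma] being the Christoffel symbols. *)
HB.lock Definition gam {R : realType} {n : nat} (g : 'rV[R]_n -> 'M[R]_n)
    (x : 'rV[R]_n) (v : 'cV[R]_n) : 'M[R]_n :=
  \matrix_(k, j) \sum_i christoffel g k i j x * v i 0.

Section LeviCivita.
Context {R : realType} {n : nat}.
Implicit Types (x : 'rV[R]_n) (v w : 'cV[R]_n).

Lemma gamE g x v k j : gam g x v k j = \sum_i christoffel g k i j x * v i 0.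
Proof. by rewrite gam.unlock mxE. Qed.

Lemma levi_civitaE g X Y x :
  levi_civita g X Y x = dv Y x *m X x + gam g x (X x) *m Y x.
Proof.
apply/colP => k; rewrite !mxE; congr (_ + _).
  by apply: eq_bigr => i _; rewrite dvE mulrC.
rewrite exchange_big /=; apply: eq_bigr => j _; rewrite gamE mulr_suml.
by apply: eq_bigr => i _; ring.
Qed.

Lemma gam_lin g x a v w : gam g x (a *: v + w) = a *: gam g x v + gam g x w.
Proof.
apply/matrixP => k j; rewrite [RHS]mxE [X in _ = X + _]mxE !gamE mulr_sumr -big_split; apply: eq_bigr => i _ /=.
by rewrite !mxE; ring.
Qed.

Variables (O : set 'rV[R]_n) (g : 'rV[R]_n -> 'M[R]_n).
Hypothesis oO : open O.
Hypothesis kg : Ckm 1 O g.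
Hypothesis gsym : forall x, O x -> (g x)^T = g x.
Hypothesis gunit : forall x, O x -> g x \in unitmx.

Lemma partial_gsym i k l x : O x ->
  partial i (fun y => g y k l) x = partial i (fun y => g y l k) x.
Proof.
move=> Ox; apply: (partial_ext _ oO Ox) => y Oy.
by rewrite -[in LHS](gsym Oy) mxE.
Qed.

Lemma christoffelC k i j x : O x -> christoffel g k i j x = christoffel g k j i x.
Proof.
move=> Ox; rewrite /christoffel; congr (_ * _); apply: eq_bigr => l _.
by congr (_ * _); rewrite (partial_gsym l i j Ox); ring.
Qed.

(** The Levi-Civita connection has no torsion. *)
Lemma gamC x v w : O x -> gam g x v *m w = gam g x w *m v.
Proof.
move=> Ox; apply/colP => k; rewrite !mxE.
under eq_bigr do rewrite gamE mulr_suml.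
rewrite exchange_big /=; apply: eq_bigr => i _; rewrite gamE mulr_suml.
by apply: eq_bigr => j _; rewrite (christoffelC k i j Ox); ring.
Qed.

Lemma g_gam x v m j : O x -> (g x *m gam g x v) m j =
  \sum_i 2^-1 * (partial i (fun y => g y j m) x + partial j (fun y => g y i m) x
     - partial m (fun y => g y i j) x) * v i 0.
Proof.
move=> Ox; rewrite mxE; under eq_bigr do rewrite gamE mulr_sumr.
rewrite exchange_big /=; apply: eq_bigr => i _.
transitivity (2^-1 * (\sum_k \sum_l g x m k * invmx (g x) k l *
    (partial i (fun y => g y j l) x + partial j (fun y => g y i l) x
     - partial l (fun y => g y i j) x)) * v i 0).
  rewrite mulr_sumr mulr_suml; apply: eq_bigr => k _; rewrite /christoffel.
  rewrite (_ : \sum_l g x m k * invmx (g x) k l * _ = g x m k * \sum_l invmx (g x) k l *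
    (partial i (fun y => g y j l) x + partial j (fun y => g y i l) x
     - partial l (fun y => g y i j) x)); first by ring.
  by rewrite mulr_sumr; apply: eq_bigr => l _; rewrite mulrA.
congr (_ * _ * _); rewrite exchange_big /=.
transitivity (\sum_l (1%:M : 'M[R]_n) m l * (partial i (fun y => g y j l) x +
   partial j (fun y => g y i l) x - partial l (fun y => g y i j) x)).
  apply: eq_bigr => l _; rewrite -mulr_suml; congr (_ * _).
  by rewrite -(mulmxV (gunit Ox)) mxE.
rewrite (bigD1 m) //= mxE eqxx mul1r big1 ?addr0 // => l /negPf lm.
by rewrite mxE eq_sym lm mul0r.
Qed.

(** The Levi-Civita connection preserves the metric. *)
Lemma dird_metric v x : O x ->
  dird v g x = (gam g x v)^T *m g x + g x *m gam g x v.
Proof.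
move=> Ox.
have -> : (gam g x v)^T *m g x = (g x *m gam g x v)^T.
  by rewrite trmx_mul (gsym Ox).
apply/matrixP => a b; rewrite dirdE mxE g_gam // [X in X + _]mxE g_gam //.
rewrite -big_split; apply: eq_bigr => i _ /=.
by rewrite (partial_gsym i b a Ox) (partial_gsym a i b Ox) (partial_gsym b i a Ox);
  field.
Qed.

(** The matrix of [X |-> nabla_X Z]. *)
Definition nab (Z : 'rV[R]_n -> 'cV[R]_n) x : 'M[R]_n :=
  \matrix_(k, i) (dv Z x k i + (gam g x (Z x)) k i).

Lemma nabE Z x : nab Z x = dv Z x + gam g x (Z x).
Proof. by apply/matrixP => k i; rewrite !mxE. Qed.

Lemma levi_civita_nab X Z x : O x -> levi_civita g X Z x = nab Z x *m X x.
Proof. by move=> Ox; rewrite levi_civitaE nabE mulmxDl (gamC (X x) (Z x) Ox). Qed.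

(** The curvature [R(v, w)Z] at a point, in terms of the matrix [A] of
    [X |-> nabla_X Z]. *)
Definition curv (A : 'rV[R]_n -> 'M[R]_n) x v w : 'cV[R]_n :=
  dird v A x *m w - dird w A x *m v + (gam g x v *m A x *m w
    - gam g x w *m A x *m v).

(** The curvature only depends on the values of [X] and [Y] at the point:
    their derivatives cancel against the bracket. *)
Lemma curvatureE A X Y Z x : Ckm 1 O A -> Ckm 1 O X -> Ckm 1 O Y ->
  (forall y, O y -> nab Z y = A y) -> O x ->
  curvature g X Y Z x = curv A x (X x) (Y x).
Proof.
move=> kA kX kY NA Ox.
have E1 W V : Ckm 1 O W -> levi_civita g V (levi_civita g W Z) x =
    dird (V x) A x *m W x + A x *m dv W x *m V x + gam g x (V x) *m A x *m W x.
  move=> kW.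
  have loc y : O y -> levi_civita g W Z y = A y *m W y.
    by move=> Oy; rewrite levi_civita_nab // NA.
  rewrite levi_civitaE loc // (dv_ext oO Ox loc) -dird_dv.
  by rewrite (dirdM _ oO kA kW Ox) dird_dv !mulmxA.
rewrite /curvature !E1 // levi_civita_nab // NA // lie_bracketE mulmxBr !mulmxA.
rewrite /curv.
move: (dird (X x) A x *m Y x) (dird (Y x) A x *m X x) (A x *m dv Y x *m X x)
  (A x *m dv X x *m Y x) (gam g x (X x) *m A x *m Y x)
  (gam g x (Y x) *m A x *m X x) => a b c d e f.
by apply/colP => i; rewrite !mxE; ring.
Qed.

End LeviCivita.

(** * Almost contact metric structures at a point *)

Section PointwiseAlgebra.
Context {R : realType} {n : nat}.
Variables (phi g : 'M[R]_n) (xi : 'cV[R]_n) (eta : 'rV[R]_n).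
Hypothesis phi2 : phi *m phi = - 1%:M + xi *m eta.
Hypothesis eta_xi : eta *m xi = 1%:M.
Hypothesis compat : phi^T *m g *m phi = g - eta^T *m eta.
Hypothesis gsym : g^T = g.

(** [phi] commutes with [phi^2], hence maps the kernel of [phi^2], the line of
    [xi], to itself; as [phi^2] vanishes there, so does [phi]. *)
Lemma phi_xi : phi *m xi = 0.
Proof.
have phi2xi : phi *m phi *m xi = 0.
  by rewrite phi2 mulmxDl mulNmx mul1mx -mulmxA eta_xi mulmx1 addNr.
have comm : xi *m (eta *m phi) = phi *m xi *m eta.
  have : phi *m (phi *m phi) = phi *m phi *m phi by rewrite mulmxA.
  rewrite phi2 mulmxDr mulmxDl mulmxN mulmx1 mulNmx mul1mx => /addrI E.
  by rewrite mulmxA -E mulmxA.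
have phixi : phi *m xi = xi *m (eta *m phi *m xi).
  by rewrite mulmxA comm -mulmxA eta_xi mulmx1.
set a := eta *m phi *m xi in phixi.
have : xi *m (a *m a) = 0.
  rewrite mulmxA -phixi -mulmxA; move: phi2xi.
  by rewrite -mulmxA [phi *m xi in LHS]phixi mulmxA phixi -!mulmxA.
move/(congr1 (mulmx eta)); rewrite mulmxA eta_xi mul1mx mulmx0 => aa; clearbody a.
have a0 : a = 0.
  apply/matrixP => i j; rewrite !ord1 [RHS]mxE.
  have /matrixP/(_ 0 0) := aa; rewrite !mxE big_ord1 => /eqP.
  by rewrite mulf_eq0 orbb => /eqP.
by rewrite phixi a0 mulmx0.
Qed.

Lemma eta_phi : eta *m phi = 0.
Proof.
have : phi *m (phi *m phi) = phi *m phi *m phi by rewrite mulmxA.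
rewrite phi2 mulmxDr mulmxDl mulmxN mulmx1 mulNmx mul1mx => /addrI.
rewrite mulmxA phi_xi mul0mx => /esym/(congr1 (mulmx eta)).
by rewrite mulmx0 !mulmxA eta_xi mul1mx.
Qed.

Lemma phi3 : phi *m phi *m phi = - phi.
Proof. by rewrite phi2 mulmxDl mulNmx mul1mx -mulmxA eta_phi mulmx0 addr0. Qed.

Lemma g_xi : g *m xi = eta^T.
Proof.
have /(congr1 (mulmx^~ xi)) := compat.
rewrite /= -mulmxA phi_xi mulmx0 mulmxBl -mulmxA eta_xi mulmx1 => /esym/eqP.
by rewrite subr_eq0 => /eqP.
Qed.

(** Composing the compatibility condition with [phi] turns [phi^T g phi^2]
    into [- phi^T g]. *)
Lemma g_phi_skew : (g *m phi)^T = - (g *m phi).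
Proof.
have /(congr1 (mulmx^~ phi)) := compat.
rewrite /= mulmxBl -[_ *m eta *m phi]mulmxA eta_phi mulmx0 subr0 -mulmxA phi2.
rewrite mulmxDr mulmxN mulmx1 mulmxA -[phi^T *m g *m xi]mulmxA g_xi -trmx_mul.
by rewrite eta_phi trmx0 mul0mx addr0 trmx_mul gsym => <-; rewrite opprK.
Qed.

Lemma g_phi2_sym : (g *m (phi *m phi))^T = g *m (phi *m phi).
Proof.
by rewrite phi2 mulmxDr mulmxN mulmx1 mulmxA g_xi !linearD !linearN /= gsym
  trmx_mul trmxK.
Qed.

Variable h : 'M[R]_n.
Hypothesis hphi : h *m phi = - (phi *m h).
Hypothesis etah : eta *m h = 0.

Lemma h_xi : h *m xi = 0.
Proof.
have : phi *m (phi *m h *m xi) = 0.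
  by rewrite -[phi *m h]opprK -hphi mulNmx -mulmxA phi_xi mulmx0 oppr0 mulmx0.
rewrite !mulmxA phi2 !mulmxDl !mulNmx mul1mx -!mulmxA [eta *m (h *m xi)]mulmxA.
by rewrite etah mul0mx mulmx0 addr0 => /eqP; rewrite oppr_eq0 => /eqP.
Qed.

Lemma phi2_h : phi *m phi *m h = - h.
Proof. by rewrite phi2 mulmxDl mulNmx mul1mx -mulmxA etah mulmx0 addr0. Qed.

Lemma h_phi2 : h *m (phi *m phi) = - h.
Proof. by rewrite phi2 mulmxDr mulmxN mulmx1 mulmxA h_xi mul0mx addr0. Qed.

(* In the names below the letter B stands for [phi h]. *)
Lemma B_phi : phi *m h *m phi = h.
Proof. by rewrite -mulmxA hphi mulmxN mulmxA phi2_h opprK. Qed.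

Lemma phi_B : phi *m (phi *m h) = - h.
Proof. by rewrite mulmxA phi2_h. Qed.

Lemma B2 : phi *m h *m (phi *m h) = h *m h.
Proof. by rewrite mulmxA B_phi. Qed.

End PointwiseAlgebra.

(** * Almost Kenmotsu structures in a chart *)

(** The tensor [h].  Locked, like the directional derivatives of which it is
    made. *)
HB.lock Definition hten {R : realType} {n : nat} (phi : 'rV[R]_n -> 'M[R]_n)
    (xi : 'rV[R]_n -> 'cV[R]_n) (x : 'rV[R]_n) : 'M[R]_n :=
  2^-1 *: lie_deriv11 xi phi x.

Lemma htenE {R : realType} {n : nat} (phi : 'rV[R]_n -> 'M[R]_n) xi x :
  hten phi xi x = 2^-1 *: lie_deriv11 xi phi x.
Proof. by rewrite hten.unlock. Qed.

Section LocalStructure.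
Context {R : realType} {n : nat}.
Variables (O : set 'rV[R]_n).
Variables (phi g : 'rV[R]_n -> 'M[R]_n) (xi : 'rV[R]_n -> 'cV[R]_n)
  (eta : 'rV[R]_n -> 'rV[R]_n).
Implicit Types (x : 'rV[R]_n) (v w : 'cV[R]_n).
Hypothesis oO : open O.
Hypothesis sphi : smoothm O phi.
Hypothesis sg : smoothm O g.
Hypothesis sxi : smoothm O xi.
Hypothesis seta : smoothm O eta.
Hypothesis phi2 : forall x, O x -> phi x *m phi x = - 1%:M + xi x *m eta x.
Hypothesis eta_xi : forall x, O x -> eta x *m xi x = 1%:M.
Hypothesis compat : forall x, O x ->
  (phi x)^T *m g x *m phi x = g x - (eta x)^T *m eta x.
Hypothesis gsym : forall x, O x -> (g x)^T = g x.
Hypothesis gpos : forall x, O x -> forall v, v != 0 ->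
  0 < (v^T *m g x *m v) 0 0.

Lemma g_unit x : O x -> g x \in unitmx.
Proof.
move=> Ox; rewrite -row_free_unit -kermx_eq0; apply/eqP/row_matrixP => i.
rewrite row0; apply/eqP/negPn/negP => k0.
have : (row i (kermx (g x)))^T != 0 by rewrite -trmx0 (inj_eq trmx_inj).
move/(gpos Ox); rewrite trmxK.
have -> : row i (kermx (g x)) *m g x = 0.
  by apply/sub_kermxP; apply: row_sub.
by rewrite mul0mx mxE ltxx.
Qed.

Local Notation hten := (hten phi xi).

Definition Bten x : 'M[R]_n := phi x *m hten x.
(** This turns out to be [X |-> nabla_X xi], see [nabla_xi]. *)
Definition Aten x : 'M[R]_n := - (phi x *m phi x) - Bten x.

Lemma lie_phi x : lie_deriv11 xi phi x = 2 *: hten x.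
Proof. by rewrite htenE scalerA divff ?scale1r // pnatr_eq0. Qed.

Lemma smooth_hten : smoothm O hten.
Proof.
apply: (smoothm_ext oO (fun y _ => esym (htenE phi xi y))) => k.
by apply: CkmZ => //; [apply: Ck_cst|apply: smoothm_lie].
Qed.

Lemma smooth_Bten : smoothm O Bten.
Proof. by apply: smoothmM => //; apply: smooth_hten. Qed.

Lemma smooth_Aten : smoothm O Aten.
Proof.
apply: smoothmB => //; last exact: smooth_Bten.
by apply: smoothmN => //; apply: smoothmM.
Qed.

Let phi_xi' x (Ox : O x) := phi_xi (phi2 Ox) (eta_xi Ox).
Let eta_phi' x (Ox : O x) := eta_phi (phi2 Ox) (eta_xi Ox).
Let phi3' x (Ox : O x) := phi3 (phi2 Ox) (eta_xi Ox).
Let g_xi' x (Ox : O x) := g_xi (phi2 Ox) (eta_xi Ox) (compat Ox).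
Let g_phi_skew' x (Ox : O x) :=
  g_phi_skew (phi2 Ox) (eta_xi Ox) (compat Ox) (gsym Ox).
Let g_phi2_sym' x (Ox : O x) :=
  g_phi2_sym (phi2 Ox) (eta_xi Ox) (compat Ox) (gsym Ox).

Hypothesis deta : forall x, O x -> d1 eta x = 0.

Lemma deta_sym x i j : O x ->
  partial i (fun y => eta y 0 j) x = partial j (fun y => eta y 0 i) x.
Proof.
by move=> Ox; have /matrixP/(_ i j) := deta Ox; rewrite !mxE => /eqP;
  rewrite subr_eq0 => /eqP.
Qed.

(** Cartan's formula: [L_xi eta = d (eta xi) + i_xi (d eta)], and both terms
    vanish. *)
Lemma lie_eta x : O x -> dird (xi x) eta x + eta x *m dv xi x = 0.
Proof.
move=> Ox; apply/rowP => j.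
have := dirdM (delta_mx j 0) oO (seta 1%N) (sxi 1%N) Ox.
rewrite (dird_ext _ oO Ox eta_xi) dird_cst dird_delta dird_dv => /matrixP/(_ 0 0).
rewrite 2!mxE => E.
rewrite mxE [RHS]mxE [RHS]E; congr (_ + _).
  rewrite dirdE mxE; apply: eq_bigr => i _; rewrite !mxE mulrC.
  by rewrite (deta_sym i j Ox).
by rewrite mulmxA -colE [RHS]mxE.
Qed.

Lemma lie_xieta x : O x -> lie_deriv11 xi (fun y => xi y *m eta y) x = 0.
Proof.
move=> Ox; rewrite lie_deriv11E (dirdM _ oO (sxi 1%N) (seta 1%N) Ox) dird_dv.
rewrite -[xi x *m eta x *m _]mulmxA mulmxA addrAC addrC !addrA addNr add0r.
by rewrite -mulmxDr lie_eta // mulmx0.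
Qed.

Lemma lie_phi2 x : O x -> lie_deriv11 xi (fun y => phi y *m phi y) x = 0.
Proof.
move=> Ox; rewrite (lie_ext _ oO Ox phi2).
have sN : smoothm O (fun _ : 'rV[R]_n => - 1%:M : 'M[R]_n) by apply: smoothm_cst.
rewrite (lieD _ oO sN (smoothmM oO sxi seta) Ox) lie_xieta // addr0.
by rewrite lie_deriv11E dird_cst add0r mulmxN mulNmx mulmx1 mul1mx opprK subrr.
Qed.

(** Half of the Lie derivative of [phi^2 = - 1 + xi eta], of which both terms
    are invariant under [xi]. *)
Lemma hphi x : O x -> hten x *m phi x = - (phi x *m hten x).
Proof.
move=> Ox; have := lie_phi2 Ox; rewrite (lieM _ oO sphi sphi Ox) !lie_phi.
rewrite -scalemxAl -scalemxAr -scalerDr => /eqP.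
by rewrite scaler_eq0 pnatr_eq0 /= addr_eq0 => /eqP.
Qed.

Lemma etah x : O x -> eta x *m hten x = 0.
Proof.
move=> Ox; rewrite htenE -scalemxAr lie_deriv11E mulmxDr mulmxBr.
rewrite [eta x *m (phi x *m _)]mulmxA (eta_phi' Ox) mul0mx addr0.
have := dirdM (xi x) oO (seta 1%N) (sphi 1%N) Ox.
rewrite (dird_ext _ oO Ox eta_phi') dird_cst => /esym/eqP.
rewrite addrC addr_eq0 => /eqP ->.
by rewrite mulmxA -opprD -mulmxDl lie_eta // mul0mx oppr0 scaler0.
Qed.

Let h_xi' x (Ox : O x) :=
  h_xi (phi2 Ox) (eta_xi Ox) (hphi Ox) (etah Ox).
Let phi2_h' x (Ox : O x) := phi2_h (phi2 Ox) (etah Ox).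
Let h_phi2' x (Ox : O x) :=
  h_phi2 (phi2 Ox) (eta_xi Ox) (hphi Ox) (etah Ox).
Let B_phi' x (Ox : O x) : Bten x *m phi x = hten x :=
  B_phi (phi2 Ox) (hphi Ox) (etah Ox).
Let phi_B' x (Ox : O x) : phi x *m Bten x = - hten x := phi_B (phi2 Ox) (etah Ox).
Let B2' x (Ox : O x) : Bten x *m Bten x = hten x *m hten x :=
  B2 (phi2 Ox) (hphi Ox) (etah Ox).

Lemma Bten_sq x : O x -> Bten x *m Bten x = hten x *m hten x.
Proof. exact: B2'. Qed.

Lemma hten_xi x : O x -> hten x *m xi x = 0.
Proof. exact: h_xi'. Qed.

Lemma A_xi x : O x -> Aten x *m xi x = 0.
Proof.
move=> Ox; rewrite /Aten /Bten mulmxBl mulNmx -!mulmxA (phi_xi' Ox) (h_xi' Ox).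
by rewrite !mulmx0 oppr0 addr0.
Qed.

Lemma eta_B x : O x -> eta x *m Bten x = 0.
Proof. by move=> Ox; rewrite /Bten mulmxA (eta_phi' Ox) mul0mx. Qed.

Lemma eta_A x : O x -> eta x *m Aten x = 0.
Proof.
move=> Ox; rewrite /Aten mulmxBr eta_B // mulmxN mulmxA (eta_phi' Ox).
by rewrite mul0mx oppr0 addr0.
Qed.

Lemma AtenE x : O x -> Aten x = 1%:M - xi x *m eta x - Bten x.
Proof. by move=> Ox; rewrite /Aten phi2 // opprD opprK. Qed.

Hypothesis dPhi : forall x, O x -> forall i j k,
  d2 (fun y => g y *m phi y) x i j k =
  2 * wedge12 (eta x) (g x *m phi x) i j k.

Let Phi y := g y *m phi y.
Let sPhi : smoothm O Phi := smoothmM oO sg sphi.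

(** Cartan's formula for [L_xi Phi]: [i_xi Phi] vanishes and [i_xi (d Phi) = 2
    i_xi (eta /\ Phi) = 2 Phi]. *)
Lemma lie_Phi x : O x ->
  dird (xi x) Phi x + (dv xi x)^T *m Phi x + Phi x *m dv xi x = 2 *: Phi x.
Proof.
move=> Ox.
have PhiT y : O y -> (Phi y)^T = - Phi y by move=> Oy; rewrite /Phi g_phi_skew'.
have Phixi y : O y -> Phi y *m xi y = 0.
  by move=> Oy; rewrite /Phi -mulmxA (phi_xi' Oy) mulmx0.
(* differentiate Phi xi = 0 *)
have E1 j k : \sum_i xi x i 0 * partial j (fun y => Phi y k i) x =
    - (Phi x *m dv xi x) k j.
  have := dirdM (delta_mx j 0) oO (sPhi 1%N) (sxi 1%N) Ox.
  rewrite (dird_ext _ oO Ox Phixi) dird_cst dird_delta dird_dv.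
  move=> /matrixP/(_ k 0); rewrite mxE [RHS]mxE => /esym/eqP.
  rewrite mulmxA -colE [in X in _ + X]mxE addr_eq0 => /eqP <-.
  by rewrite mxE; apply: eq_bigr => i _; rewrite mxE mulrC.
have Phi_skew i j k : partial k (fun y => Phi y i j) x =
    - partial k (fun y => Phi y j i) x.
  have /matrixP/(_ i j) := dird_tr (delta_mx k 0) Phi x.
  rewrite (dird_ext _ oO Ox PhiT) (dirdN _ oO (sPhi 1%N) Ox) dird_delta.
  by rewrite !mxE => <-; rewrite opprK.
apply/matrixP => j k; rewrite [RHS]mxE.
have Phijk a b : Phi x b a = - Phi x a b.
  by have /matrixP/(_ a b) := PhiT x Ox; rewrite !mxE.
have : \sum_i xi x i 0 * d2 Phi x i j k =
       \sum_i xi x i 0 * (2 * wedge12 (eta x) (Phi x) i j k).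
  by apply: eq_bigr => i _; rewrite dPhi.
have -> : \sum_i xi x i 0 * (2 * wedge12 (eta x) (Phi x) i j k) = 2 * Phi x j k.
  have S1 : \sum_i xi x i 0 * eta x 0 i = 1.
    have /matrixP/(_ 0 0) := eta_xi Ox; rewrite !mxE eqxx mulr1n => <-.
    by apply: eq_bigr => i _; rewrite mulrC.
  have S2 a : \sum_i Phi x a i * xi x i 0 = 0.
    by have /matrixP/(_ a 0) := Phixi x Ox; rewrite !mxE.
  transitivity (2 * ((\sum_i xi x i 0 * eta x 0 i) * Phi x j k +
    eta x 0 j * (\sum_i Phi x k i * xi x i 0) -
    eta x 0 k * (\sum_i Phi x j i * xi x i 0))).
    rewrite mulr_suml !mulr_sumr -sumrN -!big_split mulr_sumr.
    apply: eq_bigr => i _; rewrite /wedge12 (Phijk j i) /=; ring.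
  by rewrite S1 !S2 mul1r !mulr0 subr0 addr0.
move <-; rewrite [LHS]mxE [X in X + _]mxE dirdE.
have -> : ((dv xi x)^T *m Phi x) j k = - (Phi x *m dv xi x) k j.
  by rewrite -[Phi x in LHS]trmxK -trmx_mul PhiT // mulNmx !mxE.
rewrite -E1 -[(Phi x *m dv xi x) j k]opprK -E1 -sumrN -!big_split.
apply: eq_bigr => i _; rewrite /d2 /= (Phi_skew i j k).
ring.
Qed.

Let lieg x := dird (xi x) g x + (dv xi x)^T *m g x + g x *m dv xi x.

Lemma lieg_phi x : O x -> lieg x *m phi x = 2 *: (g x *m phi x - g x *m hten x).
Proof.
move=> Ox; have := lie_Phi Ox.
rewrite /Phi (dirdM _ oO (sg 1%N) (sphi 1%N) Ox) /lieg htenE lie_deriv11E.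
rewrite -scalemxAr scalerBr scalerA divff ?pnatr_eq0 // scale1r.
move=> <-; rewrite !(mulmxDl, mulmxDr, mulmxN) !mulmxA.
move: (g x *m dird (xi x) phi x) (dird (xi x) g x *m phi x)
  ((dv xi x)^T *m g x *m phi x) (g x *m phi x *m dv xi x)
  (g x *m dv xi x *m phi x) => a b c d e.
by apply/matrixP => i j; rewrite !mxE; ring.
Qed.

Lemma lieg_xi x : O x -> lieg x *m xi x = 0.
Proof.
move=> Ox; rewrite /lieg !mulmxDl -!mulmxA (g_xi' Ox).
have := dirdM (xi x) oO (sg 1%N) (sxi 1%N) Ox.
rewrite (dird_ext _ oO Ox (B := fun y => (eta y)^T)); last exact: g_xi'.
rewrite dird_tr dird_dv addrAC => <-.
by rewrite -trmx_mul -linearD /= lie_eta // trmx0.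
Qed.

(** [L_xi g] is determined by [L_xi g xi = 0] and by [L_xi Phi = 2 Phi] with
    [Phi = g phi] and [L_xi phi = 2 h]. *)
Lemma liegE x : O x ->
  lieg x = - (2 *: (g x *m (phi x *m phi x) + g x *m (phi x *m hten x))).
Proof.
move=> Ox.
have : lieg x *m (phi x *m phi x) = - lieg x.
  by rewrite phi2 // mulmxDr mulmxN mulmx1 mulmxA lieg_xi // mul0mx addr0.
rewrite mulmxA lieg_phi // => /eqP; rewrite eq_sym eqr_oppLR => /eqP ->.
rewrite -scalemxAl mulmxBl -!mulmxA hphi // !mulmxA mulmxN opprK.
by rewrite !mulmxA.
Qed.

(** [d eta] is the skew part of [nabla eta]. *)
Lemma gnab_sym x : O x -> (g x *m nab g xi x)^T = g x *m nab g xi x.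
Proof.
move=> Ox; apply/matrixP => i j; rewrite [LHS]mxE.
(* j-th column of the derivative of eta^T = g xi *)
have E a b : partial b (fun y => eta y 0 a) x = \sum_k christoffel g k b a x * eta x 0 k +
    (g x *m nab g xi x) a b.
  have := dirdM (delta_mx b 0) oO (sg 1%N) (sxi 1%N) Ox.
  rewrite (dird_ext _ oO Ox (B := fun y => (eta y)^T)); last exact: g_xi'.
  rewrite dird_tr dird_delta (dird_metric oO gsym g_unit) // dird_dv.
  rewrite mulmxDl -[(gam _ _ _)^T *m _ *m _]mulmxA (g_xi' Ox).
  rewrite -[g x *m gam _ _ _ *m _]mulmxA (gamC oO gsym _ _ Ox) -addrA -mulmxDr.
  rewrite -mulmxDl [gam _ _ _ + _]addrC -nabE mulmxA -colE => /colP/(_ a).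
  rewrite !mxE => ->; congr (_ + _); apply: eq_bigr => k _; rewrite !mxE gamE.
  rewrite (bigD1 b) //= mxE !eqxx mulr1 big1 ?addr0 // => l /negPf lb.
  by rewrite mxE lb mulr0.
have := deta_sym i j Ox; rewrite !E.
rewrite (eq_bigr (fun k => christoffel g k j i x * eta x 0 k)).
  by move=> /addrI.
by move=> k _; rewrite (christoffelC oO gsym).
Qed.

(** On an almost Kenmotsu manifold [nabla xi = - phi^2 - phi h]: [nabla xi] is
    self-adjoint because [eta] is closed, so it is half of [L_xi g], which is
    read off from [L_xi Phi = 2 Phi]. *)
Lemma nabla_xi x : O x -> nab g xi x = Aten x.
Proof.
move=> Ox.
have E : lieg x = 2 *: (g x *m nab g xi x).
  rewrite /lieg (dird_metric oO gsym g_unit) //.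
  rewrite scaler_nat mulr2n -{1}gnab_sym // nabE trmx_mul (gsym Ox) linearD /=.
  rewrite mulmxDl mulmxDr.
  move: ((gam g x (xi x))^T *m g x) (g x *m gam g x (xi x)) ((dv xi x)^T *m g x)
    (g x *m dv xi x) => a b c d.
  by apply/matrixP => i j; rewrite !mxE; ring.
have : g x *m nab g xi x = g x *m Aten x.
  move: E; rewrite liegE // -scalerN => /(scalerI _) => <-; last first.
    by rewrite pnatr_eq0.
  by rewrite /Aten /Bten mulmxBr mulmxN opprD.
by move/(congr1 (mulmx (invmx (g x)))); rewrite !mulKmx // g_unit.
Qed.

Lemma gB_sym x : O x -> (g x *m Bten x)^T = g x *m Bten x.
Proof.
move=> Ox; have := gnab_sym Ox; rewrite nabla_xi // /Aten mulmxBr mulmxN.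
by rewrite linearB linearN /= g_phi2_sym' // => /addrI /oppr_inj.
Qed.

Lemma gh_sym x : O x -> (g x *m hten x)^T = g x *m hten x.
Proof.
move=> Ox.
have H1 : (hten x)^T *m (g x *m phi x) = - (g x *m phi x *m hten x).
  have := gB_sym Ox; rewrite /Bten mulmxA trmx_mul g_phi_skew' // mulmxN => /eqP.
  by rewrite eqr_oppLR => /eqP.
have : (hten x)^T *m (g x *m phi x) *m phi x = - (hten x)^T *m g x.
  rewrite -!mulmxA phi2 // !mulmxDr mulmxN mulmx1 mulmxN mulNmx.
  rewrite (mulmxA (g x)) (g_xi' Ox) (mulmxA (hten x)^T) -trmx_mul etah //.
  by rewrite trmx0 mul0mx addr0.
rewrite H1 mulNmx -!mulmxA hphi // !mulmxN opprK mulmxA -mulmxA.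
rewrite [phi x *m (phi x *m _)]mulmxA phi2_h' // mulmxN => /eqP.
by rewrite mulNmx eqr_opp trmx_mul (gsym Ox) => /eqP ->.
Qed.

(** Differentiating [A xi = 0] replaces [dird v A xi] by [- A (dv xi v)]; with
    [A = nabla xi] what remains of the curvature is [L_xi A + A^2]. *)
Lemma curv_xi_lie v x : O x -> curv g Aten x v (xi x) =
    - ((lie_deriv11 xi Aten x + Aten x *m Aten x) *m v).
Proof.
move=> Ox; have E : nab g xi x *m Aten x *m v = Aten x *m Aten x *m v.
  by rewrite nabla_xi.
move: E; rewrite /curv nabE lie_deriv11E.
have := dirdM v oO (smooth_Aten 1%N) (sxi 1%N) Ox.
rewrite (dird_ext v oO Ox A_xi) dird_cst dird_dv => /esym/eqP.
rewrite addr_eq0 => /eqP ->.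
rewrite -[gam g x v *m _ *m _]mulmxA A_xi // mulmx0 sub0r.
rewrite !(mulmxDl, mulNmx) !mulmxA.
move: (Aten x *m dv xi x *m v) (dird (xi x) Aten x *m v)
 (gam g x (xi x) *m Aten x *m v) (dv xi x *m Aten x *m v)
 (Aten x *m Aten x *m v) => a b c d e <-.
by apply/colP => i; rewrite !mxE; ring.
Qed.

Lemma A2 x : O x -> Aten x *m Aten x =
  - (phi x *m phi x) - 2 *: Bten x + hten x *m hten x.
Proof.
move=> Ox; rewrite /Aten !(mulmxDl, mulmxDr, mulmxN, mulNmx) B2' //.
have -> : phi x *m phi x *m (phi x *m phi x) = - (phi x *m phi x).
  by rewrite mulmxA phi3' // mulNmx.
have -> : phi x *m phi x *m Bten x = - Bten x.
  by rewrite /Bten mulmxA phi3' // mulNmx.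
have -> : Bten x *m (phi x *m phi x) = - Bten x.
  by rewrite /Bten -mulmxA h_phi2' // mulmxN.
move: (phi x *m phi x) (Bten x) (hten x *m hten x) => a b c.
by apply/matrixP => i j; rewrite !mxE; ring.
Qed.

Lemma lie_A x : O x -> lie_deriv11 xi Aten x = - lie_deriv11 xi Bten x.
Proof.
move=> Ox; have sp2 := smoothmM oO sphi sphi.
rewrite /Aten (lieD _ oO (smoothmN oO sp2) (smoothmN oO smooth_Bten) Ox).
by rewrite (lieN _ oO sp2 Ox) lie_phi2 // oppr0 add0r (lieN _ oO smooth_Bten Ox).
Qed.

Lemma curv_xi_lieB v x : O x -> curv g Aten x v (xi x) =
    (lie_deriv11 xi Bten x + phi x *m phi x + 2 *: Bten x - hten x *m hten x) *m v.
Proof.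
move=> Ox; rewrite curv_xi_lie // lie_A // A2 // -mulNmx; congr (_ *m _).
move: (lie_deriv11 xi Bten x) (phi x *m phi x) (hten x *m hten x) (Bten x)
  => a b c d.
by apply/matrixP => i j; rewrite !mxE; ring.
Qed.

Lemma project_D x v : O x -> v - (eta x *m v) 0 0 *: xi x = - (phi x *m phi x) *m v.
Proof.
move=> Ox; rewrite phi2 // opprD opprK mulmxBl mul1mx -mulmxA.
by rewrite [eta x *m v]mx11_scalar mul_mx_scalar mxE eqxx mulr1n.
Qed.

(** The curvature equation in the direction of [xi] is the equation [L_xi B =
    mu h - 2 B] together with the algebraic one for [h^2]. *)
Lemma curv_xi_of_lieB (ka m : R) x : O x ->
  lie_deriv11 xi Bten x = m *: hten x - 2 *: Bten x ->
  hten x *m hten x = (ka + 1) *: (phi x *m phi x) ->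
  forall v, curv g Aten x v (xi x) =
    ka *: (v - (eta x *m v) 0 0 *: xi x) + m *: (hten x *m v).
Proof.
move=> Ox LB H2 v; rewrite curv_xi_lieB // LB H2 project_D //.
rewrite [ka *: (_ *m v)]scalemxAl [m *: (_ *m v)]scalemxAl -mulmxDl.
congr (_ *m _).
move: (phi x *m phi x) (hten x) (Bten x) => a b c.
by apply/matrixP => i j; rewrite !mxE; ring.
Qed.

Variables (ka mu : 'rV[R]_n -> R).
Hypothesis Rxi : forall x, O x -> forall v, curv g Aten x v (xi x) =
    ka x *: (v - (eta x *m v) 0 0 *: xi x) + mu x *: (hten x *m v).

Lemma mulmx_eq p (P Q : 'M[R]_(p, n)) : (forall v : 'cV[R]_n, P *m v = Q *m v) -> P = Q.
Proof.
move=> PQ; apply/matrixP => i j.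
by have /colP/(_ i) := PQ (delta_mx j 0); rewrite -!colE !mxE.
Qed.

Lemma lie_B0 x : O x -> lie_deriv11 xi Bten x =
  - (ka x + 1) *: (phi x *m phi x) - 2 *: Bten x + hten x *m hten x
  + mu x *: hten x.
Proof.
move=> Ox.
have : lie_deriv11 xi Bten x + phi x *m phi x + 2 *: Bten x - hten x *m hten x
    = ka x *: - (phi x *m phi x) + mu x *: hten x.
  apply: mulmx_eq => v; rewrite -curv_xi_lieB // Rxi // project_D //.
  by rewrite mulmxDl -!scalemxAl.
move: (lie_deriv11 xi Bten x) (phi x *m phi x) (hten x *m hten x) (hten x) (Bten x)
  => a b c d e /matrixP E.
by apply/matrixP => i j; have := E i j; rewrite !mxE => Eij; lra.
Qed.

Lemma phi_lie_h x : O x -> phi x *m lie_deriv11 xi hten x =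
  - (ka x + 1) *: (phi x *m phi x) - 2 *: Bten x - hten x *m hten x
  + mu x *: hten x.
Proof.
move=> Ox; have := lieM xi oO sphi smooth_hten Ox; rewrite lie_phi -scalemxAl.
rewrite -/Bten lie_B0 //.
move: (phi x *m lie_deriv11 xi hten x) (phi x *m phi x) (hten x *m hten x) (hten x)
  (Bten x) => a b c d e /matrixP E.
by apply/matrixP => i j; have := E i j; rewrite !mxE => Eij; lra.
Qed.

Lemma eta_lie_h x : O x -> eta x *m lie_deriv11 xi hten x = 0.
Proof.
move=> Ox; rewrite lie_deriv11E mulmxDr mulmxBr.
rewrite [eta x *m (hten x *m _)]mulmxA (etah Ox) mul0mx addr0.
have := dirdM (xi x) oO (seta 1%N) (smooth_hten 1%N) Ox.
rewrite (dird_ext _ oO Ox etah) dird_cst => /esym/eqP.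
rewrite addrC addr_eq0 => /eqP ->.
by rewrite mulmxA -opprD -mulmxDl lie_eta // mul0mx oppr0.
Qed.

Lemma lie_h0 x : O x -> lie_deriv11 xi hten x =
  - (ka x + 1) *: phi x - 2 *: hten x + phi x *m (hten x *m hten x)
  - mu x *: Bten x.
Proof.
move=> Ox.
have : phi x *m (phi x *m lie_deriv11 xi hten x) = - lie_deriv11 xi hten x.
  by rewrite mulmxA phi2 // mulmxDl mulNmx mul1mx -mulmxA eta_lie_h // mulmx0 addr0.
rewrite phi_lie_h // !(mulmxDr, mulmxN) -!scalemxAr phi_B' // -/(Bten x).
rewrite (mulmxA (phi x) (phi x)) phi3' //.
move: (lie_deriv11 xi hten x) (phi x *m (hten x *m hten x)) (hten x) (Bten x) (phi x)
  => a b c d e /matrixP E.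
by apply/matrixP => i j; have := E i j; rewrite !mxE => Eij; lra.
Qed.

(** Applying [L_xi] to [h phi + phi h = 0] gives one more relation between
    [h^2] and [L_xi h]; comparison with the formula for [phi (L_xi h)], which
    comes from the curvature, determines [h^2]. *)
Lemma h2 x : O x -> hten x *m hten x = (ka x + 1) *: (phi x *m phi x).
Proof.
move=> Ox.
have L : lie_deriv11 xi hten x *m phi x + phi x *m lie_deriv11 xi hten x =
    - (4 *: (hten x *m hten x)).
  have hs := smooth_hten.
  have : lie_deriv11 xi (fun y => hten y *m phi y + phi y *m hten y) x = 0.
    rewrite (lie_ext xi (T := fun=> 0) oO Ox); last first.
      by move=> y Oy; rewrite hphi // addNr.
    by rewrite lie_deriv11E dird_cst mulmx0 mul0mx subr0 addr0.
  rewrite (lieD xi oO (smoothmM oO hs sphi) (smoothmM oO sphi hs) Ox).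
  rewrite (lieM xi oO hs sphi Ox) (lieM xi oO sphi hs Ox) lie_phi.
  rewrite -scalemxAl -scalemxAr.
  move: (hten x *m hten x) (lie_deriv11 xi hten x *m phi x)
    (phi x *m lie_deriv11 xi hten x) => a b c /matrixP E.
  by apply/matrixP => i j; have := E i j; rewrite !mxE => Eij; lra.
move: L; rewrite phi_lie_h // lie_h0 //.
rewrite !(mulmxDl, mulNmx) -!scalemxAl B_phi' // hphi // -/(Bten x).
have -> : phi x *m (hten x *m hten x) *m phi x = - (hten x *m hten x).
  rewrite -!mulmxA hphi // !mulmxN (mulmxA (hten x) (phi x)) hphi // mulNmx.
  by rewrite mulmxN opprK mulmxA (mulmxA (phi x)) phi2_h' // mulNmx.
move: (phi x *m phi x) (hten x *m hten x) (hten x) (Bten x) => a b c d /matrixP E.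
by apply/matrixP => i j; have := E i j; rewrite !mxE => Eij; lra.
Qed.

Lemma lie_h x : O x -> lie_deriv11 xi hten x =
  - (2 * (ka x + 1)) *: phi x - 2 *: hten x - mu x *: Bten x.
Proof.
move=> Ox; rewrite lie_h0 // h2 // -scalemxAr mulmxA phi3' //.
by apply/matrixP => i j; rewrite !mxE; ring.
Qed.

Lemma lie_B x : O x -> lie_deriv11 xi Bten x = mu x *: hten x - 2 *: Bten x.
Proof.
move=> Ox; rewrite lie_B0 // h2 //.
by apply/matrixP => i j; rewrite !mxE; ring.
Qed.

Lemma Bten2 x : O x -> Bten x *m Bten x = (ka x + 1) *: (phi x *m phi x).
Proof. by move=> Ox; rewrite B2' // h2. Qed.

(** [h] is self-adjoint, so [g(h v, h v) = - (kappa + 1) g(phi v, phi v)]. *)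
Lemma kappa_lt x : O x -> hten x <> 0 -> ka x < - 1.
Proof.
move=> Ox /eqP h0.
have [v hv] : exists v, hten x *m v != 0.
  apply: contrapT => nv; case/eqP: h0; apply: mulmx_eq => v; rewrite mul0mx.
  by apply/eqP/negPn/negP => hv; apply: nv; exists v.
have := gpos Ox hv; rewrite trmx_mul -[_ *m g x]mulmxA.
have -> : (hten x)^T *m g x = g x *m hten x.
  by rewrite -[in RHS]gh_sym // trmx_mul (gsym Ox).
rewrite -!mulmxA (mulmxA (hten x)) h2 // -scalemxAl -!scalemxAr.
have -> : v^T *m (g x *m (phi x *m phi x *m v)) =
    - ((phi x *m v)^T *m g x *m (phi x *m v)).
  rewrite -[phi x *m phi x *m v]mulmxA (mulmxA (g x)) -[g x *m phi x]opprK.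
  rewrite -g_phi_skew' // mulNmx mulmxN; congr (- _).
  by rewrite !trmx_mul (gsym Ox) !mulmxA.
rewrite mxE [X in _ * X]mxE mulrN.
have [->|pv] := eqVneq (phi x *m v) 0; first by rewrite mulmx0 mxE mulr0 oppr0 ltxx.
have := gpos Ox pv; set q := (_ *m _) 0 0; move: q => q q0.
rewrite oppr_gt0 pmulr_llt0 // => ?; lra.
Qed.

(** The Lie derivative of [h^2 = (kappa + 1) phi^2]. *)
Lemma dkappa_xi x : smooth_on O ka -> O x -> hten x <> 0 ->
  (d0 ka x *m xi x) 0 0 = - 4 * (ka x + 1).
Proof.
move=> ska Ox hn0.
have hs := smooth_hten.
have ska1 : smooth_on O (fun y => ka y + 1).
  by move=> k; apply: CkD => //; apply: Ck_cst.
have dka1 : d0 (fun y => ka y + 1) x = d0 ka x.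
  apply/rowP => i; rewrite !mxE (partialD i (ska 1%N) (Ck_cst 1 O 1) Ox).
  by rewrite [X in _ + X](derive_cst (1 : R) x _) addr0.
have := lieM xi oO hs hs Ox.
rewrite (lie_ext xi oO Ox h2) (lieZ xi oO ska1 (smoothmM oO sphi sphi) Ox).
rewrite lie_phi2 // scaler0 addr0 dka1 lie_h //.
rewrite !(mulmxDl, mulmxDr, mulmxN, mulNmx) -!(scalemxAl, scalemxAr).
have -> : hten x *m Bten x = - (Bten x *m hten x).
  by rewrite /Bten mulmxA hphi // mulNmx.
rewrite hphi // h2 // -/(Bten x) => E.
have E1 : (d0 ka x *m xi x) 0 0 *: (phi x *m phi x) =
    (- 4 * (ka x + 1)) *: (phi x *m phi x).
  rewrite E; move: (phi x *m phi x) (Bten x *m hten x) (phi x *m hten x) => a b c.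
  by apply/matrixP => i j; rewrite !mxE; ring.
have : (d0 ka x *m xi x) 0 0 *: hten x = (- 4 * (ka x + 1)) *: hten x.
  have := congr1 (fun A => A *m hten x) E1; rewrite /= -!scalemxAl phi2_h' //.
  by rewrite !scalerN => /oppr_inj.
move/eqP; rewrite -subr_eq0 -scalerBl scaler_eq0 => /orP[|/eqP //].
by rewrite subr_eq0 => /eqP.
Qed.

End LocalStructure.

(** * Change of coordinates *)

Section Trilinear.
Context {R : realType} {n : nat}.

Lemma linear_zero (f : 'cV[R]_n -> R) :
  (forall a u v, f (a *: u + v) = a * f u + f v) ->
  (forall i, f (delta_mx i 0) = 0) -> forall u, f u = 0.
Proof.
move=> flin fe u.
have f0 : f 0 = 0.
  by have := flin 1 0 0; rewrite scaler0 addr0 mul1r; lra.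
have -> : u = \sum_i u i 0 *: delta_mx i 0.
  apply/colP => k; rewrite summxE (bigD1 k) //= !mxE !eqxx mulr1 big1 ?addr0 //.
  by move=> j /negPf jk; rewrite !mxE eq_sym jk mulr0.
elim: (index_enum _) => [|i s IH]; first by rewrite big_nil.
by rewrite big_cons flin fe IH mulr0 addr0.
Qed.

Lemma trilinear_zero (f : 'cV[R]_n -> 'cV[R]_n -> 'cV[R]_n -> R) :
  (forall a u u' v w, f (a *: u + u') v w = a * f u v w + f u' v w) ->
  (forall a u v v' w, f u (a *: v + v') w = a * f u v w + f u v' w) ->
  (forall a u v w w', f u v (a *: w + w') = a * f u v w + f u v w') ->
  (forall i j k, f (delta_mx i 0) (delta_mx j 0) (delta_mx k 0) = 0) ->
  forall u v w, f u v w = 0.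
Proof.
move=> l1 l2 l3 f0 u v w.
apply: (linear_zero (f := fun u => f u v w)) => [a x y|i]; first exact: l1.
apply: (linear_zero (f := fun v => f _ v w)) => [a x y|j]; first exact: l2.
by apply: (linear_zero (f := fun w => f _ _ w)) => [a x y|k]; [apply: l3|apply: f0].
Qed.

Definition bil (A : 'M[R]_n) (v w : 'cV[R]_n) : R := (v^T *m A *m w) 0 0.

Lemma bil_linl A a u u' w : bil A (a *: u + u') w = a * bil A u w + bil A u' w.
Proof. by rewrite /bil linearP /= !mulmxDl -!scalemxAl mxE [X in X + _]mxE. Qed.

Lemma bil_linr A a u w w' : bil A u (a *: w + w') = a * bil A u w + bil A u w'.
Proof. by rewrite /bil mulmxDr -!scalemxAr mxE [X in X + _]mxE. Qed.

Lemma bil_linm A B a u w : bil (a *: A + B) u w = a * bil A u w + bil B u w.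
Proof.
by rewrite /bil mulmxDr mulmxDl -scalemxAr -scalemxAl mxE [X in X + _]mxE.
Qed.

Lemma bilD A B u w : bil (A + B) u w = bil A u w + bil B u w.
Proof. by rewrite /bil mulmxDr mulmxDl mxE. Qed.

Lemma bil_delta A i j : bil A (delta_mx i 0) (delta_mx j 0) = A i j.
Proof. by rewrite /bil trmx_delta -rowE -colE !mxE. Qed.

Lemma bil_tr A u w : bil A^T u w = bil A w u.
Proof.
rewrite /bil; have -> : u^T *m A^T *m w = (w^T *m A *m u)^T.
  by rewrite !trmx_mul trmxK mulmxA.
by rewrite mxE.
Qed.

Lemma bilMr A B u w : bil (A *m B) u w = bil A u (B *m w).
Proof. by rewrite /bil !mulmxA. Qed.

Lemma bilMl A B u w : bil (A^T *m B) u w = bil B (A *m u) w.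
Proof. by rewrite /bil trmx_mul !mulmxA. Qed.

(** Exterior derivative of a 2-form, and its product with a 1-form, evaluated on
    three vectors. *)
Definition d2v (b : 'rV[R]_n -> 'M[R]_n) x (u v w : 'cV[R]_n) : R :=
  bil (dird u b x) v w + bil (dird v b x) w u + bil (dird w b x) u v.

Definition wedge12v (a : 'rV[R]_n) (b : 'M[R]_n) (u v w : 'cV[R]_n) : R :=
  (a *m u) 0 0 * bil b v w + (a *m v) 0 0 * bil b w u + (a *m w) 0 0 * bil b u v.

Lemma form_lin (a : 'rV[R]_n) s (u v : 'cV[R]_n) :
  (a *m (s *: u + v)) 0 0 = s * (a *m u) 0 0 + (a *m v) 0 0.
Proof. by rewrite mulmxDr -scalemxAr mxE [X in X + _]mxE. Qed.

Lemma d2vE b x i j k :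
  d2v b x (delta_mx i 0) (delta_mx j 0) (delta_mx k 0) = d2 b x i j k.
Proof. by rewrite /d2v !dird_delta !bil_delta /pd mxE [X in _ + X + _]mxE [X in _ + X]mxE. Qed.

Lemma wedge12vE a b i j k :
  wedge12v a b (delta_mx i 0) (delta_mx j 0) (delta_mx k 0) = wedge12 a b i j k.
Proof. by rewrite /wedge12v !bil_delta -!colE !mxE. Qed.

Lemma d2_wedge_vec b x c a B :
  (forall i j k, d2 b x i j k = c * wedge12 a B i j k) <->
  (forall u v w, d2v b x u v w = c * wedge12v a B u v w).
Proof.
split=> H; last by move=> i j k; rewrite -d2vE H wedge12vE.
move=> u v w; apply/eqP; rewrite -subr_eq0; apply/eqP.
apply: (trilinear_zero (f := fun u v w => d2v b x u v w - c * wedge12v a B u v w)).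
- move=> s u1 u2 v1 w1; rewrite /d2v /wedge12v !dird_lin.
  by rewrite bil_linm !bil_linr !bil_linl form_lin; ring.
- move=> s u1 u2 v1 w1; rewrite /d2v /wedge12v !dird_lin.
  by rewrite bil_linm !bil_linr !bil_linl form_lin; ring.
- move=> s u1 u2 v1 w1; rewrite /d2v /wedge12v !dird_lin.
  by rewrite bil_linm !bil_linr !bil_linl form_lin; ring.
- by move=> i j k; rewrite d2vE wedge12vE H subrr.
Qed.

End Trilinear.

Lemma trmxD' (R : nmodType) p q (A B : 'M[R]_(p, q)) : (A + B)^T = A^T + B^T.
Proof. by apply/matrixP => i j; rewrite !mxE. Qed.

Lemma trmxB' (R : zmodType) p q (A B : 'M[R]_(p, q)) : (A - B)^T = A^T - B^T.
Proof. by apply/matrixP => i j; rewrite !mxE. Qed.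

Section Relatedness.
Context {R : realType} {n : nat}.
Variables (O Q : set 'rV[R]_n) (F : 'rV[R]_n -> 'rV[R]_n).
Hypothesis oO : open O.
Hypothesis oQ : open Q.
Hypothesis sF : smoothm O F.
Hypothesis OQ : forall x, O x -> Q (F x).
Hypothesis uJ : forall x, O x -> jac F x \in unitmx.
Implicit Types (x : 'rV[R]_n) (v w : 'cV[R]_n).

Local Notation J := (jac F).

Lemma smooth_jac : smoothm O J.
Proof. by move=> k; apply: Ckm_jac. Qed.

Lemma smoothm_compF p q (A : 'rV[R]_n -> 'M[R]_(p, q)) :
  smoothm Q A -> smoothm O (fun x => A (F x)).
Proof. by move=> sA k; apply: (Ckm_comp oO oQ (sA k) (sF k)). Qed.

Lemma dird_comp p q v (A : 'rV[R]_n -> 'M[R]_(p, q)) x : Ckm 1 Q A -> O x ->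
  dird v (fun y => A (F y)) x = dird (J x *m v) A (F x).
Proof.
move=> kA Ox; apply/matrixP => a b; rewrite !dirdE.
under eq_bigr => i _ do
  rewrite (partial_comp (f := fun y => A y a b) i oO oQ (kA a b)
    (fun j => sF 1%N 0 j) Ox (OQ Ox)) mulr_sumr.
rewrite exchange_big /=; apply: eq_bigr => j _; rewrite mxE mulr_suml.
by apply: eq_bigr => i _; rewrite mxE; ring.
Qed.

(** Second derivatives are symmetric. *)
Lemma dird_jacC v w x : O x -> dird v J x *m w = dird w J x *m v.
Proof.
move=> Ox; apply/colP => k; rewrite !mxE.
under eq_bigr do rewrite dirdE mulr_suml.
rewrite exchange_big /=; apply: eq_bigr => i _; rewrite dirdE mulr_suml.
apply: eq_bigr => j _.
have E a b : partial a (fun y => J y k b) x =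
    partial a (partial b (fun y => F y 0 k)) x.
  by congr (partial a _ x); apply/funext => y; rewrite mxE.
rewrite !E (partialC _ _ oO (sF 2%N 0 k) Ox); ring.
Qed.

Section VectorFields.
Variables (X Y X' Y' : 'rV[R]_n -> 'cV[R]_n).
Hypothesis sX : smoothm O X.
Hypothesis sY : smoothm O Y.
Hypothesis sX' : smoothm Q X'.
Hypothesis sY' : smoothm Q Y'.
Hypothesis XX' : forall x, O x -> X' (F x) = J x *m X x.
Hypothesis YY' : forall x, O x -> Y' (F x) = J x *m Y x.

Lemma related_dv v x : O x ->
  dv Y' (F x) *m (J x *m v) = dird v J x *m Y x + J x *m (dv Y x *m v).
Proof.
move=> Ox; rewrite -[LHS]dird_dv -(dird_comp v (sY' 1%N) Ox).
rewrite (dird_ext v oO Ox YY') (dirdM v oO (smooth_jac 1%N) (sY 1%N) Ox).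
by rewrite (dird_dv v Y).
Qed.

End VectorFields.

Lemma related_bracket X Y X' Y' x : smoothm O X -> smoothm O Y ->
  smoothm Q X' -> smoothm Q Y' ->
  (forall x, O x -> X' (F x) = J x *m X x) ->
  (forall x, O x -> Y' (F x) = J x *m Y x) -> O x ->
  lie_bracket X' Y' (F x) = J x *m lie_bracket X Y x.
Proof.
move=> sX sY sX' sY' XX YY Ox; rewrite !lie_bracketE (XX _ Ox) (YY _ Ox).
rewrite (related_dv sY sY' YY _ Ox) (related_dv sX sX' XX _ Ox) (dird_jacC _ _ Ox).
rewrite mulmxBr.
move: (dird _ J x *m _) (J x *m (dv Y x *m X x)) (J x *m (dv X x *m Y x)) => a b c.
by apply/colP => i; rewrite !mxE; ring.
Qed.

Lemma related_lie X X' T T' x : smoothm O X -> smoothm Q X' ->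
  smoothm O T -> smoothm Q T' ->
  (forall x, O x -> X' (F x) = J x *m X x) ->
  (forall x, O x -> T' (F x) *m J x = J x *m T x) -> O x ->
  lie_deriv11 X' T' (F x) *m J x = J x *m lie_deriv11 X T x.
Proof.
move=> sX sX' sT sT' XX TT Ox.
have sJ := smooth_jac.
have dvXJ : dv X' (F x) *m J x = dird (X x) J x + J x *m dv X x.
  apply: mulmx_eq => v; rewrite -mulmxA (related_dv sX sX' XX _ Ox).
  by rewrite mulmxDl (dird_jacC _ _ Ox) mulmxA.
have dTJ : dird (X' (F x)) T' (F x) *m J x + T' (F x) *m dird (X x) J x =
    dird (X x) J x *m T x + J x *m dird (X x) T x.
  rewrite (XX _ Ox) -(dird_comp _ (sT' 1%N) Ox).
  rewrite -(dirdM _ oO (smoothm_compF sT' 1%N) (sJ 1%N) Ox).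
  by rewrite (dird_ext _ oO Ox TT) (dirdM _ oO (sJ 1%N) (sT 1%N) Ox).
rewrite !lie_deriv11E !(mulmxDl, mulmxDr, mulmxN, mulNmx).
rewrite -(mulmxA (dv X' _)) (TT _ Ox) -(mulmxA (T' _)) dvXJ !(mulmxA, mulmxDr) dvXJ.
rewrite (TT _ Ox) mulmxDl.
have -> : dird (X' (F x)) T' (F x) *m J x = dird (X x) J x *m T x +
    J x *m dird (X x) T x - T' (F x) *m dird (X x) J x by rewrite -dTJ addrK.
move: (dird (X x) J x *m T x) (J x *m dird (X x) T x) (T' (F x) *m dird (X x) J x)
  (J x *m dv X x *m T x) (J x *m T x *m dv X x) => a b c d e.
by apply/matrixP => i j; rewrite !mxE; ring.
Qed.

Lemma related_form_closed (w w' : 'rV[R]_n -> 'rV[R]_n) x :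
  smoothm O w -> smoothm Q w' ->
  (forall x, O x -> w' (F x) *m J x = w x) -> O x ->
  d1 w x = 0 -> d1 w' (F x) = 0.
Proof.
move=> sw sw' ww Ox dw.
have E (u v : 'cV[R]_n) : (dird v w x *m u) 0 0 = (dird (J x *m v) w' (F x) *m (J x *m u)) 0 0 +
    (w' (F x) *m (dird v J x *m u)) 0 0.
  rewrite -(dird_ext _ oO Ox ww).
  rewrite (dirdM _ oO (smoothm_compF sw' 1%N) (smooth_jac 1%N) Ox).
  by rewrite (dird_comp _ (sw' 1%N) Ox) mulmxDl mxE !mulmxA.
have D (a : 'rV[R]_n -> 'rV[R]_n) y i j :
    (dird (delta_mx i 0) a y *m (delta_mx j 0 : 'cV[R]_n)) 0 0 = partial i (fun z => a z 0 j) y.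
  by rewrite dird_delta -colE !mxE.
have dw0 u v : (dird v w x *m u) 0 0 - (dird u w x *m v) 0 0 = 0.
  apply: (linear_zero (f := fun u => (dird v w x *m u) 0 0 - (dird u w x *m v) 0 0)).
    move=> a u1 u2; rewrite dird_lin !mulmxDr !mulmxDl -!scalemxAr -!scalemxAl.
    move: (dird v w x *m u1) (dird v w x *m u2) (dird u1 w x *m v)
      (dird u2 w x *m v) => p q r s; rewrite !mxE; ring.
  move=> j; apply: (linear_zero (f := fun v => (dird v w x *m delta_mx j 0) 0 0 -
     (dird (delta_mx j 0) w x *m v) 0 0)).
    move=> a u1 u2; rewrite dird_lin !mulmxDr !mulmxDl -!scalemxAr -!scalemxAl.
    move: (dird u1 w x *m delta_mx j 0) (dird u2 w x *m delta_mx j 0)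
      (dird (delta_mx j 0) w x *m u1) (dird (delta_mx j 0) w x *m u2) => p q r s.
    by rewrite !mxE; ring.
  by move=> i; rewrite !D; have /matrixP/(_ i j) := dw; rewrite !mxE.
apply/matrixP => i j; rewrite !mxE -!D.
pose dJ k : 'cV[R]_n := invmx (J x) *m delta_mx k 0.
have JdJ k : J x *m dJ k = delta_mx k 0 by rewrite /dJ mulKVmx // uJ.
have := dw0 (dJ j) (dJ i); move: (dJ j) (dJ i) (JdJ j) (JdJ i) => u v Ju Jv.
rewrite (E u v) (E v u) Ju Jv (dird_jacC v u Ox) => <-.
move: ((dird (delta_mx i 0) w' _ *m _) 0 0) ((dird (delta_mx j 0) w' _ *m _) 0 0)
  ((w' _ *m _) 0 0) => p q r.
by rewrite opprD addrACA subrr addr0.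
Qed.

Lemma related_d2v (b b' : 'rV[R]_n -> 'M[R]_n) x u v w :
  smoothm O b -> smoothm Q b' ->
  (forall x, O x -> (J x)^T *m b' (F x) *m J x = b x) ->
  (forall y, Q y -> (b' y)^T = - b' y) -> O x ->
  d2v b x u v w = d2v b' (F x) (J x *m u) (J x *m v) (J x *m w).
Proof.
move=> sb sb' bb skew Ox.
have E a : dird a b x = (dird a J x)^T *m (b' (F x) *m J x) +
    ((J x)^T *m (dird (J x *m a) b' (F x) *m J x) +
    (J x)^T *m (b' (F x) *m dird a J x)).
  rewrite -(dird_ext _ oO Ox bb).
  have sbF := smoothm_compF sb'; have sJ := smooth_jac.
  rewrite (dirdM _ oO ((smoothmM oO (smoothm_tr oO sJ) sbF) 1%N) (sJ 1%N) Ox).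
  rewrite (dirdM _ oO ((smoothm_tr oO sJ) 1%N) (sbF 1%N) Ox).
  by rewrite (dird_comp _ (sb' 1%N) Ox) dird_tr mulmxDl !mulmxA -addrA.
have sk p q : bil (b' (F x)) p q = - bil (b' (F x)) q p.
  rewrite -bil_tr skew; last exact: OQ.
  by rewrite /bil mulmxN mulNmx mxE.
rewrite /d2v !E !bilD !bilMl !bilMr.
rewrite (dird_jacC v u Ox) (dird_jacC w u Ox) (dird_jacC w v Ox).
rewrite (sk (J x *m w) (dird u J x *m v)) (sk (J x *m v) (dird u J x *m w)).
rewrite (sk (J x *m u) (dird v J x *m w)); ring.
Qed.

Lemma related_wedge12v (a a' : 'rV[R]_n) (B B' : 'M[R]_n) x u v w :
  a' *m J x = a -> (J x)^T *m B' *m J x = B ->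
  wedge12v a B u v w = wedge12v a' B' (J x *m u) (J x *m v) (J x *m w).
Proof. by move=> <- <-; rewrite /wedge12v -!mulmxA !bilMl !bilMr. Qed.

(** The difference [K] between the connection of [g] and the one transported
    from [g'] by [F] is symmetric because both have no torsion, and skew
    because both preserve the metric; so it vanishes. *)
Lemma related_levi_civita (g g' : 'rV[R]_n -> 'M[R]_n) X Y X' Y' x :
  smoothm O g -> smoothm Q g' ->
  (forall x, O x -> (g x)^T = g x) -> (forall y, Q y -> (g' y)^T = g' y) ->
  (forall x, O x -> g x \in unitmx) -> (forall y, Q y -> g' y \in unitmx) ->
  (forall x, O x -> (J x)^T *m g' (F x) *m J x = g x) ->
  smoothm O Y -> smoothm Q Y' ->
  X' (F x) = J x *m X x ->
  (forall x, O x -> Y' (F x) = J x *m Y x) -> O x ->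
  levi_civita g' X' Y' (F x) = J x *m levi_civita g X Y x.
Proof.
move=> sg sg' gs gs' gu gu' gg sY sY' XX YY Ox.
have sJ := smooth_jac; have QF := OQ Ox.
pose K v := gam g' (F x) (J x *m v) *m J x + dird v J x - J x *m gam g x v.
have Ksym v w : K v *m w = K w *m v.
  rewrite /K !(mulmxDl, mulNmx) -!mulmxA (dird_jacC _ _ Ox).
  by rewrite (gamC oO gs v w Ox) (gamC oQ gs' (J x *m v) (J x *m w) QF).
have Kskew v : (K v)^T *m g' (F x) *m J x + (J x)^T *m g' (F x) *m K v = 0.
  have := dird_metric oO gs gu v Ox.
  rewrite -(dird_ext _ oO Ox gg).
  have sgF := smoothm_compF sg'.
  rewrite (dirdM _ oO ((smoothmM oO (smoothm_tr oO sJ) sgF) 1%N) (sJ 1%N) Ox).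
  rewrite (dirdM _ oO ((smoothm_tr oO sJ) 1%N) (sgF 1%N) Ox).
  rewrite (dird_comp _ (sg' 1%N) Ox) dird_tr (dird_metric oQ gs' gu' _ QF) -gg //.
  rewrite /K trmxB' trmxD' !trmx_mul.
  rewrite !(mulmxDl, mulmxDr, mulmxN, mulNmx) !mulmxA.
  move: ((dird v J x)^T *m g' (F x) *m J x)
    ((J x)^T *m (gam g' (F x) (J x *m v))^T *m g' (F x) *m J x)
    ((J x)^T *m g' (F x) *m gam g' (F x) (J x *m v) *m J x)
    ((J x)^T *m g' (F x) *m dird v J x)
    ((gam g x v)^T *m (J x)^T *m g' (F x) *m J x)
    ((J x)^T *m g' (F x) *m J x *m gam g x v) => a b c d e f /matrixP E.
  by apply/matrixP => i j; have := E i j; rewrite !mxE => Eij; lra.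
pose al v w u := bil (g' (F x)) (K v *m w) (J x *m u).
have al_sym v w u : al v w u = al w v u by rewrite /al Ksym.
have al_skew v w u : al v w u = - al v u w.
  have H : bil (g' (F x)) (K v *m w) (J x *m u) +
      bil (g' (F x)) (J x *m w) (K v *m u) = 0.
    have := congr1 (fun A => bil A w u) (Kskew v).
    rewrite bilD -mulmxA bilMl bilMr -mulmxA bilMl bilMr => ->.
    by rewrite /bil mulmx0 mul0mx mxE.
  rewrite /al -[in RHS]bil_tr (gs' _ QF).
  by apply/eqP; rewrite -addr_eq0; apply/eqP.
have al0 v w u : al v w u = 0.
  have : al v w u = - al v w u.
    rewrite {1}al_skew al_sym al_skew opprK al_sym al_skew; congr (- _).
    by rewrite al_sym.
  by move/eqP; rewrite -addr_eq0 -mulr2n mulrn_eq0 /= => /eqP.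
have K0 v w : K v *m w = 0.
  have H (u : 'cV[R]_n) : (K v *m w)^T *m g' (F x) *m J x *m u = 0.
    apply/matrixP => i j; rewrite !ord1 [RHS]mxE -(al0 v w u) /al /bil.
    by rewrite !mulmxA.
  have : (K v *m w)^T *m g' (F x) *m J x = 0.
    by apply: mulmx_eq => u; rewrite H mul0mx.
  move/(congr1 (mulmx^~ (invmx (J x)))); rewrite mulmxK ?uJ // mul0mx.
  move/(congr1 (mulmx^~ (invmx (g' (F x))))); rewrite mulmxK ?gu' // mul0mx.
  by move/(congr1 trmx); rewrite trmxK trmx0.
rewrite !levi_civitaE XX (related_dv sY sY' YY _ Ox) (YY _ Ox) mulmxDr.
have := K0 (X x) (Y x); rewrite /K !(mulmxDl, mulNmx) -!mulmxA.
move: (dird (X x) J x *m Y x) (J x *m (dv Y x *m X x))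
  (gam g' (F x) (J x *m X x) *m (J x *m Y x)) (J x *m (gam g x (X x) *m Y x))
  => a b c d /colP E.
by apply/colP => i; have := E i; rewrite !mxE => Ei; lra.
Qed.

End Relatedness.

(** * Charts of a manifold *)

Section JacobianRules.
Context {R : realType} {n : nat}.
Implicit Types (O Q : set 'rV[R]_n).

Lemma jac_ext O (F G : 'rV[R]_n -> 'rV[R]_n) x : open O -> O x ->
  (forall y, O y -> F y = G y) -> jac F x = jac G x.
Proof.
move=> oO Ox FG; apply/matrixP => i j; rewrite !mxE.
by apply: (partial_ext _ oO Ox) => y /FG ->.
Qed.

Lemma jac_comp O Q (F G : 'rV[R]_n -> 'rV[R]_n) x : open O -> open Q ->
  Ckm 1 O F -> Ckm 1 Q G -> O x -> Q (F x) ->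
  jac (fun y => G (F y)) x = jac G (F x) *m jac F x.
Proof.
move=> oO oQ kF kG Ox QF; apply/matrixP => i j; rewrite !mxE.
rewrite (partial_comp (f := fun y => G y 0 i) j oO oQ (kG 0 i) (fun l => kF 0 l) Ox QF).
by apply: eq_bigr => k _; rewrite !mxE.
Qed.

Lemma jac_id (x : 'rV[R]_n) : jac id x = 1%:M.
Proof. by apply/matrixP => i j; rewrite !mxE partial_coord. Qed.

Lemma Ck_local k O (f : 'rV[R]_n -> R) :
  (forall x, O x -> exists2 Q, open Q /\ Q x & Ck k Q f) -> Ck k O f.
Proof.
elim: k f => [|k IH] f loc.
  by split=> // x /loc[Q [_ Qx] kf]; apply: Ck_continuous kf Qx.
split=> [x /loc[Q [_ Qx] kf]|i]; first exact: Ck_continuous kf Qx.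
split=> [x /loc[Q [_ Qx] kf]|]; first exact: Ck_derivable kf Qx.
by apply: IH => x /loc[Q Qx kf]; exists Q => //; apply: Ck_partial.
Qed.

End JacobianRules.

Section Charts.
Context {R : realType} {n : nat} {M : topologicalType}.
Implicit Types (a b c : chart R n M) (p q : M).

Lemma img_open a : open (img a).
Proof. exact: coord_dom_open. Qed.

Lemma param_img a x : img a x -> dom a (param a x) /\ a (param a x) = x.
Proof. by move=> [p ap <-]; rewrite coordK. Qed.

Lemma coord_img a p : dom a p -> img a (a p).
Proof. by exists p. Qed.

Lemma coord_at a p : dom a p -> {for p, continuous a}.
Proof.
move=> ap; have := Defs.coord_continuous (c := a).
by rewrite continuous_open_subspace; [apply; rewrite inE|apply: dom_open].
Qed.

Lemma param_at a x : img a x -> {for x, continuous (param a)}.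
Proof.
move=> ax; have := param_continuous (c := a).
by rewrite continuous_open_subspace; [apply; rewrite inE|apply: img_open].
Qed.

Lemma coord_open_image a (U : set M) : open U -> open (a @` (dom a `&` U)).
Proof.
move=> oU; rewrite openE => x [p [ap Up] <-].
have nU : nbhs (param a (a p)) U by rewrite coordK //; apply: open_nbhs_nbhs.
have H : \forall y \near a p, U (param a y) := param_at (coord_img ap) nU.
have I : \forall y \near a p, img a y.
  by apply: open_nbhs_nbhs; split; [apply: img_open|apply: coord_img].
apply: filterS2 I H => y ay Uy.
by have [dy Ey] := param_img ay; exists (param a y).
Qed.

Lemma coord_open_preimage a (V : set 'rV[R]_n) : open V ->
  open (dom a `&` a @^-1` V).
Proof.
move=> oV; rewrite openE => p [ap Vp].
have nV : nbhs (a p) V by apply: open_nbhs_nbhs.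
have H : \forall q \near p, V (a q) := coord_at ap nV.
have I : \forall q \near p, dom a q.
  by apply: open_nbhs_nbhs; split => //; apply: dom_open.
by apply: filterS2 I H => q.
Qed.

Definition overlap a b : set 'rV[R]_n := a @` (dom a `&` dom b).

Definition change a b : 'rV[R]_n -> 'rV[R]_n := fun x => b (param a x).

Lemma overlap_open a b : open (overlap a b).
Proof. by apply: coord_open_image; apply: dom_open. Qed.

Lemma overlap_in a b p : dom a p -> dom b p -> overlap a b (a p).
Proof. by exists p. Qed.

Lemma change_coord a b p : dom a p -> change a b (a p) = b p.
Proof. by move=> ap; rewrite /change coordK. Qed.

Lemma change_overlap a b x : overlap a b x -> overlap b a (change a b x).
Proof. by move=> [p [ap bp] <-]; rewrite change_coord //; exists p. Qed.

Lemma changeK a b x : overlap a b x -> change b a (change a b x) = x.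
Proof. by move=> [p [ap bp] <-]; rewrite !change_coord. Qed.

Lemma overlap_img a b : overlap a b `<=` img a.
Proof. by move=> x [p [ap _] <-]; exists p. Qed.

Lemma transition_jacE a b : transition_jac a b = jac (change a b).
Proof. by []. Qed.

End Charts.

Section Atlas.
Context {R : realType} {n : nat}.
Variable M : manifold R n.
Implicit Types (a b c : chart R n M) (p q : M).

Lemma smooth_change a b : atlas M a -> atlas M b ->
  smoothm (overlap a b) (change a b).
Proof. by move=> Aa Ab k i j; rewrite ord1; apply: (atlas_compat Aa Ab). Qed.

Lemma jac_change_inv a b x : atlas M a -> atlas M b -> overlap a b x ->
  jac (change b a) (change a b x) *m jac (change a b) x = 1%:M.
Proof.
move=> Aa Ab ox; have ox' := change_overlap ox.
rewrite -(jac_comp (overlap_open (a:=a) (b:=b)) (overlap_open (a:=b) (b:=a))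
  (smooth_change Aa Ab 1%N) (smooth_change Ab Aa 1%N) ox ox').
rewrite -(jac_id x); apply: (jac_ext (overlap_open (a:=a) (b:=b)) ox) => y.
exact: changeK.
Qed.

Lemma jac_change_unit a b x : atlas M a -> atlas M b -> overlap a b x ->
  jac (change a b) x \in unitmx.
Proof. by move=> Aa Ab /(jac_change_inv Aa Ab)/mulmx1_unit[]. Qed.

Lemma jac_change_comp a b c p : atlas M a -> atlas M b -> atlas M c ->
  dom a p -> dom b p -> dom c p ->
  jac (change a c) (a p) = jac (change b c) (b p) *m jac (change a b) (a p).
Proof.
move=> Aa Ab Ac ap bp cp.
have oO := overlap_open (a:=a) (b:=b).
have oQ := overlap_open (a:=b) (b:=c).
have ob := overlap_in ap bp.
have oc : overlap b c (change a b (a p)).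
  by rewrite change_coord //; apply: overlap_in.
rewrite -[in RHS](change_coord b ap).
rewrite -(jac_comp oO oQ (smooth_change Aa Ab 1%N) (smooth_change Ab Ac 1%N) ob oc).
have oabc : open (a @` (dom a `&` (dom b `&` dom c))).
  by apply: coord_open_image; apply: openI; apply: dom_open.
apply: (jac_ext oabc); first by exists p.
by move=> y [q [aq [bq cq]] <-]; rewrite !change_coord.
Qed.

(** By the inverse function theorem [F] restricts to a chart, which belongs to the
    atlas because the latter is maximal. *)
Lemma new_chart a p O F : atlas M a -> dom a p -> open O -> O (a p) ->
  O `<=` img a -> smoothm O F -> jac F (a p) \in unitmx ->
  exists2 c, atlas M c & [/\ dom c p,
    forall q, dom c q -> [/\ dom a q, O (a q) & c q = F (a q)] &
    forall q, dom c q -> jac (change a c) (a q) = jac F (a q)].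
Proof.
move=> Aa ap oO Op Oimg sF uF.
have [U [G [r [[r0 oU Up UO] HU HG sG]]]] := inverse_function oO Op sF uF.
pose D := dom a `&` a @^-1` U.
have oD : open D by apply: coord_open_preimage.
pose cc q := F (a q).
pose cp y := param a (G y).
have imgE : cc @` D = box (F (a p)) r.
  apply/seteqP; split=> [_ [q [aq Uq] <-]|y yr]; first by case: (HU _ Uq).
  have [UG FG] := HG y yr.
  have [q aq qE] := Oimg _ (UO _ UG).
  by exists q; [split => //; rewrite /= qE|rewrite /cc qE].
have oI : open (cc @` D) by rewrite imgE; apply: box_open.
have cK q : D q -> cp (cc q) = q.
  by move=> [aq Uq]; rewrite /cp /cc; have [_ -> _] := HU _ Uq; rewrite coordK.
have contF y i : O y -> {for y, continuous (fun z => F z 0 i)}.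
  by move=> Oy; apply: Ck_continuous (sF 0 0 i) Oy.
have cont_vec (T : topologicalType) (f : T -> 'rV[R]_n) t :
    (forall i, {for t, continuous (fun z => f z 0 i)}) -> {for t, continuous f}.
  move=> H A /nbhs_box[s s0 sA].
  have : \forall z \near t, forall i, `|f z 0 i - f t 0 i| < s.
    apply: filter_forall => i.
    have Hi : f z 0 i @[z --> t] --> f t 0 i := H i.
    by move/cvgrPdist_lt : Hi => /(_ s s0); apply: filterS => z; rewrite distrC.
  by apply: filterS => z zs; apply: sA.
have ccC : {within D, continuous cc}.
  apply: continuous_in_subspaceT => q; rewrite inE => -[aq Uq].
  apply: (@continuous_comp _ _ _ a F); first exact: coord_at.
  by apply: cont_vec => i; apply: contF; apply: UO.
have cpC : {within cc @` D, continuous cp}.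
  apply: continuous_in_subspaceT => y; rewrite inE imgE => yr.
  apply: (@continuous_comp _ _ _ G (param a)).
    by apply: cont_vec => i; apply: Ck_continuous (sG 0 0 i) yr.
  by apply: param_at; apply/Oimg/UO; case: (HG y yr).
pose c := Chart oD oI cK ccC cpC.
have imgcE : img c = box (F (a p)) r by [].
have Dc q : dom c q -> [/\ dom a q, U (a q) & O (a q)].
  by move=> [aq Uq]; split => //; apply: UO.
have oB := @box_open R n (F (a p)) r.
exists c.
  apply: atlas_max => b Ab; split=> i k.
  - have ob := overlap_open (a:=b) (b:=c).
    have sub : overlap b c `<=` overlap b a.
      by move=> _ [q [bq cq] <-]; exists q => //; have [] := Dc _ cq.
    apply: (Ck_comp (Q := O) (f := fun y => F y 0 i) (F := change b a) ob oO).
    + by apply: sF.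
    + by move=> j; apply: Ck_sub sub _; apply: smooth_change.
    + by move=> _ [q [bq cq] <-]; rewrite change_coord //; have [] := Dc _ cq.
  - have oc := overlap_open (a:=c) (b:=b).
    have oab := overlap_open (a:=a) (b:=b).
    apply: (Ck_comp (Q := overlap a b) (f := fun y => change a b y 0 i)
      (F := G) oc oab).
    + by apply: smooth_change.
    + move=> j; apply: Ck_sub (sG k 0 j).
      by rewrite -imgcE; apply: overlap_img.
    + move=> _ [q [[aq Uq] bq] <-]; rewrite /= /cc.
      by have [_ -> _] := HU _ Uq; apply: overlap_in.
split => //.
- by move=> q cq; have [] := Dc _ cq.
- move=> q cq; have [aq Uq Oq] := Dc _ cq.
  apply: (jac_ext (overlap_open (a:=a) (b:=c))); first exact: overlap_in.
  by move=> _ [q' [aq' cq'] <-]; rewrite change_coord.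
Qed.

(** Multiply the constant field in a chart by a bump function; the support of
    the latter is compact, hence closed in the whole manifold, which is what makes
    the extension by zero smooth. *)
Lemma global_field a p (v : 'cV[R]_n) : atlas M a -> dom a p ->
  exists X : vector_field M, X a (a p) = v.
Proof.
move=> Aa ap.
have [r r0 rI] := open_box (img_open (a:=a)) (coord_img ap).
have r20 : 0 < r / 2 by rewrite divr_gt0.
have [rho [srho rhop rhos]] := bump_function (a p) r20.
pose K := param a @` [set x : 'rV[R]_n | forall i,
  `[(a p 0 i - r / 2), (a p 0 i + r / 2)]%classic (x ord0 i)].
have Kimg (x : 'rV[R]_n) : (forall i, `[(a p 0 i - r / 2), (a p 0 i + r / 2)]%classic
   (x ord0 i)) -> img a x.
  move=> H; apply: rI => i; have := H i; rewrite /= in_itv /= ltr_norml.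
  by move=> /andP[? ?]; apply/andP; split; lra.
have cK : closed K.
  apply: compact_closed; first exact: manifold_hausdorff.
  apply: continuous_compact.
    apply: continuous_in_subspaceT => x; rewrite inE => /Kimg; exact: param_at.
  apply: (@rV_compact _ n
    (fun i => `[(a p 0 i - r / 2), (a p 0 i + r / 2)]%classic)).
  by move=> i; apply: segment_compact.
pose w q := (rho (a q) / rho (a p)) *: v.
pose X c (y : 'rV[R]_n) : 'cV[R]_n := let q := param c y in
  if `[< dom a q >] then jac (change a c) (a q) *m w q else 0.
have XE c q : dom c q -> dom a q -> X c (c q) = jac (change a c) (a q) *m w q.
  by move=> cq aq; rewrite /X coordK // asboolT.
have X0 c q : dom c q -> ~ dom a q -> X c (c q) = 0.
  by move=> cq aq; rewrite /X coordK // asboolF.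
have X0K c q : dom c q -> ~ K q -> X c (c q) = 0.
  move=> cq Kq; have [aq|aq] := pselect (dom a q); last exact: X0.
  rewrite XE // /w; have [->|] := eqVneq (rho (a q)) 0.
    by rewrite mul0r scale0r mulmx0.
  move=> /rhos aqr; exfalso; apply: Kq; exists (a q); last by rewrite coordK.
  move=> i; have := aqr i; rewrite /= in_itv /= ltr_norml => /andP[? ?].
  by apply/andP; split; lra.
have sX : smooth_components X.
  move=> c Ac i j k; apply: Ck_local => _ [q cq <-].
  have [aq|aq] := pselect (dom a q).
    exists (overlap c a).
      by split; [apply: overlap_open|apply: overlap_in].
    have oca := overlap_open (a:=c) (b:=a).
    have oac := overlap_open (a:=a) (b:=c).
    suff H : Ckm k (overlap c a) (fun y => (rho (change c a y) / rho (a p)) *: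
        (jac (change a c) (change c a y) *m v)).
      apply: (Ck_ext oca _ (H i j)) => _ [q' [cq' aq'] <-].
      by rewrite XE // change_coord // /w -scalemxAr.
    have sca := smooth_change Ac Aa.
    apply: CkmZ => //.
      apply: CkM => //; last exact: Ck_cst.
      apply: (Ck_comp (Q := setT) (f := rho) (F := change c a) oca openT) => //.
      by move=> l; apply: sca.
    apply: CkmM => //; last exact: Ckm_cst.
    apply: (Ckm_comp oca oac _ (sca k)); last exact: change_overlap.
    by apply: Ckm_jac => //; apply: smooth_change.
  have oK : open (~` K) by apply: closed_openC.
  exists (c @` (dom c `&` ~` K)).
    split; first exact: coord_open_image.
    exists q => //; split => // -[x xK xq]; apply: aq; rewrite -xq.
    by have [] := param_img (Kimg _ xK).
  apply: (Ck_ext _ _ (Ck_cst k _ 0)); first exact: coord_open_image.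
  by move=> _ [q' [cq' Kq'] <-]; rewrite X0K // mxE.
have lX : transformation_law X (fun J Xa Xb => Xb = J *m Xa).
  move=> c d Ac Ad q cq dq.
  have [aq|aq] := pselect (dom a q); last by rewrite !X0 // mulmx0.
  rewrite !XE // transition_jacE mulmxA; congr (_ *m _).
  exact: jac_change_comp.
exists (VectorField sX lX); rewrite /= XE // /w divff // scale1r.
rewrite (_ : jac _ _ = 1%:M) ?mul1mx // -(jac_id (a p)).
apply: (jac_ext (overlap_open (a:=a) (b:=a))); first exact: overlap_in.
by move=> _ [q [aq _] <-]; rewrite change_coord.
Qed.

End Atlas.

(** * Brackets of an orthonormal frame of eigenvectors *)

Section BracketRules.
Context {R : realType} {n : nat}.
Variable O : set 'rV[R]_n.
Hypothesis oO : open O.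
Implicit Types (X Y Z : 'rV[R]_n -> 'cV[R]_n) (x : 'rV[R]_n) (v w : 'cV[R]_n).

Lemma dird_dvC Y v w x : smoothm O Y -> O x ->
  dird v (dv Y) x *m w = dird w (dv Y) x *m v.
Proof.
move=> sY Ox; apply/colP => k; rewrite !mxE.
under eq_bigr do rewrite dirdE mulr_suml.
rewrite exchange_big /=; apply: eq_bigr => i _; rewrite dirdE mulr_suml.
apply: eq_bigr => j _.
have E a b : partial a (fun y => dv Y y k b) x =
    partial a (partial b (fun y => Y y k 0)) x.
  by congr (partial a _ x); apply/funext => y; rewrite dvE.
rewrite !E (partialC _ _ oO (sY 2%N k 0) Ox); ring.
Qed.

Lemma dv_bracket X Y v x : smoothm O X -> smoothm O Y -> O x ->
  dv (lie_bracket X Y) x *m v =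
  dird v (dv Y) x *m X x + dv Y x *m (dv X x *m v) -
  (dird v (dv X) x *m Y x + dv X x *m (dv Y x *m v)).
Proof.
move=> sX sY Ox; rewrite -dird_dv.
rewrite (dird_ext v oO Ox (fun y _ => lie_bracketE X Y y)).
have sdX := smoothm_dv oO sX; have sdY := smoothm_dv oO sY.
rewrite (dirdB v oO (smoothmM oO sdY sX 1%N) (smoothmM oO sdX sY 1%N) Ox).
rewrite (dirdM v oO (sdY 1%N) (sX 1%N) Ox) (dirdM v oO (sdX 1%N) (sY 1%N) Ox).
by rewrite (dird_dv v X) (dird_dv v Y).
Qed.

Lemma lie_bracket2E X Y Z x : smoothm O X -> smoothm O Y -> O x ->
  lie_bracket (lie_bracket X Y) Z x =
  dv Z x *m (dv Y x *m X x) - dv Z x *m (dv X x *m Y x) -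
  (dird (Z x) (dv Y) x *m X x + dv Y x *m (dv X x *m Z x) -
  (dird (Z x) (dv X) x *m Y x + dv X x *m (dv Y x *m Z x))).
Proof.
move=> sX sY Ox; rewrite lie_bracketE (dv_bracket (Z x) sX sY Ox).
by rewrite lie_bracketE mulmxBr.
Qed.

Lemma jacobi X Y Z x : smoothm O X -> smoothm O Y -> smoothm O Z -> O x ->
  lie_bracket (lie_bracket X Y) Z x + lie_bracket (lie_bracket Y Z) X x +
  lie_bracket (lie_bracket Z X) Y x = 0.
Proof.
move=> sX sY sZ Ox.
rewrite (lie_bracket2E Z sX sY Ox) (lie_bracket2E X sY sZ Ox).
rewrite (lie_bracket2E Y sZ sX Ox).
have cancel (a b c e e' p q r s : 'cV[R]_n) :
  e - e' - (b + p - (a + q)) + (r - q - (c + e - (b + s))) +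
  (p - s - (a + r - (c + e'))) = 0.
  by apply/colP => i; rewrite !mxE; ring.
rewrite (dird_dvC (Y x) (X x) sZ Ox) (dird_dvC (Z x) (Y x) sX Ox).
rewrite (dird_dvC (X x) (Z x) sY Ox).
exact: cancel.
Qed.

Lemma d0N (f : 'rV[R]_n -> R) x : smooth_on O f -> O x ->
  d0 (fun y => - f y) x = - d0 f x.
Proof.
move=> sf Ox; apply/rowP => i; rewrite !mxE.
by have [_] := is_deriveN (Ck_is_derive i (sf 1%N) Ox).
Qed.

Lemma d0Dc (f : 'rV[R]_n -> R) a x : smooth_on O f -> O x ->
  d0 (fun y => f y + a) x = d0 f x.
Proof.
move=> sf Ox; apply/rowP => i; rewrite !mxE.
rewrite (partialD i (sf 1%N) (Ck_cst 1 O a) Ox).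
by rewrite [X in _ + X](derive_cst (a : R) x _) addr0.
Qed.

Lemma d0cM (f : 'rV[R]_n -> R) a x : smooth_on O f -> O x ->
  d0 (fun y => a * f y) x = a *: d0 f x.
Proof.
move=> sf Ox; apply/rowP => i; rewrite !mxE.
rewrite (partialM i (Ck_cst 1 O a) (sf 1%N) Ox).
by rewrite [X in X * _ + _](derive_cst (a : R) x _) mul0r add0r.
Qed.

Lemma dvZ (f : 'rV[R]_n -> R) X v x : smooth_on O f -> smoothm O X -> O x ->
  dv (fun y => f y *: X y) x *m v = (d0 f x *m v) 0 0 *: X x + f x *: (dv X x *m v).
Proof.
by move=> sf sX Ox; rewrite -dird_dv (dirdZ v oO (sf 1%N) (sX 1%N) Ox) dird_dv.
Qed.

Lemma lie_bracket_comb (f h : 'rV[R]_n -> R) X Y Z x : smooth_on O f -> smooth_on O h ->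
  smoothm O X -> smoothm O Y -> smoothm O Z -> O x ->
  lie_bracket (fun y => f y *: X y + h y *: Y y) Z x =
  f x *: lie_bracket X Z x - (d0 f x *m Z x) 0 0 *: X x +
  (h x *: lie_bracket Y Z x - (d0 h x *m Z x) 0 0 *: Y x).
Proof.
move=> sf sh sX sY sZ Ox; rewrite !lie_bracketE.
have -> : dv (fun y => f y *: X y + h y *: Y y) x *m Z x =
   dv (fun y => f y *: X y) x *m Z x + dv (fun y => h y *: Y y) x *m Z x.
  rewrite -!dird_dv; apply: (dirdD _ oO (smoothmZ oO sf sX 1%N) (smoothmZ oO sh sY 1%N) Ox).
rewrite !dvZ // mulmxDr -!scalemxAr.
move: (dv Z x *m X x) (dv Z x *m Y x) (dv X x *m Z x) (dv Y x *m Z x) ((d0 f x *m _) 0 0)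
  ((d0 h x *m _) 0 0) => a b c d e g.
by apply/colP => i; rewrite !mxE; ring.
Qed.

Lemma lie_bracket_ext X Y Z x : O x -> (forall y, O y -> X y = Y y) ->
  lie_bracket X Z x = lie_bracket Y Z x.
Proof. by move=> Ox XY; rewrite !lie_bracketE XY // (dv_ext oO Ox XY). Qed.

Lemma lie_bracketC X Y x : lie_bracket X Y x = - lie_bracket Y X x.
Proof. by rewrite !lie_bracketE opprB. Qed.

Lemma smooth_bil (g : 'rV[R]_n -> 'M[R]_n) X Y : smoothm O g -> smoothm O X ->
  smoothm O Y -> smooth_on O (fun y => bil (g y) (X y) (Y y)).
Proof.
move=> sg sX sY k.
by apply: (smoothmM oO (smoothmM oO (smoothm_tr oO sX) sg) sY).
Qed.

End BracketRules.

Lemma bilZr {R : realType} {n : nat} (A : 'M[R]_n) u a w :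
  bil A u (a *: w) = a * bil A u w.
Proof. by rewrite /bil -scalemxAr mxE. Qed.

Lemma bil0r {R : realType} {n : nat} (A : 'M[R]_n) u : bil A u 0 = 0.
Proof. by rewrite /bil mulmx0 mxE. Qed.

Lemma bilNr {R : realType} {n : nat} (A : 'M[R]_n) u w :
  bil A u (- w) = - bil A u w.
Proof. by rewrite -scaleN1r bilZr mulN1r. Qed.

Section Frame.
Context {R : realType} {n : nat}.
Variables (O : set 'rV[R]_n).
Variables (phi g : 'rV[R]_n -> 'M[R]_n) (xi : 'rV[R]_n -> 'cV[R]_n)
  (eta : 'rV[R]_n -> 'rV[R]_n).
Implicit Types (x y : 'rV[R]_n) (w z : 'cV[R]_n).
Hypothesis oO : open O.
Hypothesis sphi : smoothm O phi.
Hypothesis sg : smoothm O g.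
Hypothesis sxi : smoothm O xi.
Hypothesis seta : smoothm O eta.
Hypothesis gsym : forall x, O x -> (g x)^T = g x.
Hypothesis gunit : forall x, O x -> g x \in unitmx.
Hypothesis eta_xi : forall x, O x -> eta x *m xi x = 1%:M.
Hypothesis deta : forall x, O x -> d1 eta x = 0.

Local Notation h := (hten phi xi).
Local Notation B := (Bten phi xi).
Local Notation A := (Aten phi xi).

Hypothesis nabla_xi : forall x, O x -> nab g xi x = A x.
Hypothesis sA : smoothm O A.
Hypothesis sB : smoothm O B.

Variables (lam mu : 'rV[R]_n -> R) (u v : 'rV[R]_n -> 'cV[R]_n).
Hypothesis slam : smooth_on O lam.
Hypothesis smu : smooth_on O mu.
Hypothesis lam_gt0 : forall x, O x -> 0 < lam x.
Hypothesis dlam : forall x, O x -> d0 lam x = (- 2 * lam x) *: eta x.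
Hypothesis lieB : forall x, O x -> lie_deriv11 xi B x = mu x *: h x - 2 *: B x.
Hypothesis su : smoothm O u.
Hypothesis sv : smoothm O v.
Hypothesis vE : forall x, O x -> v x = phi x *m u x.
Hypothesis phiv : forall x, O x -> phi x *m v x = - u x.
Hypothesis Bu : forall x, O x -> B x *m u x = lam x *: u x.
Hypothesis Bv : forall x, O x -> B x *m v x = - lam x *: v x.
Hypothesis hu : forall x, O x -> h x *m u x = - lam x *: v x.
Hypothesis Au : forall x, O x -> A x *m u x = (1 - lam x) *: u x.
Hypothesis Av : forall x, O x -> A x *m v x = (1 + lam x) *: v x.
Hypothesis etau : forall x, O x -> eta x *m u x = 0.
Hypothesis etav : forall x, O x -> eta x *m v x = 0.
Hypothesis guu : forall x, O x -> bil (g x) (u x) (u x) = 1.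
Hypothesis gvv : forall x, O x -> bil (g x) (v x) (v x) = 1.
Hypothesis guv : forall x, O x -> bil (g x) (u x) (v x) = 0.
Hypothesis span : forall x, O x -> forall w,
  w = bil (g x) (u x) w *: u x + bil (g x) (v x) w *: v x + (eta x *m w) 0 0 *: xi x.
Hypothesis curv_uv : forall x, O x -> curv g A x (u x) (v x) = 0.

(* nabla_w Y *)
Local Notation del w Y x := (dv Y x *m w + gam g x w *m Y x).

(** Differentiate [g(Y, Y) = 1] in the direction of [w]. *)
Lemma unit_del (Y : 'rV[R]_n -> 'cV[R]_n) w x : smoothm O Y ->
  (forall x, O x -> bil (g x) (Y x) (Y x) = 1) -> O x ->
  bil (g x) (Y x) (del w Y x) = 0.
Proof.
move=> sY YY Ox.
have E y : O y -> (Y y)^T *m g y *m Y y = 1%:M.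
  move=> Oy; apply/matrixP => i j; rewrite !ord1 -[LHS]/(bil _ _ _) YY //.
  by rewrite mxE eqxx.
have sYt := smoothm_tr oO sY.
have := dirdM w oO (smoothmM oO sYt sg 1%N) (sY 1%N) Ox.
rewrite (dird_ext w oO Ox E) dird_cst (dirdM w oO (sYt 1%N) (sg 1%N) Ox).
rewrite dird_tr (dird_metric oO gsym gunit w Ox) dird_dv => /matrixP/(_ 0 0).
have T z : ((dv Y x *m w)^T *m g x *m Y x) 0 0 = bil (g x) (Y x) (dv Y x *m w).
  by rewrite -[in RHS](gsym Ox) bil_tr.
rewrite !(mulmxDl, mulmxDr) !mulmxA [in LHS]mxE.
have -> : ((Y x)^T *m (gam g x w)^T *m g x *m Y x) =
    (gam g x w *m Y x)^T *m g x *m Y x by rewrite trmx_mul.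
have -> : (Y x)^T *m g x *m gam g x w *m Y x = (Y x)^T *m g x *m (gam g x w *m Y x).
  by rewrite !mulmxA.
have -> : (Y x)^T *m g x *m dv Y x *m w = (Y x)^T *m g x *m (dv Y x *m w).
  by rewrite !mulmxA.
rewrite /bil mulmxDr.
have S z : z^T *m g x *m Y x = (Y x)^T *m g x *m z.
  apply/matrixP => i j; rewrite !ord1 -[LHS]/(bil _ _ _) -[RHS]/(bil _ _ _).
  by rewrite -[in RHS](gsym Ox) bil_tr.
rewrite !S.
move: ((Y x)^T *m g x *m (dv Y x *m w)) ((Y x)^T *m g x *m (gam g x w *m Y x)) => a b.
rewrite !mxE; move: (a 0 0) (b 0 0) => p q E1.
have /eqP : 2 * (p + q) = 0 by rewrite [RHS]E1; ring.
by rewrite mulf_eq0 pnatr_eq0 => /eqP.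
Qed.

Lemma dlam_u x w : O x -> eta x *m w = 0 -> (d0 lam x *m w) 0 0 = 0.
Proof. by move=> Ox ew; rewrite dlam // -scalemxAl ew scaler0 mxE. Qed.

(** [d eta = 0] on two fields on which [eta] is constant. *)
Lemma eta_bracket X Y x : smoothm O X -> smoothm O Y ->
  (forall y, O y -> eta y *m X y = eta x *m X x) ->
  (forall y, O y -> eta y *m Y y = eta x *m Y x) -> O x ->
  eta x *m lie_bracket X Y x = 0.
Proof.
move=> sX sY cX cY Ox; rewrite lie_bracketE mulmxBr !mulmxA.
have E Z w : smoothm O Z -> (forall y, O y -> eta y *m Z y = eta x *m Z x) ->
    eta x *m dv Z x *m w = - (dird w eta x *m Z x).
  move=> sZ cZ; have := dirdM w oO (seta 1%N) (sZ 1%N) Ox.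
  rewrite (dird_ext w oO Ox cZ) dird_cst dird_dv mulmxA => /esym/eqP.
  by rewrite addrC addr_eq0 => /eqP.
rewrite !E // opprK.
have -> : dird (Y x) eta x *m X x = dird (X x) eta x *m Y x.
  apply/matrixP => i j; rewrite !ord1 !mxE.
  under eq_bigr do rewrite dirdE mulr_suml.
  rewrite exchange_big /=; apply: eq_bigr => k _; rewrite dirdE mulr_suml.
  apply: eq_bigr => l _; rewrite (deta_sym deta k l Ox); ring.
by rewrite addNr.
Qed.

Lemma coords x a b w : O x -> w = a *: u x + b *: v x ->
  bil (g x) (u x) w = a /\ bil (g x) (v x) w = b.
Proof.
move=> Ox ->; have gvu : bil (g x) (v x) (u x) = 0.
  by rewrite -(gsym Ox) bil_tr guv.
have E z : bil (g x) z (a *: u x + b *: v x) =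
    a * bil (g x) z (u x) + b * bil (g x) z (v x).
  by rewrite bil_linr bilZr.
by rewrite !E guu // guv // gvv // gvu; split; ring.
Qed.

(** The component along [u] is [- g(A u, u)], since [nabla_xi u] is orthogonal
    to the unit field [u]; the component along [v] is found by applying [L_xi]
    to [B u = lam u]. *)
Lemma bracket_xi_u x : O x ->
  lie_bracket xi u x = (lam x - 1) *: u x + (- (mu x / 2)) *: v x.
Proof.
move=> Ox; set W := lie_bracket xi u x.
have eW : eta x *m W = 0.
  by apply: eta_bracket => // y Oy; rewrite ?eta_xi // !etau.
have := span Ox W; rewrite eW mxE scale0r addr0.
set a := bil _ _ _; set b := bil _ _ W => WE.
have aE : a = lam x - 1.
  have WA : W = del (xi x) u x - A x *m u x.
    rewrite -nabla_xi // nabE mulmxDl /W lie_bracketE (gamC oO gsym (xi x) _ Ox).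
    by rewrite opprD addrACA subrr addr0.
  rewrite /a WA Au //.
  have -> : del (xi x) u x - (1 - lam x) *: u x =
     (lam x - 1) *: u x + del (xi x) u x.
    by rewrite addrC; congr (_ + _); rewrite -scaleNr opprB.
  by rewrite bil_linr guu // unit_del // mulr1 addr0.
have bE : b = - (mu x / 2).
  have L : lie_deriv11 xi B x *m u x = (d0 lam x *m xi x) 0 0 *: u x +
      lam x *: W - B x *m W.
    rewrite lie_deriv11E !mulmxDl mulNmx -(mulmxA (dv xi x)) Bu //.
    have := dirdM (xi x) oO (sB 1%N) (su 1%N) Ox.
    rewrite (dird_ext (xi x) oO Ox Bu) (dirdZ (xi x) oO (slam 1%N) (su 1%N) Ox).
    rewrite dird_dv => /eqP; rewrite -subr_eq => /eqP <-.
    rewrite /W lie_bracketE mulmxBr scalerBr -scalemxAr !mulmxA.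
    move: (dv u x *m xi x) (B x *m dv u x *m xi x) (dv xi x *m u x)
      (B x *m dv xi x *m u x) => p q r s.
    by apply/colP => i; rewrite !mxE; ring.
  have dl : (d0 lam x *m xi x) 0 0 = - 2 * lam x.
    by rewrite dlam // -scalemxAl eta_xi // !mxE eqxx mulr1.
  move: L; rewrite lieB // dl mulmxBl -!scalemxAl hu // Bu //.
  rewrite WE mulmxDr -!scalemxAr Bu // Bv //.
  have lam0 := lam_gt0 Ox.
  have -> : - 2 * lam x *: u x + lam x *: (a *: u x + b *: v x) -
      (a *: (lam x *: u x) + b *: (- lam x *: v x)) =
      (- 2 * lam x) *: u x + (2 * lam x * b) *: v x.
    by apply/colP => i; rewrite !mxE; ring.
  have -> : mu x *: (- lam x *: v x) - 2 *: (lam x *: u x) =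
      (- 2 * lam x) *: u x + (- mu x * lam x) *: v x.
    by apply/colP => i; rewrite !mxE; ring.
  move=> E; have [_] := coords Ox E.
  have [_ ->] := coords Ox (erefl ((- 2 * lam x) *: u x + (- mu x * lam x) *: v x)).
  move=> /(congr1 (fun q : R => q / (2 * lam x))).
  rewrite [2 * lam x * b]mulrC mulfK ?mulf_neq0 ?pnatr_eq0 ?gt_eqF // => <-.
  by field; rewrite gt_eqF.
by rewrite WE aE bE.
Qed.

(** [v = phi u] and [L_xi phi = 2 h]. *)
Lemma bracket_xi_v x : O x ->
  lie_bracket xi v x = (mu x / 2) *: u x + (- (lam x + 1)) *: v x.
Proof.
move=> Ox.
have -> : lie_bracket xi v x = lie_deriv11 xi phi x *m u x +
    phi x *m lie_bracket xi u x.
  rewrite !lie_bracketE lie_deriv11E !mulmxDl mulNmx mulmxBr.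
  have := dirdM (xi x) oO (sphi 1%N) (su 1%N) Ox.
  rewrite -(dird_ext (xi x) oO Ox vE) !dird_dv => ->.
  rewrite vE // !mulmxA.
  move: (dird (xi x) phi x *m u x) (phi x *m dv u x *m xi x) (dv xi x *m phi x *m u x)
    (phi x *m dv xi x *m u x) => p q r s.
  by apply/colP => i; rewrite !mxE; ring.
rewrite bracket_xi_u // mulmxDr -!scalemxAr phiv // -vE //.
rewrite lie_phi -scalemxAl hu //.
by apply/colP => i; rewrite !mxE; ring.
Qed.

(** As [lam] is constant along the leaves, [R(u, v)xi = 0] reads [(1 + lam)
    nabla_u v - (1 - lam) nabla_v u = A [u, v]].  Since [g(nabla_u v, v) =
    g(nabla_v u, u) = 0], its components along
    [u] and [v] are, up to sign, [2 lam] times those of [[u, v]]. *)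
Lemma bracket_u_v x : O x -> lie_bracket u v x = 0.
Proof.
move=> Ox; set Z := lie_bracket u v x.
have eZ : eta x *m Z = 0.
  by apply: eta_bracket => // y Oy; rewrite ?etav // !etau.
have := span Ox Z; rewrite eZ mxE scale0r addr0.
set a := bil _ _ _; set b := bil _ _ Z => ZE.
pose P := del (u x) v x; pose Q := del (v x) u x.
have PQ : P = Q + Z.
  rewrite /P /Q /Z lie_bracketE (gamC oO gsym (u x) (v x) Ox).
  by rewrite addrAC addrCA subrr addr0 addrC.
have uQ : bil (g x) (u x) Q = 0 by apply: unit_del.
have vP : bil (g x) (v x) P = 0 by apply: unit_del.
have eqn : (1 + lam x) *: P - (1 - lam x) *: Q - A x *m Z = 0.
  rewrite -(curv_uv Ox) /curv.
  have s1 : smooth_on O (fun y => 1 + lam y).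
    by move=> k; apply: CkD => //; apply: Ck_cst.
  have s2 : smooth_on O (fun y => 1 - lam y).
    by move=> k; apply: CkB => //; apply: Ck_cst.
  have d1lam w : eta x *m w = 0 -> (d0 (fun y => 1 + lam y) x *m w) 0 0 = 0.
    move=> ew; rewrite (_ : (fun y => _) = (fun y => lam y + 1)).
      by rewrite (d0Dc 1 slam Ox) dlam_u.
    by apply/funext => y; rewrite addrC.
  have d2lam w : eta x *m w = 0 -> (d0 (fun y => 1 - lam y) x *m w) 0 0 = 0.
    have sN : smooth_on O (fun y => - lam y) by move=> k; apply: CkN.
    move=> ew; rewrite (_ : (fun y => _) = (fun y => - lam y + 1)).
      by rewrite (d0Dc 1 sN Ox) (d0N slam Ox) mulNmx mxE dlam_u // oppr0.
    by apply/funext => y; rewrite addrC.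
  have E1 : dird (u x) A x *m v x = (1 + lam x) *: (dv v x *m u x) -
      A x *m (dv v x *m u x).
    have := dirdM (u x) oO (sA 1%N) (sv 1%N) Ox.
    rewrite (dird_ext (u x) oO Ox Av) (dirdZ (u x) oO (s1 1%N) (sv 1%N) Ox).
    by rewrite d1lam ?etau // scale0r add0r dird_dv => ->; rewrite addrK.
  have E2 : dird (v x) A x *m u x = (1 - lam x) *: (dv u x *m v x) -
      A x *m (dv u x *m v x).
    have := dirdM (v x) oO (sA 1%N) (su 1%N) Ox.
    rewrite (dird_ext (v x) oO Ox Au) (dirdZ (v x) oO (s2 1%N) (su 1%N) Ox).
    by rewrite d2lam ?etav // scale0r add0r dird_dv => ->; rewrite addrK.
  rewrite E1 E2 -!(mulmxA (gam _ _ _)) Au // Av // -!scalemxAr.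
  rewrite /P /Q /Z lie_bracketE mulmxBr.
  move: (dv v x *m u x) (dv u x *m v x) (gam g x (u x) *m v x) (gam g x (v x) *m u x)
    => p q r s.
  move: (A x *m p) (A x *m q) => Ap Aq.
  by apply/colP => i; rewrite !mxE; ring.
have lam0 := lam_gt0 Ox.
have AZ : A x *m Z = ((1 - lam x) * a) *: u x + ((1 + lam x) * b) *: v x.
  rewrite ZE mulmxDr -!scalemxAr Au // Av // !scalerA.
  by rewrite [a * _]mulrC [b * _]mulrC.
have [uAZ vAZ] := coords Ox AZ.
have lin w : bil (g x) w ((1 + lam x) *: P - (1 - lam x) *: Q - A x *m Z) =
    (1 + lam x) * bil (g x) w P - (1 - lam x) * bil (g x) w Q - bil (g x) w (A x *m Z).
  by rewrite -addrA bil_linr -scaleNr bil_linr bilNr; ring.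
have Pa : bil (g x) (u x) P = a.
  by rewrite PQ -[Q]scale1r bil_linr uQ mulr0 add0r.
have Qb : bil (g x) (v x) Q = - b.
  have -> : Q = P - Z by rewrite PQ addrK.
  by rewrite -[P]scale1r bil_linr vP mulr0 add0r bilNr.
have Eu : 2 * lam x * a = 0.
  have := lin (u x); rewrite eqn bil0r Pa uQ uAZ => E; lra.
have Ev : 2 * lam x * b = 0.
  have := lin (v x); rewrite eqn bil0r vP Qb vAZ => E; lra.
have l2 : 2 * lam x != 0 by rewrite mulf_neq0 ?pnatr_eq0 ?gt_eqF.
move/eqP: Eu; rewrite mulf_eq0 (negPf l2) /= => /eqP a0.
move/eqP: Ev; rewrite mulf_eq0 (negPf l2) /= => /eqP b0.
by rewrite ZE a0 b0 !scale0r addr0.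
Qed.

(** In the Jacobi identity for [xi], [u] and [v] the bracket [[u, v]] vanishes and
    [lam] is constant along [u] and [v]; only the derivatives of [mu] in these
    directions remain, one as the coefficient of [u] and one as that of [v]. *)
Lemma dmu_uv x : O x -> (d0 mu x *m u x) 0 0 = 0 /\ (d0 mu x *m v x) 0 0 = 0.
Proof.
move=> Ox.
pose b y := - (mu y / 2).
have sb : smooth_on O b.
  move=> k; have := CkM (Ck_cst k O (- 2^-1)) (smu k) oO.
  by apply: Ck_ext => // y _; rewrite /b mulNr mulrC.
pose a y := lam y - 1.
have sa : smooth_on O a by move=> k; apply: CkB => //; apply: Ck_cst.
pose b' y := mu y / 2.
have sb' : smooth_on O b'.
  by move=> k; apply: CkM => //; apply: Ck_cst.
pose c y := - (lam y + 1).
have sc : smooth_on O c.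
  by move=> k; apply: CkN => //; apply: CkD => //; apply: Ck_cst.
have da w : eta x *m w = 0 -> (d0 a x *m w) 0 0 = 0.
  by move=> ew; rewrite /a (d0Dc (- 1) slam Ox) dlam_u.
have dc w : eta x *m w = 0 -> (d0 c x *m w) 0 0 = 0.
  have s1 : smooth_on O (fun y => lam y + 1).
    by move=> k; apply: CkD => //; apply: Ck_cst.
  by move=> ew; rewrite /c (d0N s1 Ox) (d0Dc 1 slam Ox) mulNmx mxE dlam_u // oppr0.
have db w : (d0 b x *m w) 0 0 = - 2^-1 * (d0 mu x *m w) 0 0.
  rewrite (_ : b = (fun y => - 2^-1 * mu y)).
    by rewrite (d0cM (- 2^-1) smu Ox) -scalemxAl mxE.
  by apply/funext => y; rewrite /b mulNr mulrC.
have db' w : (d0 b' x *m w) 0 0 = 2^-1 * (d0 mu x *m w) 0 0.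
  rewrite (_ : b' = (fun y => 2^-1 * mu y)).
    by rewrite (d0cM 2^-1 smu Ox) -scalemxAl mxE.
  by apply/funext => y; rewrite /b' mulrC.
have E1 : lie_bracket (lie_bracket xi u) v x = - (d0 b x *m v x) 0 0 *: v x.
  rewrite (lie_bracket_ext oO (Y := fun y => a y *: u y + b y *: v y) v Ox);
    last by move=> y Oy; rewrite bracket_xi_u.
  rewrite (lie_bracket_comb oO sa sb su sv sv Ox) bracket_u_v // da ?etav //.
  by rewrite lie_bracketE subrr !scaler0 scale0r subr0 add0r sub0r scaleNr.
have E2 : lie_bracket (lie_bracket u v) xi x = 0.
  rewrite (lie_bracket_ext oO (Y := fun=> 0) xi Ox); last exact: bracket_u_v.
  by rewrite lie_bracketE mulmx0 sub0r -dird_dv dird_cst oppr0.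
have E3 : lie_bracket (lie_bracket v xi) u x = (d0 b' x *m u x) 0 0 *: u x.
  have sc' : smooth_on O (fun y => - c y) by move=> k; apply: CkN.
  have sb1 : smooth_on O (fun y => - b' y) by move=> k; apply: CkN.
  have H y : O y -> lie_bracket v xi y = (- b' y) *: u y + (- c y) *: v y.
    move=> Oy; rewrite lie_bracketC bracket_xi_v // opprD !scaleNr.
    by rewrite /b' /c.
  rewrite (lie_bracket_ext oO u Ox H).
  rewrite (lie_bracket_comb oO sb1 sc' su sv su Ox).
  rewrite [lie_bracket v u x]lie_bracketC bracket_u_v // oppr0 scaler0 add0r.
  rewrite [lie_bracket u u x]lie_bracketE subrr scaler0 add0r.
  rewrite (d0N sb' Ox) (d0N sc Ox) !mulNmx [(- (d0 c x *m u x)) 0 0]mxE.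
  rewrite [(- (d0 b' x *m u x)) 0 0]mxE dc ?etau // oppr0 scale0r subr0.
  by rewrite -scaleNr opprK ?addr0.
have := jacobi oO sxi su sv Ox; rewrite E1 E2 E3 addr0 db db'.
rewrite addrC => E.
have := coords Ox (esym E); rewrite !bil0r => -[e1 e2].
split; [move/esym/eqP: e1|move/esym/eqP: e2].
  by rewrite mulf_eq0 invr_eq0 pnatr_eq0 => /eqP.
by rewrite mulNr opprK mulf_eq0 invr_eq0 pnatr_eq0 => /eqP.
Qed.

End Frame.

(** * Curvature along leaves on which the metric is constant *)

Section CurvatureLeaf.
Context {R : realType} {n : nat}.
Variables (O : set 'rV[R]_n) (g A : 'rV[R]_n -> 'M[R]_n)
  (xi : 'rV[R]_n -> 'cV[R]_n) (eta : 'rV[R]_n) (x : 'rV[R]_n).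
Implicit Types (u v w z : 'cV[R]_n).
Hypothesis oO : open O.
Hypothesis gsym : forall x, O x -> (g x)^T = g x.
Hypothesis gunit : forall x, O x -> g x \in unitmx.
Hypothesis Ox : O x.

Lemma curvC v w : curv g A x v w = - curv g A x w v.
Proof. by rewrite /curv opprD !opprB. Qed.

Lemma curv_linl a v v' w :
  curv g A x (a *: v + v') w = a *: curv g A x v w + curv g A x v' w.
Proof.
rewrite /curv dird_lin gam_lin !mulmxDl !mulmxDr -!scalemxAl -!scalemxAr.
move: (dird v A x *m w) (dird v' A x *m w) (dird w A x *m v) (dird w A x *m v')
  (gam g x v *m A x *m w) (gam g x v' *m A x *m w) (gam g x w *m A x *m v)
  (gam g x w *m A x *m v') => b c d e f h i j.
by apply/colP => k; rewrite !mxE; ring.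
Qed.

Lemma curv_linr a v w w' :
  curv g A x v (a *: w + w') = a *: curv g A x v w + curv g A x v w'.
Proof. by rewrite curvC curv_linl opprD -scalerN -!curvC. Qed.

Hypothesis eta_xi : eta *m xi x = 1%:M.
Hypothesis eta_A : eta *m A x = 0.
Hypothesis nabla : nab g xi x = A x.
Hypothesis dxi : dv xi x = 0.
Hypothesis dg : forall w, eta *m w = 0 -> dird w g x = 0.
Hypothesis dA : forall w, eta *m w = 0 -> dird w A x = 0.

(** Along the leaves [eta = 0] neither [g] nor [A] varies in these coordinates, so
    only the terms with Christoffel symbols remain.  On vectors tangent to the
    leaves the Christoffel symbols only have a component in the direction of [xi],
    given by [- g A]; hence [Gamma(v, A w)] is [- g(A v, A w) xi], which is
    symmetric in [v] and [w]. *)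
Lemma curv_leaf v w : eta *m v = 0 -> eta *m w = 0 -> curv g A x v w = 0.
Proof.
move=> ev ew.
have G2 z u : eta *m z = 0 ->
    forall q, bil (g x) (gam g x z *m u) q = - bil (g x) u (gam g x z *m q).
  move=> ez q; have := dird_metric oO gsym gunit z Ox; rewrite dg // => H.
  have := congr1 (fun M => bil M u q) H; rewrite /= bilD bilMl bilMr.
  rewrite {1}/bil mulmx0 mul0mx [LHS]mxE => /esym/eqP.
  by rewrite addr_eq0 => /eqP.
have bC u q : bil (g x) u q = bil (g x) q u.
  by rewrite -[in LHS](gsym Ox) bil_tr.
have G0 z u q : eta *m z = 0 -> eta *m u = 0 -> eta *m q = 0 ->
    bil (g x) (gam g x z *m u) q = 0.
  move=> ez eu eq.
  pose s z u q := bil (g x) (gam g x z *m u) q.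
  have sC a b c : s a b c = s b a c by rewrite /s (gamC oO gsym a b Ox).
  have sN a b c : eta *m a = 0 -> s a b c = - s a c b.
    by move=> ea; rewrite /s G2 // bC.
  have : s z u q = - s z u q.
    rewrite [LHS](sN z u q ez) [in LHS](sC z q u) [in LHS](sN q z u eq) opprK.
    by rewrite [LHS](sC q u z) [LHS](sN u q z eu) [in LHS](sC u z q).
  by move/eqP; rewrite -addr_eq0 -mulr2n mulrn_eq0 /= => /eqP.
have Gxi z u : eta *m z = 0 ->
    bil (g x) (gam g x z *m u) (xi x) = - bil (g x *m A x) u z.
  move=> ez; rewrite G2 // (gamC oO gsym z (xi x) Ox).
  by rewrite bilMr -nabla nabE dxi add0r.
have eAz z : eta *m (A x *m z) = 0 by rewrite mulmxA eta_A mul0mx.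
pose X := gam g x v *m (A x *m w) - gam g x w *m (A x *m v).
have XE z : bil (g x) X z =
    bil (g x) (gam g x v *m (A x *m w)) z - bil (g x) (gam g x w *m (A x *m v)) z.
  by rewrite /X /bil trmxB' !mulmxBl [LHS]mxE [Y in _ + Y]mxE.
have X0 z : bil (g x) X z = 0.
  have zE : z = (z - (eta *m z) 0 0 *: xi x) + (eta *m z) 0 0 *: xi x by rewrite subrK.
  have eD : eta *m (z - (eta *m z) 0 0 *: xi x) = 0.
    rewrite mulmxBr -scalemxAr eta_xi {1}[eta *m z]mx11_scalar.
    by rewrite scalemx1 subrr.
  rewrite zE addrC bil_linr XE Gxi // Gxi // (XE (z - _)) !G0 //.
  rewrite bilMr bilMr (bC (A x *m w)) (bC (A x *m v)).
  have -> : bil (g x) (A x *m w) (A x *m v) = bil (g x) (A x *m v) (A x *m w).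
    exact: bC.
  by rewrite opprK subr0 addr0 addNr mulr0.
have X00 : X = 0.
  have : X^T *m g x = 0.
    apply: mulmx_eq => z; rewrite mul0mx; apply/matrixP => i j; rewrite !ord1.
    by rewrite -[LHS]/(bil _ _ _) X0 mxE.
  move/(congr1 (mulmx^~ (invmx (g x)))); rewrite mulmxK ?gunit // mul0mx.
  by move/(congr1 trmx); rewrite trmxK trmx0.
by rewrite /curv !dA // !mul0mx subrr add0r -!mulmxA.
Qed.

Variables (hm : 'M[R]_n) (ka m : R).
Hypothesis hm_xi : hm *m xi x = 0.
Hypothesis Rxi : forall v, curv g A x v (xi x) =
    ka *: (v - (eta *m v) 0 0 *: xi x) + m *: (hm *m v).

(** The curvature is bilinear and skew, so its value on [xi] and a vector and
    its vanishing on the leaves determine it. *)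
Lemma curv_full v w : curv g A x v w =
  ka *: ((eta *m w) 0 0 *: v - (eta *m v) 0 0 *: w) +
  m *: ((eta *m w) 0 0 *: (hm *m v) - (eta *m v) 0 0 *: (hm *m w)).
Proof.
have D z : eta *m (z - (eta *m z) 0 0 *: xi x) = 0.
  rewrite mulmxBr -scalemxAr eta_xi {1}[eta *m z]mx11_scalar.
  by rewrite scalemx1 subrr.
set a := (eta *m v) 0 0; set b := (eta *m w) 0 0.
have vE : v = a *: xi x + (v - a *: xi x) by rewrite addrC subrK.
have wE : w = b *: xi x + (w - b *: xi x) by rewrite addrC subrK.
have Dv : eta *m (v - a *: xi x) = 0 := D v.
have Dw : eta *m (w - b *: xi x) = 0 := D w.
have F z : eta *m z = 0 -> curv g A x z w = b *: curv g A x z (xi x).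
  by move=> ez; rewrite {1}wE curv_linr (curv_leaf ez Dw) addr0.
rewrite {1}vE curv_linl [curv _ _ _ (xi x) w]curvC Rxi -/b F // Rxi Dv.
rewrite mxE scale0r subr0.
rewrite mulmxBr -scalemxAr hm_xi scaler0 subr0.
move: (hm *m v) (hm *m w) => p q.
by apply/colP => i; rewrite !mxE; ring.
Qed.

End CurvatureLeaf.

(** * Tensors depending on t only *)

Section BlockDiagonal.
Context {R : realType}.
Implicit Types (A B : 'M[R]_2) (a b : R).

Lemma bdiagM A B a b : bdiag A a *m bdiag B b = bdiag (A *m B) (a * b).
Proof.
rewrite /bdiag (mulmx_block A 0 0 a%:M B 0 0 b%:M).
by rewrite !mul0mx !mulmx0 !addr0 add0r -scalar_mxM.
Qed.

Lemma bdiagD A B a b : bdiag A a + bdiag B b = bdiag (A + B) (a + b).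
Proof.
by rewrite /bdiag (add_block_mx A 0 0 a%:M B 0 0 b%:M) !addr0 raddfD.
Qed.

Lemma bdiagZ A a c : c *: bdiag A a = bdiag (c *: A) (c * a).
Proof.
by rewrite /bdiag (scale_block_mx c A 0 0 a%:M) !scaler0 scale_scalar_mx.
Qed.

Lemma bdiagN A a : - bdiag A a = bdiag (- A) (- a).
Proof. by rewrite /bdiag (opp_block_mx A 0 0 a%:M) !oppr0 raddfN. Qed.

Lemma bdiag1 : bdiag 1%:M 1 = 1%:M :> 'M[R]_3.
Proof. by rewrite /bdiag -(scalar_mx_block 2 1). Qed.

Lemma bdiagT A a : (bdiag A a)^T = bdiag A^T a.
Proof. by rewrite /bdiag (tr_block_mx A 0 0 a%:M) !trmx0 tr_scalar_mx. Qed.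

Lemma bdiag_unit A a : A \in unitmx -> a != 0 -> bdiag A a \in unitmx.
Proof.
move=> uA a0; suff : bdiag (invmx A) a^-1 *m bdiag A a = 1%:M.
  by case/mulmx1_unit.
by rewrite bdiagM mulVmx // mulVf // bdiag1.
Qed.

Lemma bdiag_inv A a : A \in unitmx -> a != 0 ->
  invmx (bdiag A a) = bdiag (invmx A) a^-1.
Proof.
move=> uA a0; have E : bdiag (invmx A) a^-1 *m bdiag A a = 1%:M.
  by rewrite bdiagM mulVmx // mulVf // bdiag1.
by rewrite -[LHS]mul1mx -E mulmxK // bdiag_unit.
Qed.

Lemma bdiag_ul A a (i j : 'I_2) : bdiag A a (lshift 1 i) (lshift 1 j) = A i j.
Proof. exact: (block_mxEul A 0 0 a%:M). Qed.

Lemma bdiag_ur A a (i : 'I_2) (j : 'I_1) :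
  bdiag A a (lshift 1 i) (rshift 2 j) = 0.
Proof. by rewrite /bdiag [LHS](block_mxEur A 0 0 a%:M) mxE. Qed.

Lemma bdiag_dl A a (i : 'I_1) (j : 'I_2) :
  bdiag A a (rshift 2 i) (lshift 1 j) = 0.
Proof. by rewrite /bdiag [LHS](block_mxEdl A 0 0 a%:M) mxE. Qed.

Lemma bdiag_dr A a (i j : 'I_1) : bdiag A a (rshift 2 i) (rshift 2 j) = a.
Proof.
by rewrite /bdiag [LHS](block_mxEdr A 0 0 a%:M) mxE !ord1 eqxx mulr1n.
Qed.

Lemma it_rshift : it = rshift 2 (0 : 'I_1).
Proof. exact: val_inj. Qed.

Lemma bdiag_inj A B a b : bdiag A a = bdiag B b -> A = B /\ a = b.
Proof.
move=> /matrixP E; split; last first.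
  by have := E (rshift 2 (0 : 'I_1)) (rshift 2 (0 : 'I_1)); rewrite !bdiag_dr.
apply/matrixP => i j.
by have := E (lshift 1 i) (lshift 1 j); rewrite !bdiag_ul.
Qed.

Lemma I3_case (i : 'I_3) : (exists j : 'I_2, i = lshift 1 j) \/ i = it.
Proof.
case: (@split_ordP 2 1 i) => j ->; first by left; exists j.
by right; rewrite it_rshift ord1.
Qed.

Lemma lshift_it (j : 'I_2) : (lshift 1 j == it :> 'I_3) = false.
Proof.
by apply/negbTE/eqP => /(congr1 val) /= E; have := ltn_ord j; rewrite E.
Qed.

Lemma ddx_dx : ddx R it *m dx R it = bdiag 0 1.
Proof.
apply/matrixP => i j; transitivity ((i == it)%:R * (j == it)%:R : R).
  by rewrite mxE big_ord1 !mxE !eqxx andbT.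
have [[i' ->]|->] := I3_case i; have [[j' ->]|->] := I3_case j.
- by rewrite bdiag_ul lshift_it mul0r mxE.
- by rewrite [in RHS]it_rshift bdiag_ur lshift_it mul0r.
- by rewrite [in RHS]it_rshift bdiag_dl lshift_it mulr0.
- by rewrite [in RHS]it_rshift bdiag_dr eqxx mulr1.
Qed.

Lemma dx_mul (v : 'cV[R]_3) : (dx R it *m v) 0 0 = v it 0.
Proof. by rewrite /dx -rowE mxE. Qed.

End BlockDiagonal.

Section FunctionsOfT.
Context {R : realType}.
Implicit Types (x : 'rV[R]_3) (f : R -> R).

(** Both differential quotients agree before the limit is taken;
    differentiability in [t] can therefore be read off from the tensor field.
    *)
Lemma quotient_it f x : (fun h : R => h^-1 *:
    (((fun y : 'rV[R]_3 => f (y 0 it)) \o shift x) (h *: delta_mx 0 it) - f (x 0 it))) =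
  (fun h : R => h^-1 *: ((f \o shift (x 0 it)) (h *: (1 : R)) - f (x 0 it))).
Proof. by apply/funext => h /=; rewrite !mxE !eqxx. Qed.

Lemma partial_it f x : partial it (fun y => f (y 0 it)) x = 'D_1 f (x 0 it).
Proof. by rewrite /partial /derive quotient_it. Qed.

Lemma derivable_it f x :
  derivable (fun y : 'rV[R]_3 => f (y 0 it)) x (delta_mx 0 it) ->
  derivable f (x 0 it) 1.
Proof. by rewrite /derivable quotient_it. Qed.

Lemma partial_ne_it f x i : i != it -> partial i (fun y => f (y 0 it)) x = 0.
Proof.
move=> ni; rewrite -[RHS](derive_cst (0 : R) x (delta_mx 0 i)) /partial /derive.
set F := fun h : R => _; set G := fun h : R => _; suff -> : F = G by [].
apply/funext => h; rewrite /F /G /=.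
by rewrite !mxE eqxx [it == i]eq_sym (negPf ni) mulr0 add0r !subrr.
Qed.

Definition deriv_mx p q (T : R -> 'M[R]_(p, q)) (t : R) : 'M[R]_(p, q) :=
  \matrix_(i, j) 'D_1 (fun s => T s i j) t.

Lemma pd_bdiag (T : R -> 'M[R]_2) a x :
  pd it (fun y => bdiag (T (y 0 it)) a) x = bdiag (deriv_mx T (x 0 it)) 0.
Proof.
have c0 (b : R) : partial it (fun _ : 'rV[R]_3 => b) x = 0 by apply: derive_cst.
apply/matrixP => i j; rewrite mxE.
have [[i' ->]|->] := I3_case i; have [[j' ->]|->] := I3_case j.
- rewrite bdiag_ul mxE -[RHS](partial_it (fun s => T s i' j')).
  by congr (partial it _ x); apply/funext => y; rewrite bdiag_ul.
- rewrite [it in RHS]it_rshift bdiag_ur -(c0 0).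
  by congr (partial it _ x); apply/funext => y; rewrite [it in LHS]it_rshift bdiag_ur.
- rewrite [it in RHS]it_rshift bdiag_dl -(c0 0).
  by congr (partial it _ x); apply/funext => y; rewrite it_rshift bdiag_dl.
- rewrite [it in RHS]it_rshift bdiag_dr -(c0 a).
  by congr (partial it _ x); apply/funext => y; rewrite it_rshift bdiag_dr.
Qed.
End FunctionsOfT.

Section TensorsOfT.
Context {R : realType}.
Implicit Types (x : 'rV[R]_3).

Lemma pd_bdiag_ne (T : R -> 'M[R]_2) a x i : i != it ->
  pd i (fun y => bdiag (T (y 0 it)) a) x = 0.
Proof.
move=> ni; apply/matrixP => k l; rewrite !mxE.
rewrite -[RHS](partial_ne_it (fun s => bdiag (T s) a k l) x ni).
by congr (partial i _ x).
Qed.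

Lemma dird_bdiag (T : R -> 'M[R]_2) a x (w : 'cV[R]_3) :
  dird w (fun y => bdiag (T (y 0 it)) a) x =
  w it 0 *: bdiag (deriv_mx T (x 0 it)) 0.
Proof.
rewrite dird_sum (bigD1 it) //= pd_bdiag big1 ?addr0 // => i ni.
by rewrite pd_bdiag_ne // scaler0.
Qed.

End TensorsOfT.

Section AlmostContactInCharts.
Context {R : realType} {n : nat} {M : manifold R n}.
Variable S : almost_contact_metric M.
Variable c : chart R n M.
Hypothesis Ac : atlas M c.

Local Notation phi := (acm_phi S c).
Local Notation g := (acm_g S c).
Local Notation xi := (acm_xi S c).
Local Notation eta := (acm_eta S c).
Local Notation O := (img c).

Lemma acm_oO : open O. Proof. exact: img_open. Qed.
Lemma acm_sphi : smoothm O phi.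
Proof. by move=> k i j; exact: (t11_smooth (acm_phi S) Ac i j k). Qed.
Lemma acm_sg : smoothm O g.
Proof. by move=> k i j; exact: (rm_smooth (acm_g S) Ac i j k). Qed.
Lemma acm_sxi : smoothm O xi.
Proof. by move=> k i j; exact: (vf_smooth (acm_xi S) Ac i j k). Qed.
Lemma acm_seta : smoothm O eta.
Proof. by move=> k i j; exact: (of_smooth (acm_eta S) Ac i j k). Qed.
Lemma acm_phi2' x : O x -> phi x *m phi x = - 1%:M + xi x *m eta x.
Proof. by move=> Ox; apply: (acm_phi2 S Ac Ox). Qed.
Lemma acm_eta_xi' x : O x -> eta x *m xi x = 1%:M.
Proof. by move=> Ox; apply: (acm_eta_xi S Ac Ox). Qed.
Lemma acm_compat' x : O x -> (phi x)^T *m g x *m phi x = g x - (eta x)^T *m eta x.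
Proof. by move=> Ox; apply: (acm_compat S Ac Ox). Qed.
Lemma acm_gsym x : O x -> (g x)^T = g x.
Proof. by move=> Ox; exact: (rm_sym (acm_g S) Ac Ox). Qed.
Lemma acm_gpos x : O x -> forall v : 'cV[R]_n, v != 0 -> 0 < (v^T *m g x *m v) 0 0.
Proof. by move=> Ox v; exact: (rm_pos (acm_g S) Ac Ox). Qed.
Lemma acm_gunit x : O x -> g x \in unitmx.
Proof. by apply: (g_unit (O := O)) => y Oy; apply: acm_gpos. Qed.

Lemma acm_hE x : acm_h S c x = hten phi xi x.
Proof. by rewrite htenE. Qed.

Lemma acm_BE x : acm_B S c x = Bten phi xi x.
Proof. by rewrite /acm_B acm_hE. Qed.

Hypothesis AK : forall x, O x -> d1 eta x = 0 /\
    forall i j k, d2 (acm_Phi S c) x i j k =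
                  2 * wedge12 (eta x) (acm_Phi S c x) i j k.

Lemma acm_deta x : O x -> d1 eta x = 0.
Proof. by move=> /AK[]. Qed.
Lemma acm_dPhi x : O x -> forall i j k,
  d2 (fun y => g y *m phi y) x i j k = 2 * wedge12 (eta x) (g x *m phi x) i j k.
Proof. by move=> /AK[]. Qed.

Lemma acm_nabla_xi x : O x -> nab g xi x = Aten phi xi x.
Proof.
apply: (nabla_xi acm_oO acm_sphi acm_sg acm_sxi acm_seta acm_phi2' acm_eta_xi'
  acm_compat' acm_gsym acm_gpos acm_deta acm_dPhi).
Qed.

Lemma acm_sA : smoothm O (Aten phi xi).
Proof. exact: (smooth_Aten acm_oO acm_sphi acm_sxi). Qed.
Lemma acm_sB : smoothm O (Bten phi xi).
Proof. exact: (smooth_Bten acm_oO acm_sphi acm_sxi). Qed.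
Lemma acm_sh : smoothm O (hten phi xi).
Proof. exact: (smooth_hten acm_oO acm_sphi acm_sxi). Qed.

Lemma acm_curvature (X Y : 'rV[R]_n -> 'cV[R]_n) x : smoothm O X -> smoothm O Y ->
  O x -> curvature g X Y xi x = curv g (Aten phi xi) x (X x) (Y x).
Proof.
move=> sX sY Ox.
exact: (curvatureE acm_oO acm_gsym (acm_sA 1%N) (sX 1%N) (sY 1%N) acm_nabla_xi Ox).
Qed.

End AlmostContactInCharts.

(** * Curvature in a chart adapted to the structure *)

Section AdaptedChart.
Context {R : realType} {M : manifold R 3}.
Variable S : almost_contact_metric M.
Variable c : chart R 3 M.
Hypothesis Ac : atlas M c.

Local Notation phi := (acm_phi S c).
Local Notation g := (acm_g S c).
Local Notation xi := (acm_xi S c).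
Local Notation eta := (acm_eta S c).
Local Notation O := (img c).
Local Notation h := (hten phi xi).
Local Notation B := (Bten phi xi).
Local Notation A := (Aten phi xi).

Let oO : open O := @acm_oO R 3 M c.

Section ConstantXi.
Hypothesis Hxi : forall y, O y -> xi y = ddx R it.

Lemma adapted_dxi y : O y -> dv xi y = 0.
Proof.
move=> Oy; rewrite (dv_ext oO Oy Hxi); apply/matrixP => i j.
rewrite dvE [RHS]mxE; exact: (derive_cst (ddx R it i 0) y (delta_mx 0 j)).
Qed.

Lemma adapted_lie T y : O y -> lie_deriv11 xi T y = pd it T y.
Proof.
move=> Oy; rewrite lie_deriv11E adapted_dxi // mulmx0 mul0mx subr0 addr0.
by rewrite Hxi // dird_delta.
Qed.
End ConstantXi.

Variables (g0 h0 B0 : R -> 'M[R]_2) (ka mu : 'rV[R]_3 -> R).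
Hypothesis Hxi : forall y, O y -> xi y = ddx R it.
Hypothesis Heta : forall y, O y -> eta y = dx R it.
Hypothesis Hg : forall y, O y -> g y = bdiag (g0 (y 0 it)) 1.
Hypothesis HPhi : forall y, O y ->
  acm_Phi S c y = expR (2 * y 0 it) *: wedge11 (dx R ix1) (dx R ix2).
Hypothesis Hh : forall y, O y -> h y = bdiag (h0 (y 0 it)) 0.
Hypothesis HB : forall y, O y -> B y = bdiag (B0 (y 0 it)) 0.
Hypothesis HB2 : forall y, O y -> B0 (y 0 it) *m B0 (y 0 it) =
  (- (ka y + 1)) *: 1%:M.
Hypothesis dB : forall y, O y -> deriv_mx B0 (y 0 it) =
  mu y *: h0 (y 0 it) - 2 *: B0 (y 0 it).

Lemma adapted_AK y : O y -> d1 eta y = 0 /\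
    forall i j k, d2 (acm_Phi S c) y i j k =
                  2 * wedge12 (eta y) (acm_Phi S c y) i j k.
Proof.
move=> Oy; split.
  apply/matrixP => i j; rewrite !mxE.
  have E k l : partial k (fun z => eta z 0 l) y = 0.
    rewrite (partial_ext k oO Oy (g := fun=> dx R it 0 l)).
      by apply: derive_cst.
    by move=> z Oz; rewrite Heta.
  by rewrite !E subrr.
move=> i j k.
pose W : 'M[R]_3 := wedge11 (dx R ix1) (dx R ix2).
have dexp a : partial a (fun z : 'rV[R]_3 => expR (2 * z 0 it)) y =
    (it == a)%:R * (2 * expR (2 * y 0 it)).
  have d1 : is_derive y (delta_mx 0 a) (fun z : 'rV[R]_3 => 2 * z 0 it)
      (2 * (it == a)%:R).
    have := is_deriveZ (2 : R) (is_derive_coord y (delta_mx 0 a) it).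
    by rewrite mxE.
  have [_ H] := is_derive_comp1 d1 (is_derive_expR (2 * y 0 it)).
  by rewrite /partial H; ring.
have dP a b e : partial a (fun z => acm_Phi S c z b e) y =
    (it == a)%:R * (2 * expR (2 * y 0 it)) * W b e.
  rewrite (partial_ext a oO Oy (g := fun z => expR (2 * z 0 it) * W b e)).
    have kexp : Ck 1 O (fun z : 'rV[R]_3 => expR (2 * z 0 it)).
      by apply: Ck_expR => //; apply: CkM => //; [apply: Ck_cst|apply: Ck_coord].
    rewrite (partialM a kexp (Ck_cst 1 O (W b e)) Oy) dexp.
    by rewrite [X in _ + _ * X](derive_cst (W b e) y _) mulr0 addr0.
  by move=> z Oz; rewrite HPhi // mxE.
rewrite /d2 !dP /wedge12 Heta // HPhi //.
have dxE a : dx R it 0 a = (it == a)%:R by rewrite /dx mxE eqxx eq_sym.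
have PE a b : (expR (2 * y 0 it) *: W) a b = expR (2 * y 0 it) * W a b by rewrite mxE.
rewrite !dxE !PE; ring.
Qed.

Let AK := adapted_AK.

Lemma adapted_A y : O y -> A y = bdiag (1%:M - B0 (y 0 it)) 0.
Proof.
move=> Oy; rewrite (AtenE (acm_phi2' S Ac) Oy) HB // Hxi // Heta // ddx_dx.
by rewrite -[in LHS]bdiag1 !bdiagN !bdiagD !oppr0 !addr0 subrr.
Qed.

(** Along the leaves [t = const] neither [g] nor [A] varies; in the direction
    of [xi] the Lie derivative is the derivative with respect to [t]. *)
Lemma adapted_curv y v w : O y -> curv g A y v w =
  ka y *: ((eta y *m w) 0 0 *: v - (eta y *m v) 0 0 *: w) +
  mu y *: ((eta y *m w) 0 0 *: (h y *m v) - (eta y *m v) 0 0 *: (h y *m w)).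
Proof.
move=> Oy.
have it0 (z : 'cV[R]_3) : eta y *m z = 0 -> z it 0 = 0.
  by rewrite Heta // -dx_mul => ->; rewrite mxE.
have Rxi z : curv g A y z (xi y) =
    ka y *: (z - (eta y *m z) 0 0 *: xi y) + mu y *: (h y *m z).
  apply: (curv_xi_of_lieB oO (acm_sphi S Ac) (acm_sg S Ac) (acm_sxi S Ac)
    (acm_seta S Ac) (acm_phi2' S Ac) (acm_eta_xi' S Ac) (acm_compat' S Ac)
    (acm_gsym S Ac) (acm_gpos S Ac) (acm_deta AK) (acm_dPhi AK) Oy).
    rewrite adapted_lie // (_ : pd it B y = bdiag (deriv_mx B0 (y 0 it)) 0).
      by rewrite dB // Hh // HB // !bdiagZ bdiagN bdiagD !mulr0 oppr0 addr0.
    rewrite -(pd_bdiag B0 0) -!dird_delta; exact: (dird_ext _ oO Oy HB).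
  rewrite -(Bten_sq oO (acm_sphi S Ac) (acm_sxi S Ac) (acm_seta S Ac)
    (acm_phi2' S Ac) (acm_eta_xi' S Ac) (acm_deta AK) Oy).
  rewrite HB // bdiagM HB2 // mulr0 (acm_phi2' S Ac) // Hxi // Heta // ddx_dx.
  rewrite -bdiag1 bdiagN bdiagD addr0 addNr bdiagZ mulr0.
  by rewrite scalerN -scaleNr.
have eA := eta_A
    (acm_phi2' S Ac) (acm_eta_xi' S Ac) Oy.
have dg z : eta y *m z = 0 -> dird z g y = 0.
  by move=> /it0 z0; rewrite (dird_ext z oO Oy Hg) dird_bdiag z0 scale0r.
have dA z : eta y *m z = 0 -> dird z A y = 0.
  move=> /it0 z0; rewrite (dird_ext z oO Oy adapted_A).
  by rewrite (dird_bdiag (fun s => 1%:M - B0 s)) z0 scale0r.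
have hx := hten_xi oO (acm_sphi S Ac) (acm_sxi S Ac) (acm_seta S Ac)
    (acm_phi2' S Ac) (acm_eta_xi' S Ac) (acm_deta AK) Oy.
exact: (curv_full oO (acm_gsym S Ac) (acm_gunit S Ac) Oy (acm_eta_xi' S Ac Oy)
  eA (acm_nabla_xi Ac AK Oy) (adapted_dxi Hxi Oy) dg dA hx Rxi).
Qed.
End AdaptedChart.

(** * From adapted charts to the structure *)

Section ChangeOfChart.
Context {R : realType} {n : nat} {M : manifold R n}.
Variable S : almost_contact_metric M.
Variables c a : chart R n M.
Hypothesis Ac : atlas M c.
Hypothesis Aa : atlas M a.

Local Notation O := (overlap c a).
Local Notation Q := (overlap a c).
Local Notation F := (change c a).
Local Notation J := (jac F).

Let oO : open O := @overlap_open R n M c a.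
Let oQ : open Q := @overlap_open R n M a c.
Let sF : smoothm O F := smooth_change Ac Aa.
Let OQ x : O x -> Q (F x) := @change_overlap R n M c a x.
Let uJ x : O x -> J x \in unitmx := @jac_change_unit R n M c a x Ac Aa.

Lemma smoothm_sub p q (U V : set 'rV[R]_n) (T : 'rV[R]_n -> 'M[R]_(p, q)) :
  U `<=` V -> smoothm V T -> smoothm U T.
Proof. by move=> UV sT k; apply: Ckm_sub (sT k). Qed.

Let subO : O `<=` img c := @overlap_img R n M c a.
Let subQ : Q `<=` img a := @overlap_img R n M a c.

Lemma change_vf (X : vector_field M) x : O x -> X a (F x) = J x *m X c x.
Proof.
by move=> [q [cq aq] <-]; rewrite change_coord //; apply: (vf_law X Ac Aa cq aq).
Qed.

Lemma change_of (w : one_form M) x : O x -> w a (F x) *m J x = w c x.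
Proof.
by move=> [q [cq aq] <-]; rewrite change_coord //; apply: (of_law w Ac Aa cq aq).
Qed.

Lemma change_t11 (T : tensor11 M) x : O x -> T a (F x) *m J x = J x *m T c x.
Proof.
by move=> [q [cq aq] <-]; rewrite change_coord //; apply: (t11_law T Ac Aa cq aq).
Qed.

Lemma change_rm (g : riemannian_metric M) x : O x ->
  (J x)^T *m g a (F x) *m J x = g c x.
Proof.
by move=> [q [cq aq] <-]; rewrite change_coord //; apply: (rm_law g Ac Aa cq aq).
Qed.

Lemma change_Phi x : O x -> (J x)^T *m acm_Phi S a (F x) *m J x = acm_Phi S c x.
Proof.
move=> Ox; rewrite /acm_Phi -!mulmxA change_t11 // !mulmxA change_rm //.
Qed.

Lemma change_h x : O x ->
  hten (acm_phi S a) (acm_xi S a) (F x) *m J x =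
  J x *m hten (acm_phi S c) (acm_xi S c) x.
Proof.
move=> Ox; rewrite !htenE -scalemxAl -scalemxAr; congr (_ *: _).
apply: (related_lie oO oQ sF OQ
  (smoothm_sub subO (acm_sxi S Ac)) (smoothm_sub subQ (acm_sxi S Aa))
  (smoothm_sub subO (acm_sphi S Ac)) (smoothm_sub subQ (acm_sphi S Aa))
  _ _ Ox) => y Oy; [exact: change_vf|exact: change_t11].
Qed.

Lemma change_almost_kenmotsu x : O x ->
  d1 (acm_eta S c) x = 0 ->
  (forall i j k, d2 (acm_Phi S c) x i j k =
                 2 * wedge12 (acm_eta S c x) (acm_Phi S c x) i j k) ->
  d1 (acm_eta S a) (F x) = 0 /\
  forall i j k, d2 (acm_Phi S a) (F x) i j k =
                2 * wedge12 (acm_eta S a (F x)) (acm_Phi S a (F x)) i j k.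
Proof.
move=> Ox de dP; split.
  exact: (related_form_closed oO oQ sF OQ uJ (smoothm_sub subO (acm_seta S Ac))
    (smoothm_sub subQ (acm_seta S Aa)) (change_of (acm_eta S)) Ox de).
apply/d2_wedge_vec => u v w; move/d2_wedge_vec : dP.
move=> /(_ (invmx (J x) *m u) (invmx (J x) *m v) (invmx (J x) *m w)).
have sPc : smoothm O (acm_Phi S c).
  exact: (smoothm_sub subO (smoothmM (@acm_oO _ _ _ c) (acm_sg S Ac) (acm_sphi S Ac))).
have sPa : smoothm Q (acm_Phi S a).
  exact: (smoothm_sub subQ (smoothmM (@acm_oO _ _ _ a) (acm_sg S Aa) (acm_sphi S Aa))).
have skew y : Q y -> (acm_Phi S a y)^T = - acm_Phi S a y.
  move=> /subQ Qy; exact: (g_phi_skew (acm_phi2' S Aa Qy) (acm_eta_xi' S Aa Qy)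
    (acm_compat' S Aa Qy) (acm_gsym S Aa Qy)).
rewrite (related_d2v oO oQ sF OQ _ _ _ sPc sPa change_Phi skew Ox).
rewrite (related_wedge12v _ _ _ (change_of (acm_eta S) Ox) (change_Phi Ox)).
by rewrite !mulKVmx ?uJ.
Qed.

Hypothesis AKc : forall x, img c x -> d1 (acm_eta S c) x = 0 /\
    forall i j k, d2 (acm_Phi S c) x i j k =
                  2 * wedge12 (acm_eta S c x) (acm_Phi S c x) i j k.
Hypothesis AKa : forall x, img a x -> d1 (acm_eta S a) x = 0 /\
    forall i j k, d2 (acm_Phi S a) x i j k =
                  2 * wedge12 (acm_eta S a x) (acm_Phi S a x) i j k.

Lemma smooth_nabla_xi b (X : vector_field M) : atlas M b ->
  (forall x, img b x -> d1 (acm_eta S b) x = 0 /\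
    forall i j k, d2 (acm_Phi S b) x i j k =
                  2 * wedge12 (acm_eta S b x) (acm_Phi S b x) i j k) ->
  smoothm (img b) (levi_civita (acm_g S b) (X b) (acm_xi S b)).
Proof.
move=> Ab AK; have oI := @acm_oO _ _ _ b.
apply: (smoothm_ext oI (A := fun y => Aten (acm_phi S b) (acm_xi S b) y *m X b y)).
  by move=> y Iy; rewrite (levi_civita_nab oI (acm_gsym S Ab) _ _ Iy) (acm_nabla_xi Ab AK Iy).
apply: (smoothmM oI (acm_sA S Ab)) => k i j; exact: (vf_smooth X Ab i j k).
Qed.

(** The transformation of [nabla_X Y] is used twice, the second time for [Y =
    nabla_X xi], which is smooth because it is [A X] in each chart. *)
Lemma change_curvature (X Y : vector_field M) x : O x ->
  curvature (acm_g S a) (X a) (Y a) (acm_xi S a) (F x) =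
  J x *m curvature (acm_g S c) (X c) (Y c) (acm_xi S c) x.
Proof.
move=> Ox.
have sv (Z : vector_field M) b : atlas M b -> smoothm (img b) (Z b).
  by move=> Ab k i j; exact: (vf_smooth Z Ab i j k).
have LC (Z Z' : 'rV[R]_n -> 'cV[R]_n) W W' y :=
  related_levi_civita (X := Z) (X' := Z') (Y := W) (Y' := W') (x := y) oO oQ sF OQ uJ
  (smoothm_sub subO (acm_sg S Ac)) (smoothm_sub subQ (acm_sg S Aa))
  (fun z Oz => acm_gsym S Ac (subO Oz)) (fun z Qz => acm_gsym S Aa (subQ Qz))
  (fun z Oz => acm_gunit S Ac (subO Oz)) (fun z Qz => acm_gunit S Aa (subQ Qz))
  (change_rm (acm_g S)).
have sxc := smoothm_sub subO (acm_sxi S Ac).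
have sxa := smoothm_sub subQ (acm_sxi S Aa).
have LC1 (Z : vector_field M) y : O y ->
    levi_civita (acm_g S a) (Z a) (acm_xi S a) (F y) =
    J y *m levi_civita (acm_g S c) (Z c) (acm_xi S c) y.
  move=> Oy; exact: (LC _ _ _ _ y sxc sxa (change_vf Z Oy)
    (fun z Oz => change_vf (acm_xi S) Oz) Oy).
have LC2 (Z W : vector_field M) y : O y ->
    levi_civita (acm_g S a) (Z a) (levi_civita (acm_g S a) (W a) (acm_xi S a)) (F y) =
    J y *m levi_civita (acm_g S c) (Z c)
      (levi_civita (acm_g S c) (W c) (acm_xi S c)) y.
  move=> Oy; exact: (LC _ _ _ _ y (smoothm_sub subO (smooth_nabla_xi W Ac AKc))
    (smoothm_sub subQ (smooth_nabla_xi W Aa AKa)) (change_vf Z Oy) (LC1 W) Oy).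
have br : lie_bracket (X a) (Y a) (F x) = J x *m lie_bracket (X c) (Y c) x.
  apply: (related_bracket oO oQ sF OQ (smoothm_sub subO (sv X c Ac))
    (smoothm_sub subO (sv Y c Ac)) (smoothm_sub subQ (sv X a Aa))
    (smoothm_sub subQ (sv Y a Aa)) _ _ Ox) => y Oy; exact: change_vf.
rewrite /curvature (LC2 X Y x Ox) (LC2 Y X x Ox).
by rewrite (LC _ _ _ _ x sxc sxa br (fun z Oz => change_vf (acm_xi S) Oz) Ox) -!mulmxBr.
Qed.

End ChangeOfChart.

Section AdaptedToStructure.
Context {R : realType} {n : nat} {M : manifold R n}.
Variable S : almost_contact_metric M.
Variables (kappa mu : M -> R).
Hypothesis adapted : forall p : M, exists2 c, atlas M c & dom c p /\
  forall y, img c y ->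
    (d1 (acm_eta S c) y = 0 /\
     forall i j k, d2 (acm_Phi S c) y i j k =
                   2 * wedge12 (acm_eta S c y) (acm_Phi S c y) i j k) /\
    forall v w, curv (acm_g S c) (Aten (acm_phi S c) (acm_xi S c)) y v w =
      kappa (param c y) *: ((acm_eta S c y *m w) 0 0 *: v
                            - (acm_eta S c y *m v) 0 0 *: w) +
      mu (param c y) *: ((acm_eta S c y *m w) 0 0
                            *: (hten (acm_phi S c) (acm_xi S c) y *m v)
                         - (acm_eta S c y *m v) 0 0
                            *: (hten (acm_phi S c) (acm_xi S c) y *m w)).

Lemma adapted_almost_kenmotsu : almost_kenmotsu S.
Proof.
move=> a Aa _ [p ap <-]; have [c Ac [cp H]] := adapted p.
have [[de dP] _] := H _ (coord_img cp).
have := change_almost_kenmotsu Ac Aa (overlap_in cp ap) de dP.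
by rewrite change_coord.
Qed.

Lemma adapted_kappa_mu : kappa_mu_condition S kappa mu.
Proof.
move=> X Y a Aa _ [p ap <-]; have [c Ac [cp H]] := adapted p.
have AK b (Ab : atlas M b) := adapted_almost_kenmotsu Ab.
have Oc := overlap_in cp ap.
have sv (Z : vector_field M) : smoothm (img c) (Z c).
  by move=> k i j; exact: (vf_smooth Z Ac i j k).
have := change_curvature Ac Aa (AK c Ac) (AK a Aa) X Y Oc.
rewrite (acm_curvature Ac (AK c Ac) (sv X) (sv Y) (coord_img cp)).
have [_ ->] := H _ (coord_img cp); rewrite change_coord // => E.
have Ee := change_of Ac Aa (acm_eta S) Oc.
have Eh := change_h S Ac Aa Oc.
have EX := change_vf Ac Aa X Oc; have EY := change_vf Ac Aa Y Oc.
move: Ee Eh EX EY; rewrite !change_coord // => Ee Eh EX EY.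
rewrite /= E acm_hE EX EY !mulmxA Eh Ee !coordK //.
by rewrite !(mulmxDr, mulmxBr) -!scalemxAr !mulmxBr -!scalemxAr !mulmxA.

Qed.

End AdaptedToStructure.

Section Converse.
Context {R : realType} {M : manifold R 3}.
Variable S : almost_contact_metric M.
Variables (kappa mu : M -> R).

Lemma deriv_mxP (T : R -> 'M[R]_2) (t : R) (D : 'M[R]_2) :
  (forall i j, is_derive t 1 (fun s => T s i j) (D i j)) -> deriv_mx T t = D.
Proof. by move=> H; apply/matrixP => i j; rewrite mxE; have [_ ->] := H i j. Qed.

Definition adapted_at (c : chart R 3 M) (phi g h B : R -> 'M[R]_2) (m : R -> R)
    (q : M) : Prop :=
  let t := c q 0 it in
  let lambda := expR (- 2 * t) in
  [/\ kappa q = - 1 - expR (- 4 * t) /\ mu q = m t,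
      [/\ acm_phi S c (c q) = bdiag (phi t) 0,
          acm_xi S c (c q) = ddx R it,
          acm_eta S c (c q) = dx R it &
          acm_g S c (c q) = bdiag (g t) 1],
      acm_Phi S c (c q) = expR (2 * t) *: wedge11 (dx R ix1) (dx R ix2),
      [/\ acm_h S c (c q) = bdiag (h t) 0,
          acm_B S c (c q) = bdiag (B t) 0 &
          forall i j : 'I_2, \sum_(s < 2) B t i s * B t s j =
                             expR (- 4 * t) * (i == j)%:R] &
      forall i j : 'I_2,
        [/\ is_derive t 1 (fun s => phi s i j) (2 * h t i j),
            is_derive t 1 (fun s => h s i j)
              (2 * lambda ^+ 2 * phi t i j - 2 * h t i j - mu q * B t i j) &
            is_derive t 1 (fun s => B s i j) (mu q * h t i j - 2 * B t i j)]].

Lemma kappa_mu_of_adapted :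
  (forall p : M, exists2 c, atlas M c & dom c p /\
    exists phi g h B m, forall q, dom c q -> adapted_at c phi g h B m q) ->
  almost_kenmotsu S /\ kappa_mu_condition S kappa mu.
Proof.
move=> H; suff ad p : exists2 c, atlas M c & dom c p /\
  forall y, img c y ->
    (d1 (acm_eta S c) y = 0 /\
     forall i j k, d2 (acm_Phi S c) y i j k =
                   2 * wedge12 (acm_eta S c y) (acm_Phi S c y) i j k) /\
    forall v w, curv (acm_g S c) (Aten (acm_phi S c) (acm_xi S c)) y v w =
      kappa (param c y) *: ((acm_eta S c y *m w) 0 0 *: v
                            - (acm_eta S c y *m v) 0 0 *: w) +
      mu (param c y) *: ((acm_eta S c y *m w) 0 0
                            *: (hten (acm_phi S c) (acm_xi S c) y *m v)
                         - (acm_eta S c y *m v) 0 0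
                            *: (hten (acm_phi S c) (acm_xi S c) y *m w)).
  by split; [apply: adapted_almost_kenmotsu ad|apply: adapted_kappa_mu ad].
have [c Ac [cp [phi [g [h [B [m {}H]]]]]]] := H p.
exists c => //; split => //.
have P (P : 'rV[R]_3 -> Prop) : (forall q, dom c q -> P (c q)) ->
  forall y, img c y -> P y by move=> HP _ [q cq <-]; exact: HP.
have Hxi : forall y, img c y -> acm_xi S c y = ddx R it.
  by apply: P => q /H[_ [_ ->]].
have Heta : forall y, img c y -> acm_eta S c y = dx R it.
  by apply: P => q /H[_ [_ _ ->]].
have Hg : forall y, img c y -> acm_g S c y = bdiag (g (y 0 it)) 1.
  by apply: P => q /H[_ [_ _ _ ->]].
have HPhi : forall y, img c y -> acm_Phi S c y =
    expR (2 * y 0 it) *: wedge11 (dx R ix1) (dx R ix2).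
  by apply: P => q /H[_ _ ->].
have Hh : forall y, img c y ->
    hten (acm_phi S c) (acm_xi S c) y = bdiag (h (y 0 it)) 0.
  by apply: P => q /H[_ _ _ [<-]]; rewrite acm_hE.
have HB : forall y, img c y ->
    Bten (acm_phi S c) (acm_xi S c) y = bdiag (B (y 0 it)) 0.
  by apply: P => q /H[_ _ _ [_ <-]]; rewrite acm_BE.
have HB2 : forall y, img c y -> B (y 0 it) *m B (y 0 it) =
    (- (kappa (param c y) + 1)) *: 1%:M.
  apply: P => q cq; rewrite coordK //; have [[-> _] _ _ [_ _ H2] _] := H q cq.
  apply/matrixP => i j; rewrite mxE H2 !mxE -mulr_natr.
  by rewrite -[1 *+ _]mulr_natl mulr1; congr (_ * _); ring.
have dB : forall y, img c y -> deriv_mx B (y 0 it) =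
    mu (param c y) *: h (y 0 it) - 2 *: B (y 0 it).
  apply: P => q cq; rewrite coordK //; have [_ _ _ _ HD] := H q cq.
  apply: deriv_mxP => i j; have [_ _] := HD i j.
  by rewrite !mxE.
move=> y Oy; split; first exact: (adapted_AK Heta HPhi Oy).
move=> v w.
exact: (adapted_curv Ac Hxi Heta Hg HPhi Hh HB HB2 dB v w Oy).
Qed.

End Converse.

(** * The coordinate t *)

Lemma unitmx_ker {R : fieldType} {n : nat} (K : 'M[R]_n) :
  (forall z : 'cV[R]_n, K *m z = 0 -> z = 0) -> K \in unitmx.
Proof.
move=> H; rewrite -unitmx_tr -row_free_unit -kermx_eq0; apply/eqP/row_matrixP => i.
rewrite row0; apply: trmx_inj; rewrite trmx0; apply: H.
apply: trmx_inj; rewrite trmx_mul trmxK trmx0.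
by apply/sub_kermxP; apply: row_sub.
Qed.

Section KappaMu.
Context {R : realType} {n : nat} {M : manifold R n}.
Variable S : almost_contact_metric M.
Variables (kappa mu : M -> R).
Hypothesis h_neq0 : forall c, atlas M c -> forall x, img c x -> acm_h S c x <> 0.
Hypothesis kappa_smooth : smooth_fun kappa.
Hypothesis dkappa_eta : forall c, atlas M c -> forall x, img c x ->
  wedge11 (d0 (fun y => kappa (param c y)) x) (acm_eta S c x) = 0.
Hypothesis AK : almost_kenmotsu S.
Hypothesis KM : kappa_mu_condition S kappa mu.

Section InChart.
Variable c : chart R n M.
Hypothesis Ac : atlas M c.

Local Notation phi := (acm_phi S c).
Local Notation g := (acm_g S c).
Local Notation xi := (acm_xi S c).
Local Notation eta := (acm_eta S c).
Local Notation O := (img c).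
Local Notation h := (hten phi xi).
Local Notation B := (Bten phi xi).
Local Notation A := (Aten phi xi).
Local Notation ka := (fun y => kappa (param c y)).
Local Notation m := (fun y => mu (param c y)).

Let oO : open O := @acm_oO R n M c.

(** The condition speaks of globally defined fields, which take all values at
    a given point. *)
Lemma kappa_mu_curv y v w : O y -> curv g A y v w =
  ka y *: ((eta y *m w) 0 0 *: v - (eta y *m v) 0 0 *: w) +
  m y *: ((eta y *m w) 0 0 *: (h y *m v) - (eta y *m v) 0 0 *: (h y *m w)).
Proof.
move=> Oy; have [q cq Eq] := Oy; rewrite -Eq.
have [X Xv] := global_field v Ac cq; have [Y Yw] := global_field w Ac cq.
have sv (Z : vector_field M) : smoothm O (Z c).
  by move=> k i j; exact: (vf_smooth Z Ac i j k).
have := KM X Y Ac (coord_img cq).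
rewrite (acm_curvature Ac (AK Ac) (sv X) (sv Y) (coord_img cq)) Xv Yw /=.
by rewrite !acm_hE Xv Yw => ->.
Qed.

Lemma kappa_mu_Rxi y : O y -> forall v, curv g A y v (xi y) =
  ka y *: (v - (eta y *m v) 0 0 *: xi y) + m y *: (h y *m v).
Proof.
move=> Oy v; rewrite kappa_mu_curv // (acm_eta_xi S Ac Oy).
rewrite (hten_xi oO (acm_sphi S Ac) (acm_sxi S Ac) (acm_seta S Ac)
  (acm_phi2' S Ac) (acm_eta_xi' S Ac) (acm_deta (AK Ac)) Oy).
by rewrite scaler0 subr0 mxE eqxx !scale1r.
Qed.

Lemma hten_neq0 y : O y -> h y <> 0.
Proof. by move=> Oy; rewrite -acm_hE; apply: h_neq0. Qed.

Let dP := acm_dPhi (AK Ac).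
Let de := acm_deta (AK Ac).
Let sphi := acm_sphi S Ac.
Let sg := acm_sg S Ac.
Let sxi := acm_sxi S Ac.
Let seta := acm_seta S Ac.
Let phi2' := acm_phi2' S Ac.
Let eta_xi' := acm_eta_xi' S Ac.
Let compat' := acm_compat' S Ac.
Let gsym' := acm_gsym S Ac.
Let gpos' := acm_gpos S Ac.

Lemma acm_kappa_lt y : O y -> ka y < - 1.
Proof.
move=> Oy; exact: (kappa_lt oO sphi sg sxi seta phi2' eta_xi' compat' gsym' gpos' de dP
  (ka := ka) (mu := m) kappa_mu_Rxi Oy (hten_neq0 Oy)).
Qed.

(** Contract [d kappa /\ eta = 0] with [xi]. *)
Lemma acm_dkappa y : O y -> d0 ka y = (- 4 * (ka y + 1)) *: eta y.
Proof.
move=> Oy; have := dkappa_xi oO sphi sg sxi seta phi2' eta_xi' compat' gsym' gpos' de dP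
  (ka := ka) (mu := m) kappa_mu_Rxi (kappa_smooth Ac) Oy (hten_neq0 Oy).
move=> <-; apply/rowP => i; rewrite [RHS]mxE [X in X * _]mxE mulr_suml.
have /matrixP/(_ 0 0) := eta_xi' Oy; rewrite !mxE eqxx mulr1n => e1.
rewrite -[LHS]mulr1 -e1 mulr_sumr; apply: eq_bigr => j _.
have /matrixP/(_ i j) := dkappa_eta Ac Oy; rewrite !mxE => /eqP.
rewrite subr_eq0 => /eqP E.
by rewrite mulrA E mulrAC.
Qed.

(** The solution of [kappa = - 1 - expR (- 4 * t)] for [t]. *)
Definition time (y : 'rV[R]_n) : R := - 4^-1 * ln (- 1 - ka y).

Lemma smooth_time : smooth_on O time.
Proof.
move=> k; apply: CkM => //; first exact: Ck_cst.
apply: Ck_ln => // [x Ox|]; first by have := acm_kappa_lt Ox; lra.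
by apply: CkB => //; [apply: Ck_cst|apply: kappa_smooth].
Qed.

Lemma kappa_time y : O y -> ka y = - 1 - expR (- 4 * time y).
Proof.
move=> Oy; have k0 : 0 < - 1 - ka y by have := acm_kappa_lt Oy; lra.
rewrite /time mulrA mulrNN divff ?pnatr_eq0 // mul1r lnK ?posrE //; ring.
Qed.

Lemma d0_time y : O y -> d0 time y = eta y.
Proof.
move=> Oy; have k0 : 0 < - 1 - ka y by have := acm_kappa_lt Oy; lra.
apply/rowP => i; rewrite mxE.
have k1 : Ck 1 O (fun y => - 1 - ka y).
  exact: (CkB (Ck_cst 1 O (- 1)) (kappa_smooth Ac 1%N) oO).
have kl : Ck 1 O (fun y => ln (- 1 - ka y)).
  apply: Ck_ln => // x Ox; have := acm_kappa_lt Ox; lra.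
rewrite /time (partialM i (Ck_cst 1 O (- 4^-1)) kl Oy).
rewrite [X in X * _](derive_cst (- 4^-1 : R) y (delta_mx 0 i)) mul0r add0r.
have dk := is_derive_comp1 (Ck_is_derive i k1 Oy) (is_derive1_ln k0).
rewrite [X in _ * X](_ : _ = (- 1 - ka y)^-1 *
    partial i (fun y => - 1 - ka y) y); last by have [_] := dk.
rewrite (partialD i (Ck_cst 1 O (- 1)) (CkN (kappa_smooth Ac 1%N) oO) Oy).
have -> : partial i (fun=> - 1) y = 0 :> R by exact: derive_cst.
rewrite add0r.
have /rowP/(_ i) := d0N (kappa_smooth Ac) Oy; rewrite mxE => ->.
rewrite acm_dkappa // !mxE; field.
by rewrite gt_eqF //; move: k0; rewrite -opprD.
Qed.

End InChart.

(** [time] has differential [eta], which is not zero; together with all the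
    coordinates of a given chart but one, it therefore makes a new chart. *)
Lemma time_chart (i0 : 'I_n) p : exists2 b, atlas M b &
  [/\ dom b p,
      forall y, img b y -> acm_eta S b y = delta_mx 0 i0 &
      forall y, img b y -> kappa (param b y) = - 1 - expR (- 4 * y 0 i0)].
Proof.
have [a Aa ap] := atlas_cover p; have pI := coord_img ap.
have [k ek] : exists k, acm_eta S a (a p) 0 k != 0.
  apply: contrapT => nk; have := acm_eta_xi S Aa pI.
  rewrite (_ : acm_eta S a (a p) = 0).
    by rewrite mul0mx => /matrixP/(_ 0 0); rewrite !mxE => /esym/eqP; rewrite oner_eq0.
  apply/rowP => k; rewrite [RHS]mxE; apply/eqP/negPn/negP => ek; apply: nk; by exists k.
pose F (x : 'rV[R]_n) : 'rV[R]_n :=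
  \row_i (if i == i0 then time a x else x 0 (tperm k i0 i)).
have sF : smoothm (img a) F.
  move=> l i j; apply: (Ck_ext (@acm_oO _ _ _ a)
     (f := fun x => if j == i0 then time a x else x 0 (tperm k i0 j))).
    by move=> y _; rewrite mxE.
  case: (j == i0); first exact: (smooth_time Aa).
  by apply: Ck_coord; exact: acm_oO.
have jF x i j : img a x -> jac F x i j =
    if i == i0 then acm_eta S a x 0 j else (tperm k i0 i == j)%:R.
  move=> Ix; rewrite mxE.
  rewrite (_ : (fun y => F y 0 i) =
     (fun y => if i == i0 then time a y else y 0 (tperm k i0 i))).
    case: (i == i0); last by rewrite partial_coord.
    by rewrite -(d0_time Aa Ix) mxE.
  by apply/funext => y; rewrite mxE.
have uF : jac F (a p) \in unitmx.
  apply: unitmx_ker => z /colP Kz.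
  have zj j : j != k -> z j 0 = 0.
    move=> jk; have := Kz (tperm k i0 j); rewrite !mxE.
    under eq_bigr do rewrite jF // tpermK.
    have -> : (tperm k i0 j == i0) = false.
      by rewrite -[i0 in X in _ == X](tpermL k) (inj_eq perm_inj) (negPf jk).
    rewrite (bigD1 j) //= eqxx mul1r big1 ?addr0 // => l /negPf lj.
    by rewrite eq_sym lj mul0r.
  apply/colP => j; rewrite [RHS]mxE; have [->|] := eqVneq j k; last exact: zj.
  have := Kz i0; rewrite !mxE (bigD1 k) //= jF // eqxx big1 ?addr0.
    by move/eqP; rewrite mulf_eq0 (negPf ek) => /eqP.
  by move=> l lk; rewrite zj // mulr0.
have [b Ab [bp Hb Jb]] := new_chart Aa ap (@acm_oO _ _ _ a) pI
  (fun x => id) sF uF.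
exists b => //; split => //.
- move=> _ [q bq <-]; have [aq _ _] := Hb q bq.
  have oab := overlap_in aq bq.
  have uJ := jac_change_unit Aa Ab oab.
  have := change_of Aa Ab (acm_eta S) oab; rewrite change_coord // => E.
  apply: (can_inj (mulmxK uJ)); rewrite E Jb //.
  by apply/rowP => j; rewrite -rowE mxE jF ?eqxx //; apply: coord_img.
- move=> _ [q bq <-]; have [aq _ Fq] := Hb q bq.
  rewrite coordK // -[in LHS](coordK aq) (kappa_time Aa (coord_img aq)).
  by rewrite Fq mxE eqxx.
Qed.

End KappaMu.

(** * A unit eigenvector field *)

Section TimeChart.
Context {R : realType} {n : nat} {M : manifold R n}.
Variable S : almost_contact_metric M.
Variables (kappa mu : M -> R).
Hypothesis h_neq0 : forall c, atlas M c -> forall x, img c x -> acm_h S c x <> 0.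
Hypothesis AK : almost_kenmotsu S.
Hypothesis KM : kappa_mu_condition S kappa mu.
Variable b : chart R n M.
Hypothesis Ab : atlas M b.
Variable i0 : 'I_n.

Local Notation phi := (acm_phi S b).
Local Notation g := (acm_g S b).
Local Notation xi := (acm_xi S b).
Local Notation eta := (acm_eta S b).
Local Notation O := (img b).
Local Notation h := (hten phi xi).
Local Notation B := (Bten phi xi).
Local Notation A := (Aten phi xi).
Local Notation ka := (fun y => kappa (param b y)).
Local Notation m := (fun y => mu (param b y)).
Local Notation lam := (fun y : 'rV[R]_n => expR (- 2 * y 0 i0)).

Hypothesis Eeta : forall y, O y -> eta y = delta_mx 0 i0.
Hypothesis Eka : forall y, O y -> ka y = - 1 - expR (- 4 * y 0 i0).

Let oO : open O := @acm_oO R n M b.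
Let de := acm_deta (AK Ab).
Let sphi := acm_sphi S Ab.
Let sg := acm_sg S Ab.
Let sxi := acm_sxi S Ab.
Let seta := acm_seta S Ab.
Let phi2' := acm_phi2' S Ab.
Let eta_xi' := acm_eta_xi' S Ab.
Let compat' := acm_compat' S Ab.
Let gsym' := acm_gsym S Ab.
Let gpos' := acm_gpos S Ab.
Let sB := acm_sB S Ab.

Lemma acm_phi3 y : O y -> phi y *m phi y *m phi y = - phi y.
Proof. by move=> Oy; exact: (phi3 (phi2' Oy) (eta_xi' Oy)). Qed.

Lemma acm_eta_phi y : O y -> eta y *m phi y = 0.
Proof. by move=> Oy; exact: (eta_phi (phi2' Oy) (eta_xi' Oy)). Qed.

Lemma acm_phi_xi y : O y -> phi y *m xi y = 0.
Proof. by move=> Oy; exact: (phi_xi (phi2' Oy) (eta_xi' Oy)). Qed.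

Lemma acm_g_xi y : O y -> g y *m xi y = (eta y)^T.
Proof. by move=> Oy; exact: (g_xi (phi2' Oy) (eta_xi' Oy) (compat' Oy)). Qed.

Lemma acm_hphi y : O y -> h y *m phi y = - (phi y *m h y).
Proof. by move=> Oy; exact: (hphi oO sphi sxi seta phi2' eta_xi' de Oy). Qed.

Lemma acm_etah y : O y -> eta y *m h y = 0.
Proof. by move=> Oy; exact: (etah oO sphi sxi seta phi2' eta_xi' de Oy). Qed.

Lemma acm_eta_B y : O y -> eta y *m B y = 0.
Proof. by move=> Oy; rewrite /Bten mulmxA acm_eta_phi // mul0mx. Qed.

Lemma acm_B_phi y : O y -> B y *m phi y = h y.
Proof. by move=> Oy; exact: (B_phi (phi2' Oy) (acm_hphi Oy) (acm_etah Oy)). Qed.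

Lemma acm_B_phi_anti y : O y -> B y *m phi y = - (phi y *m B y).
Proof.
move=> Oy; rewrite acm_B_phi // /Bten.
by rewrite (phi_B (phi2' Oy) (acm_etah Oy)) opprK.
Qed.

Lemma acm_B_phi2 y : O y -> B y *m (phi y *m phi y) = - B y.
Proof. by move=> Oy; rewrite mulmxA acm_B_phi // acm_hphi. Qed.

Lemma acm_B2 y : O y -> B y *m B y = - lam y ^+ 2 *: (phi y *m phi y).
Proof.
move=> Oy; rewrite (Bten2 oO sphi sg sxi seta phi2' eta_xi' compat' gsym' gpos'
  de (acm_dPhi (AK Ab)) (ka := ka) (mu := m) (kappa_mu_Rxi AK KM Ab) Oy) Eka //.
congr (_ *: _); rewrite -expRM_natl addrAC addNr add0r; congr (- expR _); ring.
Qed.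

(** [lam phi^2 - B = (B + lam) phi^2] takes values in the eigenspace of [B] for
    [lam], because [B^2 = - lam^2 phi^2]. *)
Definition eigenproj y : 'M[R]_n := lam y *: (phi y *m phi y) - B y.

Lemma eigenproj_neq0 y : O y -> exists w : 'cV[R]_n, eigenproj y *m w != 0.
Proof.
move=> Oy; apply: contrapT => nw.
have E : eigenproj y = 0.
  apply: mulmx_eq => w; rewrite mul0mx; apply/eqP/negPn/negP => w0.
  by apply: nw; exists w.
have BE : B y = lam y *: (phi y *m phi y).
  by move/eqP: E; rewrite subr_eq0 => /eqP.
have l0 : lam y != 0 by rewrite gt_eqF // expR_gt0.
have := acm_B_phi_anti Oy; rewrite BE -scalemxAl -scalemxAr mulmxA acm_phi3 //.
rewrite scalerN opprK => /eqP; rewrite -subr_eq0 -opprD oppr_eq0 -mulr2n.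
rewrite -scaler_nat scaler_eq0 pnatr_eq0 /= scaler_eq0 (negPf l0) => /eqP phi0.
apply: (hten_neq0 h_neq0 Ab Oy).
have := phi2_h (phi2' Oy) (acm_etah Oy).
by rewrite phi0 !mul0mx => /esym/eqP; rewrite oppr_eq0 => /eqP.
Qed.

Lemma B_eigenproj y : O y -> B y *m eigenproj y = lam y *: eigenproj y.
Proof.
move=> Oy; rewrite /eigenproj mulmxBr -scalemxAr acm_B_phi2 // acm_B2 //.
move: (phi y *m phi y) (B y) => p q.
by apply/matrixP => i j; rewrite !mxE; ring.
Qed.

Lemma eta_eigenproj y : O y -> eta y *m eigenproj y = 0.
Proof.
move=> Oy; rewrite mulmxBr -scalemxAr mulmxA acm_eta_phi // mul0mx scaler0.
by rewrite acm_eta_B // subrr.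
Qed.

Lemma smooth_lam : smooth_on O lam.
Proof.
move=> k; apply: (Ck_expR oO).
exact: (CkM (Ck_cst k O (- 2)) (Ck_coord k i0 oO) oO).
Qed.

Lemma smooth_eigenproj : smoothm O eigenproj.
Proof.
exact: (smoothmB oO (smoothmZ oO smooth_lam (smoothmM oO sphi sphi)) sB).
Qed.

(** A fixed vector [w] on which the projection does not vanish at [y0] gives an
    eigenvector field near [y0], to be divided by its length. *)
Lemma unit_eigenfield y0 : O y0 -> exists r (u : 'rV[R]_n -> 'cV[R]_n),
  [/\ 0 < r, box y0 r `<=` O, smoothm (box y0 r) u &
   forall y, box y0 r y -> [/\ B y *m u y = lam y *: u y, eta y *m u y = 0 &
     bil (g y) (u y) (u y) = 1]].
Proof.
move=> Oy0; have [w w0] := eigenproj_neq0 Oy0.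
pose u0 y := eigenproj y *m w; pose N y := bil (g y) (u0 y) (u0 y).
have su0 : smoothm O u0 by exact: (smoothmM oO smooth_eigenproj (smoothm_cst O w)).
have sN : smooth_on O N by exact: (smooth_bil oO sg su0 su0).
have [r r0 rO] := open_box (open_nonzero oO (sN 0%N)) (x := y0)
  (conj Oy0 (lt0r_neq0 (gpos' Oy0 w0))).
have sub : box y0 r `<=` O by move=> y /rO[].
have N0 y : box y0 r y -> 0 < N y.
  move=> /rO[Oy Ny]; apply: gpos' => //; apply: contraNneq Ny => /= u00.
  by rewrite (_ : N y = 0) ?eqxx // /N (u00 : u0 y = 0) bil0r.
have oX := @box_open R n y0 r.
pose f y := expR (- 2^-1 * ln (N y)).
have sf : smooth_on (box y0 r) f.
  move=> k; apply: (Ck_expR oX); apply: (CkM (Ck_cst k _ (- 2^-1)) _ oX).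
  exact: (Ck_ln oX N0 (Ck_sub sub (sN k))).
exists r, (fun y => f y *: u0 y); split => //.
  exact: (smoothmZ oX sf (smoothm_sub sub su0)).
move=> y yr; have Oy := sub y yr; split.
- rewrite -scalemxAr /u0 mulmxA B_eigenproj // -scalemxAl.
  by rewrite !scalerA mulrC.
- by rewrite -scalemxAr /u0 mulmxA eta_eigenproj // mul0mx scaler0.
- have -> : bil (g y) (f y *: u0 y) (f y *: u0 y) = f y * f y * N y.
    by rewrite -[in LHS](gsym' Oy) bilZr bil_tr bilZr mulrA.
  rewrite -expRD -mulrDl.
  have -> : - 2^-1 + - 2^-1 = -1 :> R by field.
  rewrite mulN1r expRN lnK ?mulVf ?gt_eqF ?posrE //; exact: N0.
Qed.

End TimeChart.

(** * The orthonormal frame of an almost Kenmotsu structure *)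

Lemma I3P (i : 'I_3) : [\/ i = ix1, i = ix2 | i = it].
Proof.
case: i => -[|[|[|//]]] ?; [apply: Or31|apply: Or32|apply: Or33]; exact: val_inj.
Qed.

Section EigenFrame.
Context {R : realType} {M : manifold R 3}.
Variable S : almost_contact_metric M.
Variables (kappa mu : M -> R).
Hypothesis mu_smooth : smooth_fun mu.
Hypothesis AK : almost_kenmotsu S.
Hypothesis KM : kappa_mu_condition S kappa mu.
Variable b : chart R 3 M.
Hypothesis Ab : atlas M b.

Local Notation phi := (acm_phi S b).
Local Notation g := (acm_g S b).
Local Notation xi := (acm_xi S b).
Local Notation eta := (acm_eta S b).
Local Notation h := (hten phi xi).
Local Notation B := (Bten phi xi).
Local Notation A := (Aten phi xi).
Local Notation m := (fun y => mu (param b y)).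
Local Notation lam := (fun y : 'rV[R]_3 => expR (- 2 * y 0 it)).

Hypothesis Eeta : forall y, img b y -> eta y = dx R it.

Variables (X : set 'rV[R]_3) (u : 'rV[R]_3 -> 'cV[R]_3).
Hypothesis oX : open X.
Hypothesis XO : X `<=` img b.
Hypothesis su : smoothm X u.
Hypothesis Hu : forall y, X y -> [/\ B y *m u y = lam y *: u y,
  eta y *m u y = 0 & bil (g y) (u y) (u y) = 1].

Definition framev y := phi y *m u y.
Local Notation v := framev.

Let Bu y (Xy : X y) : B y *m u y = lam y *: u y. Proof. by have [] := Hu Xy. Qed.
Let etau y (Xy : X y) : eta y *m u y = 0. Proof. by have [] := Hu Xy. Qed.
Let guu y (Xy : X y) : bil (g y) (u y) (u y) = 1. Proof. by have [] := Hu Xy. Qed.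

Let gsym' y (Xy : X y) := acm_gsym S Ab (XO Xy).
Let gunit' y (Xy : X y) := acm_gunit S Ab (XO Xy).
Let eta_xi' y (Xy : X y) := acm_eta_xi' S Ab (XO Xy).
Let phi2' y (Xy : X y) := acm_phi2' S Ab (XO Xy).
Let compat' y (Xy : X y) := acm_compat' S Ab (XO Xy).

Lemma phi_framev y : X y -> phi y *m v y = - u y.
Proof.
move=> Xy; rewrite /v mulmxA phi2' // mulmxDl mulNmx mul1mx -mulmxA etau //.
by rewrite mulmx0 addr0.
Qed.
Let phiv := phi_framev.

Let etav y (Xy : X y) : eta y *m v y = 0.
Proof. by rewrite /v mulmxA (acm_eta_phi S Ab (XO Xy)) mul0mx. Qed.

Let Bv y (Xy : X y) : B y *m v y = - lam y *: v y.
Proof.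
rewrite /v mulmxA (acm_B_phi_anti AK Ab (XO Xy)) mulNmx -mulmxA Bu //.
by rewrite -scalemxAr scaleNr.
Qed.

Let hu y (Xy : X y) : h y *m u y = - lam y *: v y.
Proof. by rewrite -(acm_B_phi AK Ab (XO Xy)) -mulmxA Bv. Qed.

Let Au y (Xy : X y) : A y *m u y = (1 - lam y) *: u y.
Proof.
rewrite /Aten mulmxBl mulNmx -mulmxA -/(v y) phiv // opprK Bu //.
by rewrite scalerBl scale1r.
Qed.

Let Av y (Xy : X y) : A y *m v y = (1 + lam y) *: v y.
Proof.
rewrite /Aten mulmxBl mulNmx -mulmxA phiv // mulmxN opprK Bv //.
by rewrite scalerDl scale1r scaleNr opprK.
Qed.

Let gvv y (Xy : X y) : bil (g y) (v y) (v y) = 1.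
Proof.
rewrite /v -bilMl -bilMr compat' // -[g y]scale1r -scaleN1r addrC.
rewrite bil_linm scale1r guu // -[eta y]/(eta y) /bil.
by rewrite -!mulmxA etau // !mulmx0 mxE mulr0 add0r.
Qed.

Let guv y (Xy : X y) : bil (g y) (u y) (v y) = 0.
Proof.
have : bil (g y) (u y) (v y) = - bil (g y) (u y) (v y).
  rewrite {1}/v -bilMr -[in LHS]bil_tr.
  rewrite (g_phi_skew (phi2' Xy) (eta_xi' Xy) (compat' Xy) (gsym' Xy)).
  by rewrite /bil mulmxN mulNmx mxE -/(bil _ _ _) bilMr.
by move/eqP; rewrite -addr_eq0 -mulr2n mulrn_eq0 /= => /eqP.
Qed.

Definition frame y : 'M[R]_3 :=
  \matrix_(i, j) (if j == ix1 then u y else if j == ix2 then v y else xi y) i 0.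

Lemma frame1 y : frame y *m delta_mx ix1 0 = u y.
Proof. by apply/colP => i; rewrite -colE !mxE. Qed.

Lemma frame2 y : frame y *m delta_mx ix2 0 = v y.
Proof. by apply/colP => i; rewrite -colE !mxE. Qed.

Lemma frame3 y : frame y *m ddx R it = xi y.
Proof. by apply/colP => i; rewrite -colE !mxE. Qed.

Lemma cV3E (z : 'cV[R]_3) : z =
  z ix1 0 *: delta_mx ix1 0 + z ix2 0 *: delta_mx ix2 0 + z it 0 *: ddx R it.
Proof.
apply/colP => i; rewrite !mxE.
have [] := I3P i => ->; rewrite !eqxx /= !mulr1 !mulr0.
- by rewrite !addr0.
- by rewrite addr0 add0r.
- by rewrite !add0r.
Qed.

Lemma frame_orthonormal y : X y -> (frame y)^T *m g y *m frame y = 1%:M.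
Proof.
move=> Xy.
have gxi z : bil (g y) (xi y) z = (eta y *m z) 0 0.
  rewrite -[in LHS](gsym' Xy) bil_tr /bil -mulmxA (acm_g_xi S Ab (XO Xy)).
  by rewrite -trmx_mul mxE.
have gC p q : bil (g y) p q = bil (g y) q p by rewrite -[in LHS](gsym' Xy) bil_tr.
have E (i j : 'I_3) : ((frame y)^T *m g y *m frame y) i j =
    bil (g y) (frame y *m delta_mx i 0) (frame y *m delta_mx j 0).
  by rewrite -bilMr -bilMl bil_delta mulmxA.
have exx := congr1 (fun A : 'M[R]_1 => A 0 0) (eta_xi' Xy).
rewrite /= [X in _ = X]mxE eqxx mulr1n in exx.
apply/matrixP => i j; rewrite E [RHS]mxE.
have [] := I3P i => ->; have [] := I3P j => ->;
  rewrite ?(frame1, frame2, frame3) ?guu // ?gvv // ?guv //.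
- by rewrite gC gxi etau // mxE.
- by rewrite gC guv.
- by rewrite gC gxi etav // mxE.
- by rewrite gxi etau // mxE.
- by rewrite gxi etav // mxE.
- by rewrite gxi exx.
Qed.

(** [E^T g E = 1] says that [E^T g] is inverse to [E]. *)
Lemma frame_span y : X y -> forall w, w = bil (g y) (u y) w *: u y
  + bil (g y) (v y) w *: v y + (eta y *m w) 0 0 *: xi y.
Proof.
move=> Xy w; have := frame_orthonormal Xy => /mulmx1C EE.
rewrite -[LHS]mul1mx -EE -mulmxA [X in _ *m X]cV3E !mulmxDr -!scalemxAr.
rewrite frame1 frame2 frame3; congr (_ *: _ + _ *: _ + _ *: _).
- by rewrite -(frame1 y) /bil trmx_mul trmx_delta -!mulmxA -rowE [RHS]mxE.
- by rewrite -(frame2 y) /bil trmx_mul trmx_delta -!mulmxA -rowE [RHS]mxE.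
- rewrite -[eta y in RHS]trmxK -(acm_g_xi S Ab (XO Xy)) trmx_mul gsym' //.
  by rewrite -(frame3 y) trmx_mul trmx_delta -!mulmxA -rowE [RHS]mxE.
Qed.

Let sphi := smoothm_sub XO (acm_sphi S Ab).
Let sg := smoothm_sub XO (acm_sg S Ab).
Let sxi := smoothm_sub XO (acm_sxi S Ab).
Let seta := smoothm_sub XO (acm_seta S Ab).
Let sA := smoothm_sub XO (acm_sA S Ab).
Let sB := smoothm_sub XO (acm_sB S Ab).
Let de y (Xy : X y) := acm_deta (AK Ab) (XO Xy).
Let nxi y (Xy : X y) := acm_nabla_xi Ab (AK Ab) (XO Xy).
Let sv : smoothm X v := smoothmM oX sphi su.

Let slam : smooth_on X lam.
Proof. by move=> k; apply: Ck_sub XO (smooth_lam b it k). Qed.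

Let smu : smooth_on X m.
Proof. by move=> k; apply: Ck_sub XO (mu_smooth Ab k). Qed.

Let lam_gt0 y (_ : X y) : 0 < lam y := expR_gt0 (- 2 * y 0 it).

Lemma partial_lam y i : partial i lam y = - 2 * lam y * (it == i)%:R.
Proof.
have d1 : is_derive y (delta_mx 0 i) (fun z : 'rV[R]_3 => - 2 * z 0 it)
    (- 2 * (it == i)%:R).
  have := is_deriveZ (- 2 : R) (is_derive_coord y (delta_mx 0 i) it).
  by rewrite mxE.
have [_ H] := is_derive_comp1 d1 (is_derive_expR (- 2 * y 0 it)).
by rewrite /partial H; ring.
Qed.

Let dlam y (Xy : X y) : d0 lam y = (- 2 * lam y) *: eta y.
Proof.
apply/rowP => i; rewrite mxE partial_lam [RHS]mxE (Eeta (XO Xy)) /dx mxE.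
by rewrite [i == it]eq_sym.
Qed.

Let lieB y (Xy : X y) : lie_deriv11 xi B y = m y *: h y - 2 *: B y.
Proof.
exact: (lie_B (@acm_oO R 3 M b) (acm_sphi S Ab) (acm_sg S Ab) (acm_sxi S Ab)
  (acm_seta S Ab) (acm_phi2' S Ab) (acm_eta_xi' S Ab) (acm_compat' S Ab)
  (acm_gsym S Ab) (acm_gpos S Ab) (acm_deta (AK Ab)) (acm_dPhi (AK Ab))
  (mu := m) (kappa_mu_Rxi AK KM Ab) (XO Xy)).
Qed.

Let curv_uv y (Xy : X y) : curv g A y (u y) (v y) = 0.
Proof.
rewrite (kappa_mu_curv AK KM Ab _ _ (XO Xy)) etau // etav //.
by rewrite mxE !scale0r !subrr !scaler0 addr0.
Qed.

Lemma frame_xi_u y : X y ->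
  lie_bracket xi u y = (lam y - 1) *: u y + (- (m y / 2)) *: v y.
Proof.
move=> Xy; exact: (bracket_xi_u oX sg sxi seta gsym' gunit' eta_xi' de nxi sB
  slam lam_gt0 dlam lieB su Bu Bv hu Au etau guu gvv guv frame_span Xy).
Qed.

Lemma frame_xi_v y : X y ->
  lie_bracket xi v y = (m y / 2) *: u y + (- (lam y + 1)) *: v y.
Proof.
move=> Xy; exact: (bracket_xi_v oX sphi sg sxi seta gsym' gunit' eta_xi' de nxi sB
  slam lam_gt0 dlam lieB su (fun _ _ => erefl) phiv Bu Bv hu Au etau guu gvv guv
  frame_span Xy).
Qed.

Lemma frame_u_v y : X y -> lie_bracket u v y = 0.
Proof.
move=> Xy; exact: (bracket_u_v oX sg seta gsym' gunit' de sA slam lam_gt0 dlam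
  su sv Au Av etau etav guu gvv guv frame_span curv_uv Xy).
Qed.

(** [d/dx_i] is tangent to the leaves, hence a combination of [u] and [v],
    which annihilate [mu]. *)
Lemma partial_mu y i : X y -> i != it -> partial i m y = 0.
Proof.
move=> Xy ni.
have [du dv] := dmu_uv oX sphi sg sxi seta gsym' gunit' eta_xi' de nxi sA sB
  slam smu lam_gt0 dlam lieB su sv (fun _ _ => erefl) phiv Bu Bv hu Au Av etau etav
  guu gvv guv frame_span curv_uv Xy.
have -> : partial i m y = (d0 m y *m (delta_mx i 0 : 'cV[R]_3)) 0 0 by rewrite -colE !mxE.
rewrite [delta_mx i 0](frame_span Xy) (Eeta (XO Xy)) dx_mul.
rewrite [in X in _ + X *: _]mxE eq_sym (negPf ni) scale0r addr0.
by rewrite mulmxDr -!scalemxAr mxE mxE du [X in _ + X]mxE dv !mulr0 addr0.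
Qed.

End EigenFrame.

Section FunctionOfTime.
Context {R : realType}.

(** Integrate along the segment from [y] to its projection to the line through
    the centre in the direction of [t]; the segment lies in the box and in a leaf. *)
Lemma box_function_it (f : 'rV[R]_3 -> R) y0 r : Ck 1 (box y0 r) f ->
  (forall i y, i != it -> box y0 r y -> partial i f y = 0) ->
  forall y, box y0 r y -> f y = f (y0 + (y 0 it - y0 0 it) *: dx R it).
Proof.
move=> kf df y yr; pose z : 'rV[R]_3 := y0 + (y 0 it - y0 0 it) *: dx R it.
have zE i : z 0 i = if i == it then y 0 it else y0 0 i.
  rewrite !mxE /=; case: eqP => [->|_]; last by rewrite mulr0 addr0.
  by rewrite mulr1 addrC subrK.
have H (s : R) : 0 <= s <= 1 -> is_derive s 1 (fun t => f (z + t *: (y - z))) 0.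
  move=> /andP[s0 s1].
  have zs : box y0 r (z + s *: (y - z)).
    move=> i; have := yr i.
    have -> : (z + s *: (y - z)) 0 i = z 0 i + s * (y 0 i - z 0 i).
      by rewrite mxE [X in _ + X]mxE [X in _ * X]mxE [X in _ * (_ + X)]mxE.
    rewrite zE; case: eqP => [-> yi|_ yi]; first by rewrite subrr mulr0 addr0.
    rewrite addrAC subrr add0r normrM; apply: le_lt_trans yi.
    by rewrite ger0_norm // ler_piMl.
  have := is_derive_line (@box_open R 3 y0 r) kf zs.
  rewrite (_ : \sum_i _ = 0) // big1 // => i _.
  have [->|ni] := eqVneq i it; last by rewrite df // mul0r.
  by rewrite [X in _ * X]mxE [X in _ * (_ + X)]mxE zE eqxx subrr mulr0.
have H' (s : R) : Num.min 0 1 <= s <= Num.max 0 1 ->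
    is_derive s 1 (fun t => f (z + t *: (y - z))) 0.
  by rewrite minElt maxElt ltr01 => /H.
have := derive_zero_const H'.
by rewrite scale1r scale0r addr0 [z + _]addrC subrK.
Qed.

End FunctionOfTime.

(** * The differential equation for the coframe *)

Section LocalODE.
Context {R : realType}.

(** Outside a smaller interval the coefficients are replaced by their values
    at its end points, which makes them bounded and globally continuous. *)
Lemma linear_ode_local {n : nat} (A : 'I_n -> 'I_n -> R -> R) (t0 r0 : R)
    (c : 'I_n -> R) : 0 < r0 ->
  (forall i j s, `|s - t0| < r0 -> {for s, continuous (A i j)}) ->
  exists r (y : 'I_n -> R -> R), [/\ 0 < r, r <= r0,
    forall i, y i t0 = c i &
    forall i (s : R), `|s - t0| < r ->
      is_derive s 1 (y i) (\sum_j A i j s * y j s)].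
Proof.
move=> r00 cA.
have near_t0 (ij : 'I_n * 'I_n) : exists2 r, 0 < r & forall s, `|s - t0| < r ->
    `|A ij.1 ij.2 s| <= `|A ij.1 ij.2 t0| + 1.
  have c0 : A ij.1 ij.2 s @[s --> t0] --> A ij.1 ij.2 t0.
    by apply: (cA ij.1 ij.2 t0); rewrite subrr normr0.
  have /cvgrPdist_lt/(_ 1 ltr01)/nbhs_ballP[r /= rp Hr] := c0.
  exists r => // s sr; have : `|A ij.1 ij.2 t0 - A ij.1 ij.2 s| < 1.
    by apply: Hr; rewrite /ball /= distrC.
  by rewrite distrC => /ltW; have := lerB_dist (A ij.1 ij.2 s) (A ij.1 ij.2 t0); lra.
have [r1 [r10 r1r0 Hr1]] : exists r, [/\ 0 < r, r <= r0 & forall ij : 'I_n * 'I_n,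
    forall s, `|s - t0| < r -> `|A ij.1 ij.2 s| <= `|A ij.1 ij.2 t0| + 1].
  apply: (common_radius r00 near_t0) => ij r s sr H t ts; apply: H.
  exact: lt_le_trans ts sr.
pose d := r1 / 2; have d0 : 0 < d by rewrite divr_gt0.
pose cl (s : R) := Num.max (t0 - d) (Num.min (t0 + d) s).
have clr s : `|cl s - t0| < r1.
  rewrite /cl /d ltr_norml; case: (leP (t0 + r1 / 2) s) => ?; case: (leP (t0 - r1 / 2)) => ?;
    apply/andP; split; lra.
have cl_id s : `|s - t0| < d -> cl s = s.
  rewrite /cl ltr_norml => /andP[? ?].
  case: (leP (t0 + d) s) => ?; case: (leP (t0 - d)) => ?; lra.
have cl_cont s : {for s, continuous cl}.
  apply: (@continuous_max _ _ (fun=> t0 - d) (fun s => Num.min (t0 + d) s) s).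
    exact: cst_continuous.
  apply: (@continuous_min _ _ (fun=> t0 + d) id s); first exact: cst_continuous.
  exact: cvg_id.
have [i j s|i j s|r [y [r0' y0 dy]]] := linear_ode
  (A := fun i j s => A i j (cl s)) (N := 1 + \sum_i \sum_j `|A i j t0|) t0 c.
- apply: (@continuous_comp _ _ _ cl (A i j)) => //.
  by apply: cA; apply: lt_le_trans r1r0.
- apply: (le_trans (Hr1 (i, j) _ (clr s))) => /=; rewrite addrC lerD2l.
  rewrite (bigD1 i) //= (bigD1 j) //= -addrA lerDl addr_ge0 //.
    by apply: sumr_ge0.
  by apply: sumr_ge0 => k _; apply: sumr_ge0.
exists (Num.min r d), y; split => //.
- by rewrite lt_min r0' d0.
- by rewrite ge_min; apply/orP; right; rewrite /d; lra.
- move=> i s; rewrite lt_min => /andP[sr sd].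
  by have := dy i s sr; rewrite cl_id.
Qed.

Lemma I2P (i : 'I_2) : i = 0 \/ i = 1.
Proof. by case: i => -[|[|//]] ?; [left|right]; apply: val_inj. Qed.

Lemma det2 (A : 'M[R]_2) : \det A = A 0 0 * A 1 1 - A 0 1 * A 1 0.
Proof.
have l01 : lift 0 0 = 1 :> 'I_2 by exact: val_inj.
have l10 : lift 1 0 = 0 :> 'I_2 by exact: val_inj.
rewrite (expand_det_row _ 0) big_ord_recl big_ord1 l01 /cofactor !det_mx11.
rewrite 2!(mxE _ _ (0 : 'I_1) (0 : 'I_1)) 2!(mxE _ _ _ (0 : 'I_1)) l01 l10.
have o0 : ord0 = 0 :> 'I_2 by exact: val_inj.
by rewrite o0 /= addn0 expr0 expr1 mul1r mulN1r mulrN.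
Qed.

(** The coefficients come from the brackets of [xi] with the frame; the trace
    [-2] of the system gives the determinant. *)
Lemma frame_ode (m : R -> R) (t0 r0 : R) : 0 < r0 ->
  (forall s, `|s - t0| < r0 -> {for s, continuous m}) ->
  exists r (P : R -> 'M[R]_2), [/\ 0 < r, r <= r0,
    forall (s : R) i, `|s - t0| < r -> is_derive s 1 (fun s => P s i 0)
      ((expR (- 2 * s) - 1) * P s i 0 + - (m s / 2) * P s i 1),
    forall (s : R) i, `|s - t0| < r -> is_derive s 1 (fun s => P s i 1)
      (m s / 2 * P s i 0 + - (expR (- 2 * s) + 1) * P s i 1) &
    forall s : R, `|s - t0| < r -> \det (P s) = - expR (- 2 * s)].
Proof.
move=> r00 cm.
pose A (i j : 'I_2) (s : R) : R :=
  if i == 0 then (if j == 0 then expR (- 2 * s) - 1 else - (m s / 2))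
  else (if j == 0 then m s / 2 else - (expR (- 2 * s) + 1)).
have dexp (s : R) : is_derive s 1 (fun s => expR (- 2 * s)) (- 2 * expR (- 2 * s)).
  have d1 : is_derive s 1 (fun s : R => - 2 * s) (- 2 * 1).
    exact: (is_deriveZ (- 2 : R) (is_derive_id s 1)).
  have := is_derive_comp1 d1 (is_derive_expR (- 2 * s)).
  by rewrite mulr1 mulrC.
have cexp (s : R) : {for s, continuous (fun s : R => expR (- 2 * s))}.
  exact: is_derive_continuous (dexp s).
have cA i j s : `|s - t0| < r0 -> {for s, continuous (A i j)}.
  move=> /cm cms.
  have c2 : {for s, continuous (fun s : R => m s / 2)}.
    by apply: (@continuousM _ _ m (fun=> 2^-1)) => //; apply: cst_continuous.
  have [->|->] := I2P i; have [->|->] := I2P j; rewrite /A /=.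
  - exact: (@continuousB R R^o R (fun s : R => expR (- 2 * s)) (fun=> 1) s (cexp s)
      (@cst_continuous R R 1 s)).
  - exact: (@continuousN R R^o R (fun s : R => m s / 2) s c2).
  - exact: c2.
  - apply: (@continuousN R R^o R (fun s : R => expR (- 2 * s) + 1) s).
    exact: (@continuousD R R^o R (fun s : R => expR (- 2 * s)) (fun=> 1) s (cexp s)
      (@cst_continuous R R 1 s)).
have [r1 [y [r10 r1r0 y0 dy]]] :=
  linear_ode_local (fun j : 'I_2 => (j == 0)%:R) r00 cA.
have [r2 [z [r20 r2r0 z0 dz]]] :=
  linear_ode_local (fun j : 'I_2 => if j == 0 then 0 else - expR (- 2 * t0)) r00 cA.
pose r := Num.min r1 r2.
pose P s : 'M[R]_2 := \matrix_(i, j) (if i == 0 then y j s else z j s).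
have PE i j : (fun s : R => P s i j) = (if i == 0 then y j else z j).
  by apply/funext => s; rewrite mxE; case: (i == 0).
have PE' s i j : P s i j = if i == 0 then y j s else z j s by rewrite mxE.
have dP (s : R) i j : `|s - t0| < r -> is_derive s 1 (fun s : R => P s i j)
    (A j 0 s * P s i 0 + A j 1 s * P s i 1).
  rewrite lt_min => /andP[s1 s2]; rewrite PE !PE'.
  case: (i == 0).
    by have := dy j s s1; rewrite big_ord_recl big_ord1 (_ : lift _ _ = 1) //; apply: val_inj.
  by have := dz j s s2; rewrite big_ord_recl big_ord1 (_ : lift _ _ = 1) //; apply: val_inj.
exists r, P; split => //.
- by rewrite lt_min r10.
- by rewrite ge_min r1r0.
- by move=> s i sr; exact: (dP s i 0 sr).
- by move=> s i sr; exact: (dP s i 1 sr).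
move=> s sr.
pose D (s : R) := P s 0 0 * P s 1 1 - P s 0 1 * P s 1 0.
have detE : \det (P s) = D s by exact: det2.
have dexp' (s' : R) : is_derive s' 1 (fun s : R => expR (2 * s)) (2 * expR (2 * s')).
  have d1 : is_derive s' 1 (fun s : R => 2 * s) (2 * 1).
    exact: (is_deriveZ (2 : R) (is_derive_id s' 1)).
  have := is_derive_comp1 d1 (is_derive_expR (2 * s')).
  by rewrite mulr1 mulrC.
have dD (s' : R) : `|s' - t0| < r ->
    is_derive s' 1 (fun s : R => D s * expR (2 * s)) 0.
  move=> sr'.
  have d1 := is_deriveM (dP s' 0 0 sr') (dP s' 1 1 sr').
  have d2 := is_deriveM (dP s' 0 1 sr') (dP s' 1 0 sr').
  apply: (is_derive_eq (is_deriveM (is_deriveB d1 d2) (dexp' s'))).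
  rewrite /GRing.scale /= !fctE /A /=.
  move: (P s' 0 0) (P s' 0 1) (P s' 1 0) (P s' 1 1) (expR (- 2 * s')) (m s')
    (expR (2 * s')) => a b c d e f k.
  by field.
have D0 : D t0 = - expR (- 2 * t0).
  by rewrite /D !PE' /= !y0 !z0 /= mul0r subr0 mul1r.
have : D s * expR (2 * s) = D t0 * expR (2 * t0).
  apply: (derive_zero_const (g := fun s : R => D s * expR (2 * s))) => s' Hs'.
  apply: dD; move: sr Hs'; clear; rewrite !ltr_norml => /andP[? ?].
  by case: (leP t0 s) => ? /andP[? ?]; apply/andP; split; lra.
have e1 (c : R) : expR (- 2 * c) * expR (2 * c) = 1.
  by rewrite mulNr expRN mulVf // gt_eqF // expR_gt0.
rewrite D0 [RHS]mulNr e1 => E.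
rewrite detE -[LHS]mulr1 -[X in _ * X](e1 s) mulrCA.
by move: E; move: (D s) (expR (2 * s)) => a k ->; rewrite mulrN1.
Qed.

End LocalODE.

(** * A closed coframe *)

Lemma bdiag_col_ul {R : realType} (A : 'M[R]_2) a (i j : 'I_2) :
  (bdiag A a *m (delta_mx (lshift 1 j) 0 : 'cV_3)) (lshift 1 i) 0 = A i j.
Proof. by rewrite -colE mxE bdiag_ul. Qed.

Lemma bdiag_col_dl {R : realType} (A : 'M[R]_2) a (j : 'I_2) :
  (bdiag A a *m (delta_mx (lshift 1 j) 0 : 'cV_3)) it 0 = 0.
Proof. by rewrite -colE mxE it_rshift bdiag_dl. Qed.

Lemma bdiag_comb0 {R : realType} (A B : 'M[R]_2) a b (j j1 j2 : 'I_2) (c1 c2 : R) :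
  (forall i, A i j = c1 * B i j1 + c2 * B i j2) ->
  bdiag A a *m (delta_mx (lshift 1 j) 0 : 'cV_3) -
  (c1 *: (bdiag B b *m (delta_mx (lshift 1 j1) 0 : 'cV_3)) +
   c2 *: (bdiag B b *m (delta_mx (lshift 1 j2) 0 : 'cV_3))) = 0.
Proof.
move=> H; set p := bdiag A a *m _; set q := bdiag B b *m _; set s := bdiag B b *m _.
have {}H i : p i 0 = c1 * q i 0 + c2 * s i 0.
  have [[i' ->]|->] := I3_case i; last by rewrite !bdiag_col_dl !mulr0 addr0.
  by rewrite !bdiag_col_ul.
apply/colP => i; move: {H}(H i); move: p q s => p q s H.
by rewrite !mxE H subrr.
Qed.

Section ClosedCoframe.
Context {R : realType} {M : manifold R 3}.
Variable S : almost_contact_metric M.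
Variables (kappa mu : M -> R).
Hypothesis mu_smooth : smooth_fun mu.
Hypothesis AK : almost_kenmotsu S.
Hypothesis KM : kappa_mu_condition S kappa mu.
Variable b : chart R 3 M.
Hypothesis Ab : atlas M b.

Local Notation phi := (acm_phi S b).
Local Notation g := (acm_g S b).
Local Notation xi := (acm_xi S b).
Local Notation eta := (acm_eta S b).
Local Notation B := (Bten phi xi).
Local Notation m := (fun y => mu (param b y)).
Local Notation lam := (fun y : 'rV[R]_3 => expR (- 2 * y 0 it)).

Hypothesis Eeta : forall y, img b y -> eta y = dx R it.

Variables (y0 : 'rV[R]_3) (r : R) (u : 'rV[R]_3 -> 'cV[R]_3).
Hypothesis r0 : 0 < r.
Local Notation X := (box y0 r).
Hypothesis XO : X `<=` img b.
Hypothesis su : smoothm X u.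
Hypothesis Hu : forall y, X y -> [/\ B y *m u y = lam y *: u y,
  eta y *m u y = 0 & bil (g y) (u y) (u y) = 1].
Local Notation v := (framev S b u).
Local Notation E := (frame S b u).

Let oX : open X := @box_open R 3 y0 r.
Let t0 := y0 0 it.

Definition time_mu (s : R) : R := m (y0 + (s - y0 0 it) *: dx R it).

Lemma mu_time y : X y -> m y = time_mu (y 0 it).
Proof.
apply: (@box_function_it _ (fun y => mu (param b y))).
  exact: (Ck_sub XO (mu_smooth Ab 1%N)).
by move=> i z ni Xz; exact: (partial_mu mu_smooth AK KM Ab Eeta oX XO su Hu Xz ni).
Qed.

Lemma time_mu_continuous (s : R) : `|s - y0 0 it| < r -> {for s, continuous time_mu}.
Proof.
move=> sr; pose G (s : R) := y0 + (s - y0 0 it) *: dx R it.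
have XG : X (G s).
  move=> i; rewrite mxE addrAC subrr add0r !mxE /=.
  by case: (i == it); rewrite ?mulr1 // mulr0 normr0.
have dG i : is_derive s 1 (fun t : R => G t 0 i) (dx R it 0 i).
  rewrite (_ : (fun t => _) = (fun t : R => dx R it 0 i * t + (y0 0 i - y0 0 it * dx R it 0 i))).
    apply: (is_derive_eq (is_deriveD (is_deriveZ (dx R it 0 i) (is_derive_id s 1))
      (is_derive_cst (y0 0 i - y0 0 it * dx R it 0 i) s 1))).
    by rewrite /GRing.scale /= mulr1 addr0.
  by apply/funext => t; rewrite /G mxE [X in _ + X]mxE; ring.
exact: (is_derive_continuous (chain_line oX (Ck_sub XO (mu_smooth Ab 1%N)) XG dG)).
Qed.

Let smu : smooth_on X m.
Proof. by move=> k; apply: Ck_sub XO (mu_smooth Ab k). Qed.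

Variables (r1 : R) (P : R -> 'M[R]_2).
Hypothesis r10 : 0 < r1.
Hypothesis r1r : r1 <= r.
Hypothesis dP0 : forall (s : R) i, `|s - t0| < r1 -> is_derive s 1 (fun s => P s i 0)
  ((expR (- 2 * s) - 1) * P s i 0 + - (time_mu s / 2) * P s i 1).
Hypothesis dP1 : forall (s : R) i, `|s - t0| < r1 -> is_derive s 1 (fun s => P s i 1)
  (time_mu s / 2 * P s i 0 + - (expR (- 2 * s) + 1) * P s i 1).
Local Notation Y := (box y0 r1).
Let oY : open Y := @box_open R 3 y0 r1.
Let YX : Y `<=` X := box_sub r1r.

Let Yit y : Y y -> `|y 0 it - t0| < r1. Proof. by move/(_ it). Qed.

(** By induction on the order, the differential equation expressing the
    derivative of [P] by [P] and smooth functions. *)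
Lemma smooth_P k i j : Ck k Y (fun y => P (y 0 it) i j).
Proof.
elim: k i j => [|k IH] i j.
  split=> // y /Yit yt.
  apply: (@continuous_comp _ _ _ (fun y : 'rV[R]_3 => y 0 it) (fun s => P s i j)).
    exact: coord_cont.
  have [->|->] := I2P j; [exact: is_derive_continuous (dP0 i yt)|].
  exact: is_derive_continuous (dP1 i yt).
have kc := Ck_coord k.+1 it oY.
have kl : Ck k Y lam by exact: (Ck_sub (subset_trans YX XO) (smooth_lam b it k)).
have km : Ck k Y (fun y => time_mu (y 0 it)).
  by apply: (Ck_ext oY _ (Ck_sub YX (smu k))) => y /YX/mu_time.
have km2 : Ck k Y (fun y => time_mu (y 0 it) / 2).
  exact: (CkM km (Ck_cst k Y 2^-1) oY).
have [->|->] := I2P j.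
  apply: (Ck_comp1 oY (D := [set s : R | `|s - t0| < r1]) (fun s => @dP0 s i) Yit kc).
  apply: (CkD (CkM (CkB kl (Ck_cst k Y 1) oY) (IH i 0) oY)
    (CkM (CkN km2 oY) (IH i 1) oY) oY).
apply: (Ck_comp1 oY (D := [set s : R | `|s - t0| < r1]) (fun s => @dP1 s i) Yit kc).
apply: (CkD (CkM km2 (IH i 0) oY)
  (CkM (CkN (CkD kl (Ck_cst k Y 1) oY) oY) (IH i 1) oY) oY).
Qed.

Local Notation bP := (fun y : 'rV[R]_3 => bdiag (P (y 0 it)) 1).

Lemma smooth_bP : smoothm Y bP.
Proof.
move=> k i j; have [[i' ->]|->] := I3_case i; have [[j' ->]|->] := I3_case j.
- by apply: (Ck_ext oY _ (smooth_P k i' j')) => y _; rewrite bdiag_ul.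
- by apply: (Ck_ext oY _ (Ck_cst k Y 0)) => y _; rewrite it_rshift bdiag_ur.
- by apply: (Ck_ext oY _ (Ck_cst k Y 0)) => y _; rewrite [it in RHS]it_rshift bdiag_dl.
- by apply: (Ck_ext oY _ (Ck_cst k Y 1)) => y _; rewrite it_rshift bdiag_dr.
Qed.

Lemma smooth_frame : smoothm X E.
Proof.
move=> k i j.
apply: (Ck_ext oX (f := fun y => (if j == ix1 then u y else
    if j == ix2 then v y else xi y) i 0)).
  by move=> y _; rewrite mxE.
case: (j == ix1); first exact: su.
case: (j == ix2); last exact: (smoothm_sub XO (acm_sxi S Ab)).
exact: (smoothmM oX (smoothm_sub XO (acm_sphi S Ab)) su).
Qed.

(** With [E] the matrix whose columns are [u, v, xi], the rows of [bP E^T g] are the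
    1-forms whose values on these fields are the entries of [bP]. *)
Definition coframe y : 'M[R]_3 := bP y *m ((E y)^T *m g y).

Lemma coframe_frame y : X y -> coframe y *m E y = bP y.
Proof.
move=> Xy; rewrite -mulmxA (frame_orthonormal Ab XO Hu Xy).
by rewrite mulmx1.
Qed.

Lemma smooth_coframe : smoothm Y coframe.
Proof.
apply: (smoothmM oY smooth_bP); apply: (smoothmM oY).
  exact: (smoothm_tr oY (smoothm_sub YX smooth_frame)).
exact: (smoothm_sub (subset_trans YX XO) (acm_sg S Ab)).
Qed.

Lemma coframe_it y : Y y -> row it (coframe y) = dx R it.
Proof.
move=> Yy; have Xy := YX Yy.
rewrite rowE /coframe mulmxA -/(dx R it).
have -> : dx R it *m bP y = dx R it.
  apply/rowP => j; rewrite -rowE mxE; have [[j' ->]|->] := I3_case j.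
    by rewrite [RHS]mxE lshift_it andbF it_rshift bdiag_dl.
  by rewrite [RHS]mxE !eqxx it_rshift bdiag_dr.
rewrite mulmxA -[dx R it *m _](trmxK _) trmx_mul trmxK.
have -> : (dx R it)^T = ddx R it by rewrite trmx_delta.
rewrite frame3 -(acm_gsym S Ab (XO Xy)) -trmx_mul (acm_g_xi S Ab (XO Xy)) trmxK.
by rewrite Eeta //; apply: XO.
Qed.

(** The three brackets of the frame, together with the differential equation
    for [P], are what closedness of the coframe amounts to. *)
Lemma coframe_closed y : Y y -> forall w z : 'cV[R]_3,
  dird w coframe y *m z = dird z coframe y *m w.
Proof.
move=> Yy; have Xy := YX Yy; have Oy := XO Xy.
have sC := smooth_coframe; have sE := smoothm_sub YX smooth_frame.
pose K w z := dird w coframe y *m z - dird z coframe y *m w.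
have KC w z : K w z = - K z w by rewrite /K opprB.
have Klin a w w' z : K (a *: w + w') z = a *: K w z + K w' z.
  rewrite /K dird_lin mulmxDl mulmxDr -scalemxAl -scalemxAr.
  move: (dird w coframe y *m z) (dird w' coframe y *m z) (dird z coframe y *m w)
    (dird z coframe y *m w') => p q s t.
  by apply/colP => i; rewrite !mxE; ring.
have sX (Z : 'rV[R]_3 -> 'cV[R]_3) e : (forall z, E z *m e = Z z) -> smoothm Y Z.
  move=> EZ; apply: (smoothm_ext oY (A := fun z => E z *m e) (fun z _ => EZ z)).
  exact: (smoothmM oY sE (smoothm_cst Y e)).
have D (Z : 'rV[R]_3 -> 'cV[R]_3) e w : (forall z, E z *m e = Z z) ->
    dird w coframe y *m Z y =
    w it 0 *: (bdiag (deriv_mx P (y 0 it)) 0 *m e) - coframe y *m (dv Z y *m w).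
  move=> EZ; have := dirdM w oY (sC 1%N) (sX Z e EZ 1%N) Yy.
  rewrite -(dird_ext w oY Yy (A := fun z => bP z *m e)); last first.
    by move=> z Yz; rewrite -EZ mulmxA coframe_frame //; apply: YX.
  rewrite (dirdM w oY (smooth_bP 1%N) (Ckm_cst 1 Y e) Yy) dird_cst mulmx0 addr0.
  by rewrite dird_bdiag -scalemxAl dird_dv => ->; rewrite addrK.
have KE (Z W : 'rV[R]_3 -> 'cV[R]_3) e f : (forall z, E z *m e = Z z) ->
    (forall z, E z *m f = W z) -> K (Z y) (W y) =
    Z y it 0 *: (bdiag (deriv_mx P (y 0 it)) 0 *m f)
    - W y it 0 *: (bdiag (deriv_mx P (y 0 it)) 0 *m e)
    - coframe y *m lie_bracket Z W y.
  move=> EZ EW; rewrite /K (D Z e) // (D W f) // lie_bracketE mulmxBr.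
  move: (coframe y *m (dv W y *m Z y)) (coframe y *m (dv Z y *m W y))
    (Z y it 0 *: _) (W y it 0 *: _) => p q s t.
  by apply/colP => i; rewrite !mxE; ring.
have [_ etau _] := Hu Xy.
have uit : u y it 0 = 0 by rewrite -dx_mul -(Eeta Oy) etau mxE.
have vit : v y it 0 = 0.
  by rewrite -dx_mul -(Eeta Oy) mulmxA (acm_eta_phi S Ab Oy) mul0mx mxE.
have xit : xi y it 0 = 1.
  by rewrite -dx_mul -(Eeta Oy) (acm_eta_xi S Ab Oy) mxE eqxx.
have E1 z := frame1 S b u z; have E2 z := frame2 S b u z; have E3 z := frame3 S b u z.
have Cu : coframe y *m u y = bP y *m delta_mx ix1 0.
  by rewrite -E1 mulmxA coframe_frame.
have Cv : coframe y *m v y = bP y *m delta_mx ix2 0.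
  by rewrite -E2 mulmxA coframe_frame.
have dPE i : deriv_mx P (y 0 it) i 0 = (lam y - 1) * P (y 0 it) i 0 +
    - (m y / 2) * P (y 0 it) i 1.
  by rewrite mxE (mu_time Xy); have [_ ->] := dP0 i (Yit Yy).
have dPE' i : deriv_mx P (y 0 it) i 1 = m y / 2 * P (y 0 it) i 0 +
    - (lam y + 1) * P (y 0 it) i 1.
  by rewrite mxE (mu_time Xy); have [_ ->] := dP1 i (Yit Yy).
have x1 : ix1 = lshift 1 (0 : 'I_2) :> 'I_3 by exact: val_inj.
have x2 : ix2 = lshift 1 (1 : 'I_2) :> 'I_3 by exact: val_inj.
have Kuv : K (u y) (v y) = 0.
  rewrite (KE u v _ _ E1 E2) uit vit !scale0r subr0.
  by rewrite (frame_u_v AK KM Ab Eeta oX XO su Hu Xy) mulmx0 subr0.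
have Kxu : K (xi y) (u y) = 0.
  rewrite (KE xi u _ _ E3 E1) uit xit scale0r scale1r subr0.
  rewrite (frame_xi_u AK KM Ab Eeta oX XO su Hu Xy) mulmxDr -!scalemxAr Cu Cv.
  rewrite x1 x2.
  exact: (bdiag_comb0 0 1 dPE).
have Kxv : K (xi y) (v y) = 0.
  rewrite (KE xi v _ _ E3 E2) vit xit scale0r scale1r subr0.
  rewrite (frame_xi_v AK KM Ab Eeta oX XO su Hu Xy) mulmxDr -!scalemxAr Cu Cv.
  rewrite x1 x2.
  exact: (bdiag_comb0 0 1 dPE').
have Kxx z : K z z = 0 by rewrite /K subrr.
have span0 z : K (u y) z = 0 -> K (v y) z = 0 -> K (xi y) z = 0 -> forall w, K w z = 0.
  have K00 : K 0 z = 0 by rewrite /K dird_sum big1 ?mul0mx ?mulmx0 ?subrr // => i _;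
    rewrite mxE scale0r.
  move=> zu zv zx w; rewrite (frame_span Ab XO Hu Xy w).
  rewrite -addrA Klin zu scaler0 add0r Klin zv scaler0 add0r.
  by rewrite -[_ *: _]addr0 Klin zx scaler0 add0r.
have Kvu : K (v y) (u y) = 0 by rewrite KC Kuv oppr0.
have Kux : K (u y) (xi y) = 0 by rewrite KC Kxu oppr0.
have Kvx : K (v y) (xi y) = 0 by rewrite KC Kxv oppr0.
have K0 w z : K w z = 0.
  by apply: (span0 z); rewrite KC; apply/eqP; rewrite oppr_eq0; apply/eqP; apply: (span0 _).
by move=> w z; apply/eqP; rewrite -subr_eq0 -/(K w z) K0.
Qed.

(** The Poincare lemma for the first two forms of the coframe; the third one is
    [dt]. *)
Lemma coframe_exact : exists r2 (F : 'rV[R]_3 -> 'rV[R]_3),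
  [/\ 0 < r2, r2 <= r1, smoothm (box y0 r2) F,
    forall y, box y0 r2 y -> jac F y = coframe y &
    forall y, F y 0 it = y 0 it].
Proof.
have sC := smooth_coframe.
have P1 a : exists f q, [/\ 0 < q, box y0 q `<=` Y,
    forall i x, box y0 q x -> is_derive x (delta_mx 0 i) f (coframe x a i) &
    forall k, Ck k (box y0 q) f].
  apply: (poincare (theta := fun i x => coframe x a i) oY (box_center y0 r10)).
    by move=> k i; exact: sC.
  move=> i j x Yx.
  have E k l : partial k (fun z => coframe z a l) x = pd k coframe x a l.
    by rewrite mxE.
  rewrite (E i j) (E j i).
  have := coframe_closed Yx (delta_mx i 0) (delta_mx j 0).
  rewrite (dird_delta i coframe) (dird_delta j coframe).
  move: (pd i coframe x) (pd j coframe x) => p q.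
  by rewrite -2!colE => /colP/(_ a); rewrite !mxE.
have [f1 [q1 [q10 q1Y df1 sf1]]] := P1 ix1.
have [f2 [q2 [q20 q2Y df2 sf2]]] := P1 ix2.
pose q := Num.min r1 (Num.min q1 q2).
have qr1 : q <= r1 by rewrite ge_min lexx.
have qq1 : q <= q1 by rewrite !ge_min lexx orbT.
have qq2 : q <= q2 by rewrite !ge_min lexx !orbT.
pose F (y : 'rV[R]_3) : 'rV[R]_3 :=
  \row_i (if i == ix1 then f1 y else if i == ix2 then f2 y else y 0 it).
exists q, F; split => //.
- by rewrite !lt_min r10 q10.
- move=> k i j.
  apply: (Ck_ext (@box_open R 3 y0 q) (f := fun y => if j == ix1 then f1 y else
      if j == ix2 then f2 y else y 0 it)).
    by move=> y _; rewrite mxE.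
  case: (j == ix1); first exact: Ck_sub (box_sub qq1) (sf1 k).
  case: (j == ix2); first exact: Ck_sub (box_sub qq2) (sf2 k).
  by apply: Ck_coord; exact: box_open.
- move=> y yq; apply/matrixP => i j; rewrite mxE.
  rewrite (_ : (fun z => F z 0 i) = (if i == ix1 then f1 else
      if i == ix2 then f2 else fun z => z 0 it)); last first.
    by apply/funext => z; rewrite mxE; do 2 case: ifP => // _.
  have [] := I3P i => ->; rewrite /=.
  + by have [_] := df1 j y (box_sub qq1 yq).
  + by have [_] := df2 j y (box_sub qq2 yq).
  + rewrite partial_coord; have /rowP/(_ j) := coframe_it (box_sub qr1 yq).
    by rewrite !mxE eqxx /= eq_sym => ->.
- by move=> y; rewrite mxE.
Qed.

End ClosedCoframe.

(** * Adapted charts *)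

Section Forward.
Context {R : realType} {M : manifold R 3}.
Variable S : almost_contact_metric M.
Variables (kappa mu : M -> R).
Hypothesis h_neq0 : forall c, atlas M c -> forall x, img c x -> acm_h S c x <> 0.
Hypothesis kappa_smooth : smooth_fun kappa.
Hypothesis mu_smooth : smooth_fun mu.
Hypothesis dkappa_eta : forall c, atlas M c -> forall x, img c x ->
  wedge11 (d0 (fun y => kappa (param c y)) x) (acm_eta S c x) = 0.
Hypothesis AK : almost_kenmotsu S.
Hypothesis KM : kappa_mu_condition S kappa mu.

Lemma ix1_lshift : ix1 = lshift 1 (0 : 'I_2) :> 'I_3.
Proof. exact: val_inj. Qed.

Lemma ix2_lshift : ix2 = lshift 1 (1 : 'I_2) :> 'I_3.
Proof. exact: val_inj. Qed.

Lemma bdiag_lshift (A : 'M[R]_2) a (j : 'I_2) :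
  bdiag A a *m (delta_mx (lshift 1 j) 0 : 'cV_3) =
  A 0 j *: delta_mx ix1 0 + A 1 j *: delta_mx ix2 0.
Proof.
rewrite [LHS]cV3E {1}ix1_lshift {1}ix2_lshift !bdiag_col_ul bdiag_col_dl.
by rewrite scale0r addr0.
Qed.

Lemma bdiag_ddx (A : 'M[R]_2) a : bdiag A a *m ddx R it = a *: ddx R it.
Proof.
rewrite /ddx -colE; apply/colP => i; rewrite mxE; have [[i' ->]|->] := I3_case i.
  by rewrite it_rshift bdiag_ur -it_rshift 2!mxE lshift_it mulr0.
by rewrite [in LHS]it_rshift bdiag_dr 2!mxE !eqxx mulr1.
Qed.

Lemma mx3_eq (A B : 'M[R]_3) :
  (forall j, A *m (delta_mx j 0 : 'cV_3) = B *m delta_mx j 0) -> A = B.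
Proof.
move=> H; apply/matrixP => i j; have /colP/(_ i) := H j.
by rewrite -!colE mxE [RHS]mxE.
Qed.

(** Rotation by a right angle: the matrix of [phi] in the basis [u, v]. *)
Definition quarter_turn : 'M[R]_2 := \matrix_(i, j) ((j < i)%N%:R - (i < j)%N%:R).

Lemma phi_frame b (X : set 'rV[R]_3) (u : 'rV[R]_3 -> 'cV[R]_3) y :
  atlas M b -> X `<=` img b ->
  (forall y, X y -> [/\ Bten (acm_phi S b) (acm_xi S b) y *m u y =
     expR (- 2 * y 0 it) *: u y,
     acm_eta S b y *m u y = 0 & bil (acm_g S b y) (u y) (u y) = 1]) ->
  X y -> acm_phi S b y *m frame S b u y = frame S b u y *m bdiag quarter_turn 0.
Proof.
move=> Ab XO Hu Xy.
have Oy := XO y Xy; apply: mx3_eq => j; rewrite -!mulmxA.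
have [] := I3P j => ->.
- rewrite frame1 ix1_lshift bdiag_lshift !mxE /= subrr scale0r add0r subr0 scale1r.
  by rewrite frame2.
- rewrite frame2 (phi_framev Ab XO Hu Xy) ix2_lshift bdiag_lshift !mxE /= subrr.
  by rewrite scale0r addr0 sub0r scaleN1r mulmxN frame1.
- rewrite -/(ddx R it) frame3 bdiag_ddx scale0r mulmx0.
  exact: acm_phi_xi.
Qed.

(** The jacobian matrix of the functions given by the coframe maps the frame
    [u, v, xi] to the columns of [bdiag P 1]; this yields all tensors in the new
    chart. *)
Lemma adapted_chart p : exists2 c, atlas M c & dom c p /\
  exists (P : R -> 'M[R]_2) (m : R -> R), forall q, dom c q ->
    let t := c q 0 it in
    [/\ kappa q = - 1 - expR (- 4 * t) /\ mu q = m t,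
        \det (P t) = - expR (- 2 * t),
        acm_xi S c (c q) = ddx R it /\ acm_eta S c (c q) = dx R it,
        acm_g S c (c q) = bdiag ((invmx (P t))^T *m invmx (P t)) 1 &
        acm_phi S c (c q) = bdiag (P t *m quarter_turn *m invmx (P t)) 0].
Proof.
have [b Ab [bp Eeta Eka]] :=
  time_chart h_neq0 kappa_smooth dkappa_eta AK KM it p.
have [r [u [r0 XO su Hu]]] := unit_eigenfield h_neq0 AK KM Ab Eka (coord_img bp).
set y0 := b p in XO su Hu.
have [r1 [P [r10 r1r dP0 dP1 detP]]] := frame_ode r0
  (fun s sr => time_mu_continuous mu_smooth Ab r0 XO sr).
have [r2 [F [r20 r21 sF jF Fit]]] := coframe_exact mu_smooth AK KM Ab Eeta XO su Hu
  r10 r1r dP0 dP1.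
have r2r : r2 <= r := le_trans r21 r1r.
pose E := frame S b u; pose bP (y : 'rV[R]_3) := bdiag (P (y 0 it)) 1.
have Pu y : box y0 r2 y -> P (y 0 it) \in unitmx.
  move=> yr; rewrite unitmxE detP; last exact: (box_sub r21 yr).
  by rewrite unitfE oppr_eq0 gt_eqF ?expR_gt0.
have JE y : box y0 r2 y -> jac F y *m E y = bP y.
  by move=> yr; rewrite jF // (coframe_frame Ab XO Hu P (box_sub r2r yr)).
have Ju y : box y0 r2 y -> jac F y \in unitmx.
  move=> yr; have := bdiag_unit (Pu y yr) (oner_neq0 R).
  by rewrite -/(bP y) -JE // unitmx_mul => /andP[].
have [c Ac [cp Hc Jc]] := new_chart Ab bp (@box_open R 3 y0 r2)
  (box_center y0 r20) (subset_trans (box_sub r2r) XO) sF (Ju _ (box_center y0 r20)).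
exists c => //; split => //; exists P, (time_mu mu b y0) => q cq t.
have [bq q2 Fq] := Hc q cq; have Xq := box_sub r2r q2; have Oq := XO _ Xq.
have tE : t = b q 0 it by rewrite /t Fq Fit.
have Jq := Jc q cq; have oq := overlap_in bq cq.
have EgE : (E (b q))^T *m acm_g S b (b q) *m E (b q) = 1%:M.
  exact: (frame_orthonormal Ab XO Hu Xq).
have JEq := JE _ q2; rewrite /bP -tE in JEq.
have uQ : bdiag (P t) 1 \in unitmx.
  by rewrite tE; apply: bdiag_unit; [apply: Pu|apply: oner_neq0].
have iQ : invmx (bdiag (P t) 1) = bdiag (invmx (P t)) 1.
  by rewrite bdiag_inv ?invr1 ?oner_neq0 // tE; apply: Pu.
split.
- split; first by rewrite tE -(Eka _ Oq) coordK.
  by rewrite tE -(mu_time mu_smooth AK KM Ab Eeta XO su Hu Xq) coordK.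
- by rewrite tE; apply: detP; apply: (box_sub r21 q2).
- split.
    have := change_vf Ab Ac (acm_xi S) oq; rewrite change_coord // Jq => ->.
    by rewrite -(frame3 S b u) mulmxA JEq bdiag_ddx scale1r.
  have := change_of Ab Ac (acm_eta S) oq; rewrite change_coord // Jq => E1.
  apply: (can_inj (mulmxK (Ju _ q2))); rewrite E1 Eeta // jF //.
  by rewrite -rowE (coframe_it Ab Eeta _ XO _ r1r (box_sub r21 q2)).
- have := change_rm Ab Ac (acm_g S) oq; rewrite change_coord // Jq => E1.
  have : (bdiag (P t) 1)^T *m acm_g S c (c q) *m bdiag (P t) 1 = 1%:M.
    by rewrite -JEq trmx_mul -EgE -E1 !mulmxA.
  move: (acm_g S c (c q)) => G QGQ.
  have -> : G = (invmx (bdiag (P t) 1))^T *m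
      ((bdiag (P t) 1)^T *m G *m bdiag (P t) 1) *m invmx (bdiag (P t) 1).
    by rewrite !mulmxA -trmx_mul mulmxV // trmx1 mul1mx mulmxK.
  by rewrite QGQ mulmx1 iQ bdiagT bdiagM mulr1.
- have := change_t11 Ab Ac (acm_phi S) oq; rewrite change_coord // Jq => E1.
  have EQ : acm_phi S c (c q) *m bdiag (P t) 1 = bdiag (P t) 1 *m bdiag quarter_turn 0.
    by rewrite -JEq mulmxA E1 -mulmxA (phi_frame Ab XO Hu Xq) mulmxA.
  by rewrite -[LHS](mulmxK uQ) EQ iQ !bdiagM mulr0 mul0r.
Qed.

End Forward.

(** * The differential equations *)

Section AdaptedEquations.
Context {R : realType} {M : manifold R 3}.
Variable S : almost_contact_metric M.
Variables (kappa mu : M -> R).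
Hypothesis AK : almost_kenmotsu S.
Hypothesis KM : kappa_mu_condition S kappa mu.
Variable c : chart R 3 M.
Hypothesis Ac : atlas M c.

Local Notation phi := (acm_phi S c).
Local Notation g := (acm_g S c).
Local Notation xi := (acm_xi S c).
Local Notation eta := (acm_eta S c).
Local Notation O := (img c).
Local Notation h := (hten phi xi).
Local Notation B := (Bten phi xi).

Let oO : open O := @acm_oO R 3 M c.

Hypothesis Hxi : forall y, O y -> xi y = ddx R it.
Hypothesis Heta : forall y, O y -> eta y = dx R it.

(** Where a tensor field only depends on [t], its entries inherit
    differentiability from its smoothness, and [L_xi] is [d/dt]. *)
Lemma adapted_derive (T : 'rV[R]_3 -> 'M[R]_3) (T0 : R -> 'M[R]_2) a y (D : 'M[R]_2) :
  smoothm O T -> (forall z, O z -> T z = bdiag (T0 (z 0 it)) a) -> O y ->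
  lie_deriv11 xi T y = bdiag D 0 ->
  forall i j, is_derive (y 0 it) 1 (fun s => T0 s i j) (D i j).
Proof.
move=> sT HT Oy LD i j.
have E : deriv_mx T0 (y 0 it) = D.
  have : bdiag (deriv_mx T0 (y 0 it)) 0 = bdiag D 0.
    rewrite -LD (adapted_lie Hxi T Oy) -(pd_bdiag T0 a) -!dird_delta.
    by rewrite (dird_ext _ oO Oy HT).
  by case/bdiag_inj.
rewrite -E mxE; apply: DeriveDef => //.
apply: (@derivable_it R (fun s => T0 s i j)).
apply: (derivable_ext oO Oy (f := fun z => T z (lshift 1 i) (lshift 1 j))).
  by move=> z Oz; rewrite HT // bdiag_ul.
exact: (@Ck_derivable R 3 0 O (fun z => T z (lshift 1 i) (lshift 1 j)) y it
  (sT 1%N (lshift 1 i) (lshift 1 j)) Oy).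
Qed.

Lemma quarter_turn_conj (A : 'M[R]_2) : A^T *m quarter_turn *m A = \det A *: quarter_turn.
Proof.
apply/matrixP => i j; rewrite det2 !mxE.
under eq_bigr do rewrite mxE.
rewrite !big_ord_recl !big_ord0 !mxE.
have l01 : lift ord0 ord0 = 1 :> 'I_2 by exact: val_inj.
have l0 : ord0 = 0 :> 'I_2 by exact: val_inj.
rewrite l01 l0.
by have [->|->] := I2P i; have [->|->] := I2P j => /=; ring.
Qed.

Lemma wedge_bdiag : wedge11 (dx R ix1) (dx R ix2) = bdiag (- quarter_turn) 0.
Proof.
apply/matrixP => i j; rewrite mxE [dx R ix1 _ i]mxE [dx R ix2 _ j]mxE.
rewrite [dx R ix1 _ j]mxE [dx R ix2 _ i]mxE eqxx /=.
have [[i' ->]|->] := I3_case i; have [[j' ->]|->] := I3_case j.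
- rewrite bdiag_ul !mxE; have [->|->] := I2P i'; have [->|->] := I2P j' => /=; ring.
- rewrite [in RHS]it_rshift bdiag_ur /= ; ring.
- rewrite [in RHS]it_rshift bdiag_dl /= ; ring.
- rewrite [in RHS]it_rshift bdiag_dr /= ; ring.
Qed.

Variables (P : R -> 'M[R]_2) (m : R -> R).
Hypothesis HP : forall q, dom c q -> let t := c q 0 it in
  [/\ kappa q = - 1 - expR (- 4 * t) /\ mu q = m t,
      \det (P t) = - expR (- 2 * t),
      acm_xi S c (c q) = ddx R it /\ acm_eta S c (c q) = dx R it,
      acm_g S c (c q) = bdiag ((invmx (P t))^T *m invmx (P t)) 1 &
      acm_phi S c (c q) = bdiag (P t *m quarter_turn *m invmx (P t)) 0].

Let phi0 t := P t *m quarter_turn *m invmx (P t).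
Let h0 t := 2^-1 *: deriv_mx phi0 t.
Let B0 t := phi0 t *m h0 t.

Let Hphi y : O y -> phi y = bdiag (phi0 (y 0 it)) 0.
Proof. by move=> [q cq <-]; have [] := HP cq. Qed.

Let Hh y : O y -> h y = bdiag (h0 (y 0 it)) 0.
Proof.
move=> Oy; rewrite htenE (adapted_lie Hxi phi Oy) -dird_delta.
by rewrite (dird_ext _ oO Oy Hphi) dird_delta (pd_bdiag phi0 0) bdiagZ mulr0.
Qed.

Let HB y : O y -> B y = bdiag (B0 (y 0 it)) 0.
Proof. by move=> Oy; rewrite /Bten Hphi // Hh // bdiagM mulr0. Qed.

(** The Lie derivatives [L_xi phi = 2 h], [L_xi h] and [L_xi B] become the
    differential equations. *)
Lemma adapted_equations : exists phi0 g0 h0 B0 m,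
  forall q, dom c q -> adapted_at S kappa mu c phi0 g0 h0 B0 m q.
Proof.
exists phi0, (fun t => (invmx (P t))^T *m invmx (P t)), h0, B0, m => q cq.
rewrite /adapted_at; set t := c q 0 it; set lambda := expR (- 2 * t).
have [[kq mq] dq [xq eq] gq pq] := HP cq.
have Oq := coord_img cq.
have k1 : kappa q + 1 = - lambda ^+ 2.
  rewrite kq /lambda -/t -expRM_natl addrAC addNr add0r; congr (- expR _); ring.
have Ka := kappa_mu_Rxi AK KM Ac.
have uP : P t \in unitmx by rewrite unitmxE dq unitfE oppr_eq0 gt_eqF ?expR_gt0.
split => //.
- rewrite /acm_Phi gq pq bdiagM mul1r wedge_bdiag bdiagZ mulr0 -/t; congr (bdiag _ _).
  rewrite !mulmxA mulmxKV // quarter_turn_conj det_inv dq.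
  rewrite scalerN -scaleNr invrN -expRN; congr (- expR _ *: _); rewrite /t; ring.
- split; [by rewrite acm_hE Hh|by rewrite acm_BE HB|].
  have := Bten2 oO (acm_sphi S Ac) (acm_sg S Ac) (acm_sxi S Ac) (acm_seta S Ac)
    (acm_phi2' S Ac) (acm_eta_xi' S Ac) (acm_compat' S Ac) (acm_gsym S Ac)
    (acm_gpos S Ac) (acm_deta (AK Ac)) (acm_dPhi (AK Ac))
    (ka := fun y => kappa (param c y)) (mu := fun y => mu (param c y)) Ka Oq.
  rewrite HB // bdiagM mulr0 (acm_phi2' S Ac Oq) xq eq ddx_dx -bdiag1 bdiagN bdiagD.
  rewrite addNr addr0 coordK // bdiagZ mulr0 => /bdiag_inj[/matrixP E _] i j.
  have := E i j; rewrite !mxE => ->.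
  by rewrite kq -/t mulrN; case: (i == j); rewrite ?mulr0n ?mulr1n; ring.
- move=> i j; split.
  + have := adapted_derive (D := 2 *: h0 t) (acm_sphi S Ac) Hphi Oq _ i j.
    rewrite mxE; apply.
    by rewrite lie_phi Hh // bdiagZ mulr0.
  + have := adapted_derive (D := 2 * lambda ^+ 2 *: phi0 t - 2 *: h0 t - mu q *: B0 t)
      (acm_sh S Ac) Hh Oq _ i j.
    rewrite !mxE; apply.
    rewrite (lie_h oO (acm_sphi S Ac) (acm_sg S Ac) (acm_sxi S Ac) (acm_seta S Ac)
      (acm_phi2' S Ac) (acm_eta_xi' S Ac) (acm_compat' S Ac) (acm_gsym S Ac)
      (acm_gpos S Ac) (acm_deta (AK Ac)) (acm_dPhi (AK Ac))
      (ka := fun y => kappa (param c y)) (mu := fun y => mu (param c y)) Ka Oq).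
    rewrite Hphi // Hh // HB // coordK // k1 -/t !bdiagZ !bdiagN !bdiagD.
    by rewrite !mulr0 !oppr0 !addr0 mulrN opprK.
  + have := adapted_derive (D := mu q *: h0 t - 2 *: B0 t) (acm_sB S Ac) HB Oq _ i j.
    rewrite !mxE; apply.
    rewrite (lie_B oO (acm_sphi S Ac) (acm_sg S Ac) (acm_sxi S Ac) (acm_seta S Ac)
      (acm_phi2' S Ac) (acm_eta_xi' S Ac) (acm_compat' S Ac) (acm_gsym S Ac)
      (acm_gpos S Ac) (acm_deta (AK Ac)) (acm_dPhi (AK Ac))
      (ka := fun y => kappa (param c y)) (mu := fun y => mu (param c y)) Ka Oq).
    rewrite Hh // HB // coordK // -/t !bdiagZ bdiagN bdiagD.
    by rewrite !mulr0 oppr0 addr0.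
Qed.

End AdaptedEquations.

Theorem theorem6p1 (R : realType) (M : manifold R 3)
    (S : almost_contact_metric M)
    (h_neq0 : forall c, atlas M c -> forall x, img c x -> acm_h S c x <> 0)
    (kappa mu : M -> R)
    (kappa_smooth : smooth_fun kappa) (mu_smooth : smooth_fun mu)
    (dkappa_eta : forall c, atlas M c -> forall x, img c x ->
       wedge11 (d0 (fun y => kappa (param c y)) x) (acm_eta S c x) = 0) :
  generalized_kappa_mu S kappa mu <->
  forall p : M, exists2 c, atlas M c &
    dom c p /\
    exists (phi g h B : R -> 'M[R]_2) (m : R -> R),
      forall q : M, dom c q ->
        let t := c q 0 it in
        let lambda := expR (- 2 * t) in
        [/\ kappa q = - 1 - expR (- 4 * t) /\ mu q = m t,
            [/\ acm_phi S c (c q) = bdiag (phi t) 0,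
                acm_xi S c (c q) = ddx R it,
                acm_eta S c (c q) = dx R it &
                acm_g S c (c q) = bdiag (g t) 1],
            acm_Phi S c (c q) = expR (2 * t) *: wedge11 (dx R ix1) (dx R ix2),
            [/\ acm_h S c (c q) = bdiag (h t) 0,
                acm_B S c (c q) = bdiag (B t) 0 &
                forall i j : 'I_2, \sum_(s < 2) B t i s * B t s j =
                                   expR (- 4 * t) * (i == j)%:R] &
            forall i j : 'I_2,
              [/\ is_derive t 1 (fun s => phi s i j) (2 * h t i j),
                  is_derive t 1 (fun s => h s i j)
                    (2 * lambda ^+ 2 * phi t i j - 2 * h t i j
                     - mu q * B t i j) &
                  is_derive t 1 (fun s => B s i j)
                    (mu q * h t i j - 2 * B t i j)]].
Proof.
split=> [[AK sk sm KM] p|H].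
  have [c Ac [cp [P [m HP]]]] := adapted_chart h_neq0 kappa_smooth mu_smooth dkappa_eta AK KM p.
  exists c => //; split => //.
  apply: (adapted_equations AK KM Ac _ HP) => _ [q cq <-].
  by have [_ _ [-> _] _ _] := HP q cq.
by have [AK KM] := kappa_mu_of_adapted H.
Qed.
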